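(* For every integer $n\ge 2$, the Poincaré polynomial of $\overline{\mathcal{M}}_{0,n+1}$ is \[P_{\overline{\mathcal{M}}_{0,n+1}}(x) = \sum_{\lambda \vdash [n-1]} \frac{(n-1+\ell(\lambda))!}{(n-1)!} \prod_{i=1}^{\ell(\lambda)} \frac{ \overline{\chi}_{\lambda_i+1}(x)}{\lambda_i +1},\] where the sum is over all set partitions $\lambda$ of $[n-1]=\{1,\dots,n-1\}$ into $\ell(\lambda)$ nonempty blocks, $\lambda_i$ is the cardinality of the $i$-th block, and $\overline{\chi}_{m}(x) := (x-2)(x-3)\cdots (x-m+1)$ (an empty product, equal to $1$, when $m\le 2$).
   Context: $\overline{\mathcal{M}}_{0,n+1}$ is the Deligne–Knudsen–Mumford moduli space of stable rational curves with $n+1$ marked points; its cohomology is concentrated in even degrees, and its Poincaré polynomial is $P_{\overline{\mathcal{M}}_{0,n+1}}(x)=\sum_{i\ge0}\dim_\mathbb{Q}H^{2i}(\overline{\mathcal{M}}_{0,n+1};\mathbb{Q})\,x^i$. Equivalently, $P_{\overline{\mathcal{M}}_{0,n+1}}(x)$ equals the Hilbert series of the Feichtner–Yuzvinsky Chow ring of the graphic matroid of the complete graph $K_n$ with respect to its minimal building set (the nonempty connected flats). *)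

(* Defs.v *)
From HB Require Import structures.
From mathcomp Require Import all_boot all_order all_algebra.
From mathcomp Require Import mpoly.

Set Implicit Arguments.
Unset Strict Implicit.
Unset Printing Implicit Defensive.

Import GRing.Theory.
Local Open Scope ring_scope.

(** * Flats of a matroid

   A matroid on the finite ground set E is given by its rank function r. *)

Section Matroid.

Variables (E : finType) (r : {set E} -> nat).

Implicit Types (A F : {set E}) (G N C : {set {set E}}).

Definition mclosure A : {set E} := [set e | r (e |: A) == r A].

Definition flat F : bool := mclosure F == F.

(* The join of a family of flats in the lattice of flats. *)
Definition flat_join C : {set E} := mclosure (cover C).

Definition flat_atom F : bool := flat F && (r F == 1%N).

(* The restriction of the matroid to F is connected: it is not the direct sum
   of its restrictions to A and F :\: A, for any A with set0 < A < F. *)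
Definition mconnected F : bool :=
  [forall A : {set E},
     (A != set0) && (A \proper F) ==> (r A + r (F :\: A) != r F)%N].

Definition min_building_set : {set {set E}} :=
  [set F | [&& F != set0, flat F & mconnected F]].

Definition antichain C : bool :=
  [forall F1 in C, forall F2 in C, (F1 \subset F2) ==> (F1 == F2)].

Definition nested G N : bool :=
  (N \subset G) &&
  [forall C : {set {set E}},
     [&& C \subset N, (1 < #|C|)%N & antichain C] ==> (flat_join C \notin G)].

(** * The Feichtner-Yuzvinsky Chow ring

   It is the quotient of the polynomial ring on variables x_F, F in G, by the
   ideal generated by the elements below; x_F is 'X_i for the i such that
   enum_val i = F. *)

Inductive FY_generator G : {mpoly rat[#|G|]} -> Prop :=
| FY_nonnested N of N \subset G & ~~ nested G N :
    FY_generator (\prod_(i < #|G| | enum_val i \in N) 'X_i)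
| FY_atom F of flat_atom F :
    FY_generator (\sum_(i < #|G| | F \subset enum_val i) 'X_i).

End Matroid.

Definition ideal_of (A : comNzRingType) (S : A -> Prop) (p : A) : Prop :=
  exists (k : nat) (q g : 'I_k -> A),
    (forall j, S (g j)) /\ p = \sum_j q j * g j.

(* The degree d part of the quotient of K[x_1, .., x_m] by the homogeneous
   ideal I has a basis formed by the classes of k homogeneous polynomials. *)
Definition graded_quotient_dim (K : fieldType) (m : nat)
    (I : {mpoly K[m]} -> Prop) (d k : nat) : Prop :=
  exists b : 'I_k -> {mpoly K[m]},
    [/\ forall j, b j \is d.-homog,
        forall c : 'I_k -> K,
          I (\sum_j c j *: b j) -> forall j, c j = 0
      & forall p, p \is d.-homog ->
          exists c : 'I_k -> K, I (p - \sum_j c j *: b j)].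

Definition is_FY_hilbert_series (E : finType) (r : {set E} -> nat)
    (G : {set {set E}}) (P : {poly rat}) : Prop :=
  forall d, exists2 k : nat,
    graded_quotient_dim (ideal_of (FY_generator r (G := G))) d k & P`_d = k%:R.

(** * The graphic matroid of the complete graph *)

Section CompleteGraph.

Variable n : nat.

Definition Kedge : finType := {e : {set 'I_n} | #|e| == 2}.

Definition Kadj (A : {set Kedge}) : rel 'I_n :=
  [rel u v | [exists e in A, val e == [set u; v]]].

(* The rank of A in the graphic matroid is n minus the number of connected
   components of the spanning subgraph with edge set A. *)
Definition graphic_rank (A : {set Kedge}) : nat := (n - n_comp (Kadj A) 'I_n)%N.

End CompleteGraph.

(* P is the Poincare polynomial of the moduli space of stable rational curves
   with n.+1 marked points, whose rational cohomology ring, with degrees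
   halved, is the Feichtner-Yuzvinsky Chow ring of the graphic matroid of K_n
   for its minimal building set. *)
Definition is_M0bar_poincare (n : nat) (P : {poly rat}) : Prop :=
  is_FY_hilbert_series (@graphic_rank n) (min_building_set (@graphic_rank n)) P.

Definition chibar (m : nat) : {poly rat} := \prod_(2 <= k < m) ('X - k%:R%:P).

(** * A polynomial is determined by being a Hilbert series *)

Section IdealOf.

Variables (A : comNzRingType) (S : A -> Prop).

Lemma ideal_of0 : ideal_of S 0.
Proof.
exists 0%N, (fun _ => 0), (fun _ => 0); split; first by case.
by rewrite big_ord0.
Qed.

Lemma ideal_ofD p q : ideal_of S p -> ideal_of S q -> ideal_of S (p + q).
Proof.
move=> [k1 [q1 [g1 [Sg1 ->]]]] [k2 [q2 [g2 [Sg2 ->]]]].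
pose mix (f1 : 'I_k1 -> A) (f2 : 'I_k2 -> A) (i : 'I_(k1 + k2)) :=
  match split i with inl j => f1 j | inr j => f2 j end.
exists (k1 + k2)%N, (mix q1 q2), (mix g1 g2); split.
  by move=> j; rewrite /mix; case: (split j).
rewrite big_split_ord /=; congr (_ + _); apply: eq_bigr => i _; rewrite /mix.
  by rewrite (unsplitK (inl i)).
by rewrite (unsplitK (inr i)).
Qed.

Lemma ideal_ofM a p : ideal_of S p -> ideal_of S (a * p).
Proof.
move=> [k [q [g [Sg ->]]]]; exists k, (fun j => a * q j), g; split=> //.
by rewrite mulr_sumr; apply: eq_bigr => j _; rewrite mulrA.
Qed.

Lemma ideal_of_sum (I : finType) (F : I -> A) :
  (forall i, ideal_of S (F i)) -> ideal_of S (\sum_i F i).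
Proof.
by move=> SF; elim/big_ind: _ => //; [exact: ideal_of0 | exact: ideal_ofD].
Qed.

End IdealOf.

Lemma graded_quotient_dim_le (K : fieldType) m (S : {mpoly K[m]} -> Prop)
    d k1 k2 :
  graded_quotient_dim (ideal_of S) d k1 ->
  graded_quotient_dim (ideal_of S) d k2 -> (k1 <= k2)%N.
Proof.
move=> [b1 [hb1 free1 _]] [b2 [_ _ span2]].
have /(@fin_all_exists _ _ _)[c Hc] : forall j, exists c : 'I_k2 -> K,
  ideal_of S (b1 j - \sum_i c i *: b2 i) by move=> j; exact: span2.
pose M : 'M[K]_(k1, k2) := \matrix_(j, i) c j i.
suff /eqP <- : row_free M by exact: rank_leq_col.
apply: inj_row_free => v vM0.
apply/rowP => j; rewrite mxE; apply: (free1 (v 0)) => {j}.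
have -> : \sum_j v 0 j *: b1 j =
          \sum_j (v 0 j)%:MP * (b1 j - \sum_i c j i *: b2 i).
  under [RHS]eq_bigr => j _ do rewrite mul_mpolyC scalerBr scaler_sumr.
  rewrite sumrB exchange_big /= [X in _ - X]big1 ?subr0 // => i _.
  under eq_bigr => j _ do rewrite scalerA.
  rewrite -scaler_suml.
  suff -> : \sum_j v 0 j * c j i = 0 by rewrite scale0r.
  have := congr1 (fun u : 'rV_k2 => u 0 i) vM0; rewrite /= !mxE => vMi.
  by rewrite -[RHS]vMi; apply: eq_bigr => j _; rewrite mxE.
by apply: ideal_of_sum => j; apply: ideal_ofM.
Qed.

Lemma FY_hilbert_series_unique (E : finType) (r : {set E} -> nat)
    (G : {set {set E}}) (P Q : {poly rat}) :
  is_FY_hilbert_series r G P -> is_FY_hilbert_series r G Q -> P = Q.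
Proof.
move=> HP HQ; apply/polyP => d.
have [k1 D1 ->] := HP d; have [k2 D2 ->] := HQ d.
congr _%:R; apply/eqP; rewrite eqn_leq.
by rewrite (graded_quotient_dim_le D1 D2) (graded_quotient_dim_le D2 D1).
Qed.

(* Main.v *)
(** The ring is generated by [x_S], [S] a subset of [[n]] with at least two
   elements, with [x_S x_S' = 0] when [S] and [S'] cross and
   [y_ij = 0], where [y_S] is the sum of the [x_U] over [U] containing [S].

   Spanning: if [B_1, .., B_c] are disjoint, then the product of the [x_(B_i)]
   kills every product of [c - 1] elements [y_S] where each [S] is contained in
   the union of the [B_i] and meets two of them.  Hence the monomials in the
   [y_S] with laminar support and exponents at most [c_S - 2] span, [c_S] being
   the number of children of [S] in the forest given by the support.

   Independence: the linear form sending a product [y_(S_1) .. y_(S_k)] to [1]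
   if every nonempty set of indices [I] satisfies
   [#|union of the S_i, i in I| >= #|I| + 2], and to [0] otherwise, vanishes on
   the ideal by submodularity of the cardinal.  For the pairing that it defines,
   each basis monomial has a dual element, up to a triangular matrix.

   Counting: removing the leaf [z] from a forest on [n + 1] points gives
   [P_(n+1) = P_n + x \sum_(k = 2)^n 'C(n, k) P_k P_(n+1-k)].  The right-hand
   side of the theorem is [(n-1)!] times the coefficient of [w^(n-1)] in
   [(1 - u)^(-n)]; it satisfies the same recurrence by Lagrange inversion and the
   linear differential equation of [w (1 - u(w))]. *)

Require Import Defs.
From mathcomp Require Import all_boot all_order all_algebra.
From mathcomp Require Import ring zify mpoly.

Set Implicit Arguments.
Unset Strict Implicit.
Unset Printing Implicit Defensive.

Import Order.TTheory GRing.Theory Num.Theory.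

(** * Laminar families *)

Section Laminar.

Variable T : finType.
Implicit Types (A B S U X Y : {set T}) (N : {set {set T}}) (x y z : T).

(** Everything is ordered by the weight of a monomial, the sum of the sizes of its sets with
    multiplicity. Uncrossing [y_S y_S'] through [y_(S :|: S')] produces heavier monomials, and so
    does the error made when [x_C] is replaced by [y_C]; the weight is bounded in a fixed degree, so
    the rewriting ends. The same order makes the pairing triangular.

    The constant 2 goes back to [y_ij = 0]. The children of a node with [c] children kill [c - 1]
    factors [y_S]; when these children are the points of [S], [c = #|S|], and [#|S| - 1] is the
    first exponent for which the condition on unions fails. That condition concerns monomials in the
    [y_S], so the form is prescribed there and carried to the [x_S] by Moebius inversion.

    The dual of a basis monomial raises each exponent to [c_v - 2], the whole set [T] always
    counting as a node, and adds one factor [x_v] for each other node. The product with the monomial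
    is, modulo the ideal, plus or minus [y_T] to the power [#|T| - 2], on which the form is 1:
    deleting a largest node other than [T] changes the sign, until [T] is the only node left. *)

Definition noncrossing A B := [|| A \subset B, B \subset A | [disjoint A & B]].

Definition laminar N := [forall A in N, forall B in N, noncrossing A B].

(* The block of [x] in [S]: the largest member of [N] strictly inside [S] that
   contains [x], or [[set x]] if there is none. *)
Definition blk N S x := x |: \bigcup_(B in N | (B \proper S) && (x \in B)) B.

Definition blocks N S := [set blk N S x | x in S].

Lemma noncrossing_sym A B : noncrossing A B = noncrossing B A.
Proof. by rewrite /noncrossing orbCA disjoint_sym. Qed.

Lemma crossing_gt1 A B : ~~ noncrossing A B -> 1 < #|A|.
Proof.
rewrite /noncrossing !negb_or => /and3P[/subsetPn[x Ax nBx] _].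
case/pred0Pn=> y /andP[/= Ay By]; apply/card_gt1P; exists x, y; split=> //.
by apply: contraNneq nBx => ->.
Qed.

Lemma laminarP N :
  reflect {in N &, forall A B, noncrossing A B} (laminar N).
Proof.
apply: (iffP forall_inP) => [lamN A B NA NB | lamN A NA].
  exact: (forall_inP (lamN A NA)).
by apply/forall_inP => B NB; apply: lamN.
Qed.

Lemma laminarS N N' : N' \subset N -> laminar N -> laminar N'.
Proof.
move=> /subsetP sN /laminarP lamN; apply/laminarP => A B /sN NA /sN NB.
exact: lamN.
Qed.

Lemma laminar_mem_cmp N A B x : laminar N -> A \in N -> B \in N ->
  x \in A -> x \in B -> (A \subset B) || (B \subset A).
Proof.
move=> /laminarP lamN NA NB Ax Bx; have := lamN A B NA NB.
case/or3P=> [->|->|dAB] //; first by rewrite orbT.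
by rewrite (disjointFr dAB Ax) in Bx.
Qed.

Lemma mem_blk N S x : x \in blk N S x. Proof. by rewrite setU11. Qed.

Lemma blkP N S x y : reflect
  (y = x \/ exists B, [/\ B \in N, B \proper S, x \in B & y \in B])
  (y \in blk N S x).
Proof.
rewrite !inE; apply: (iffP orP) => [[/eqP|/bigcupP[B]] | [->|[B [NB pB xB yB]]]].
- by left.
- by case/and3P=> NB pB xB yB; right; exists B.
- by left.
- by right; apply/bigcupP; exists B; rewrite ?NB ?pB.
Qed.

Lemma sub_blk N S x B : B \in N -> B \proper S -> x \in B -> B \subset blk N S x.
Proof.
by move=> NB pB xB; apply/subsetP=> y yB; apply/blkP; right; exists B.
Qed.

Lemma blk_sub N S x : x \in S -> blk N S x \subset S.
Proof.
move=> Sx; apply/subsetP=> y /blkP[-> //|[B [_ /proper_sub/subsetP sBS _ yB]]].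
exact: sBS.
Qed.

(** The members strictly inside [S] that contain [x] form a chain, so their union is the largest of
    them. *)
Lemma blk_cases N S x : laminar N ->
  blk N S x = [set x] \/ (blk N S x \in N /\ blk N S x \proper S).
Proof.
move=> lamN.
have [B /and3P[NB pB xB] | no] :=
    pickP (fun B => [&& B \in N, B \proper S & x \in B]); last first.
  left; apply/setP=> y; rewrite inE; apply/blkP/eqP => [[]//[B [NB pB xB]]|->].
    by have := no B; rewrite /= NB pB xB.
  by left.
right; pose P := fun C => [&& C \in N, C \proper S & x \in C].
have PB : P B by rewrite /P NB pB xB.
case: (@arg_maxnP _ B P (fun C => #|C|) PB) => C /and3P[NC pC xC] maxC.
suff -> : blk N S x = C by [].
apply/eqP; rewrite eqEsubset sub_blk // andbT.
apply/subsetP=> y /blkP[->//|[D [ND pD xD yD]]].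
have := laminar_mem_cmp lamN NC ND xC xD.
case/orP=> [sCD|/subsetP->//]; have : #|D| <= #|C| by apply: maxC; rewrite /P ND pD.
by move=> leDC; have /eqP-> : C == D by rewrite eqEcard sCD.
Qed.

Lemma blk_eq N S x y : laminar N -> y \in blk N S x -> blk N S y = blk N S x.
Proof.
move=> lamN; case: (blk_cases S x lamN) => [Ex|[NB pB] yB].
  by rewrite Ex inE => /eqP->.
apply/eqP; rewrite eqEsubset andbC sub_blk //=.
have [-> | [NC pC]] := blk_cases S y lamN; first by rewrite sub1set.
apply: sub_blk => //; apply: subsetP (mem_blk N S x).
exact: sub_blk.
Qed.

Lemma blocks_partition N S : laminar N -> partition (blocks N S) S.
Proof.
move=> lamN; apply/and3P; split.
- rewrite eqEsubset; apply/andP; split.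
    by apply/bigcupsP=> _ /imsetP[x Sx ->]; apply: blk_sub.
  apply/subsetP=> x Sx; apply/bigcupP; exists (blk N S x); last exact: mem_blk.
  exact: imset_f.
- apply/trivIsetP=> _ _ /imsetP[x Sx ->] /imsetP[y Sy ->].
  apply: contraR => /pred0Pn[u /andP[/= xu yu]].
  by rewrite -(blk_eq lamN xu) -(blk_eq lamN yu).
- by apply/imsetP=> -[x _ x0]; have := mem_blk N S x; rewrite -x0 inE.
Qed.

Lemma blocks_cover N S : laminar N -> cover (blocks N S) = S.
Proof. by move/(blocks_partition S)/cover_partition. Qed.

Lemma blocks_trivIset N S : laminar N -> trivIset (blocks N S).
Proof. by move/(blocks_partition S)/and3P=> []. Qed.

Lemma blocks_mem N S B : laminar N -> B \in blocks N S -> 1 < #|B| ->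
  B \in N /\ B \proper S.
Proof.
move=> lamN /imsetP[x Sx ->].
by have [->|//] := blk_cases S x lamN; rewrite cards1.
Qed.

Lemma blocks_proper N S B : laminar N -> 1 < #|S| -> B \in blocks N S ->
  B \proper S.
Proof.
move=> lamN S_gt1 SB; have [/(blocks_mem lamN SB)[]//|leB1] := ltnP 1 #|B|.
rewrite properEcard (leq_ltn_trans leB1 S_gt1) andbT -(blocks_cover S lamN).
exact: bigcup_sup.
Qed.

Lemma card_blocks_gt1 N S : laminar N -> 1 < #|S| -> 1 < #|blocks N S|.
Proof.
move=> lamN S_gt1; have [x Sx] : exists x, x \in S.
  by apply/set0Pn; rewrite -card_gt0 ltnW.
have SB : blk N S x \in blocks N S by apply: imset_f.
have /properP[_ [y Sy nBy]] := blocks_proper lamN S_gt1 SB.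
rewrite (cardsD1 (blk N S x)) SB add1n ltnS card_gt0; apply/set0Pn.
exists (blk N S y); rewrite !inE imset_f // andbT.
by apply: contraNneq nBy => <-; apply: mem_blk.
Qed.

Lemma eq_blocks N N' S :
  (forall B, B \proper S -> (B \in N) = (B \in N')) -> blocks N S = blocks N' S.
Proof.
move=> eqN; apply: eq_imset => x; congr (_ |: _); apply: eq_bigl => B.
by rewrite andbCA [in RHS]andbCA; apply: andb_id2l => /eqN->.
Qed.

End Laminar.

(** * Splitting a forest at the smallest node containing a given leaf *)

Section Grafting.

Variable T : finType.
Implicit Types (A B S U X Y : {set T}) (N : {set {set T}}) (x y z : T).

(** A forest with set of leaves [U]: the members of [N] are its inner nodes and the leaves are
    implicit. The whole of [U] may or may not be a node. *)
Definition laminar_on U N :=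
  laminar N && [forall B in N, (B \subset U) && (1 < #|B|)].

Lemma laminar_onP U N : reflect
  (laminar N /\ {in N, forall B, B \subset U /\ 1 < #|B|}) (laminar_on U N).
Proof.
apply: (iffP andP) => -[lamN NU]; split=> //.
  by move=> B NB; apply/andP; apply: (forall_inP NU).
by apply/forall_inP => B NB; apply/andP; apply: NU.
Qed.

Variables (U A : {set T}) (z : T).
Hypotheses (zU : z \in U) (sAU : A \subset U :\ z) (A_neq0 : A != set0).

Let zA : z \notin A.
Proof. by apply: contraTN sAU => zA; apply/subsetPn; exists z; rewrite ?inE ?eqxx. Qed.

Definition unfold_point X := if z \in X then X :|: A else X.

(* [N1] lives on [A] and [N2] on [U :\: A], where [z] stands for the contracted
   node [z |: A]. *)
Definition graft (N12 : {set {set T}} * {set {set T}}) : {set {set T}} :=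
  N12.1 :|: ((z |: A) |: unfold_point @: N12.2).

Definition ungraft N : {set {set T}} * {set {set T}} :=
  ([set B in N | B \subset A],
   [set B :\: A | B in [set B in N | ~~ (B \subset A) && (B != z |: A)]]).

(** This sorts the forests that cover [z]: each is in the class of exactly one [A], its smallest
    node containing [z] deprived of [z]. *)
Definition lowest_at_z N :=
  (z |: A \in N) && [forall B in N, (z \in B) ==> (z |: A \subset B)].

Let E := unfold_point.
Let v := z |: A.

Lemma sub_unfold X : X \subset E X.
Proof. by rewrite /E /unfold_point; case: ifP => // _; apply: subsetUl. Qed.

Lemma unfoldS X Y : X \subset Y -> E X \subset E Y.
Proof.
move=> sXY; rewrite /E /unfold_point; case: ifP => zX.
  by rewrite (subsetP sXY _ zX) setSU.
by case: ifP => _ //; apply: subset_trans sXY (subsetUl _ _).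
Qed.

Lemma unfoldK X : [disjoint X & A] -> E X :\: A = X.
Proof.
move=> dXA; rewrite /E /unfold_point; case: ifP => _.
  by rewrite setDUl setDv setU0; apply/setDidPl.
by apply/setDidPl.
Qed.

Lemma mem_unfold X x : x \notin A -> (x \in E X) = (x \in X).
Proof.
by move=> nAx; rewrite /E /unfold_point; case: ifP; rewrite ?inE ?(negbTE nAx) ?orbF.
Qed.

Lemma sub_unfold_point X : z \in X -> v \subset E X.
Proof.
by move=> zX; rewrite /E /unfold_point zX subUset sub1set inE zX subsetUr.
Qed.

Lemma unfold_disjoint X Y : [disjoint X & A] -> [disjoint Y & A] ->
  [disjoint X & Y] -> [disjoint E X & E Y].
Proof.
move=> dX dY dXY; apply/pred0P=> u /=; apply/negbTE/negP=> /andP[].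
have nXY w : w \in X -> w \in Y -> False by move=> Xw; rewrite (disjointFr dXY Xw).
have nXA w : w \in X -> w \in A -> False by move=> Xw; rewrite (disjointFr dX Xw).
have nYA w : w \in Y -> w \in A -> False by move=> Xw; rewrite (disjointFr dY Xw).
rewrite /E /unfold_point; case: ifP => zX; case: ifP => zY; rewrite ?inE.
- by case: (nXY z zX zY).
- by case/orP=> [Xu|Au] Yu; [apply: nXY Yu | apply: nYA Au].
- by move=> Xu /orP[Yu|Au]; [apply: nXY Yu | apply: nXA Au].
- exact: nXY.
Qed.

Section Graft.

Variables N1 N2 : {set {set T}}.
Hypotheses (lam1 : laminar_on A N1) (nA1 : A \notin N1)
           (lam2 : laminar_on (U :\: A) N2).

Let N := graft (N1, N2).

Lemma graft_out X : X \in N2 ->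
  [/\ X \subset U, [disjoint X & A] & 1 < #|X|].
Proof.
case/laminar_onP: lam2 => _ h /h[sXU X1]; split=> //.
  by apply: subset_trans sXU (subsetDl _ _).
by rewrite disjoints_subset; apply: subset_trans sXU _; rewrite setDE subsetIr.
Qed.

Lemma graft_in B : B \in N1 -> B \proper A /\ 1 < #|B|.
Proof.
case/laminar_onP: lam1 => _ h NB; have [sBA B1] := h B NB; split=> //.
by rewrite properEneq sBA andbT; apply: contraNneq nA1 => <-.
Qed.

Lemma graftP B : reflect
  [\/ B \in N1, B = v | exists2 X, X \in N2 & B = E X] (B \in N).
Proof.
rewrite !inE; apply: (iffP or3P) => -[].
- by move=> h; apply: Or31.
- by move=> /eqP h; apply: Or32.
- by case/imsetP=> X NX ->; apply: Or33; exists X.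
- by move=> h; apply: Or31.
- by move=> ->; apply: Or32.
- by case=> X NX ->; apply: Or33; apply: imset_f.
Qed.

Lemma unfold_not_sub X : X \in N2 -> ~~ (E X \subset A).
Proof.
case/graft_out=> _ dXA X1; apply/negP=> /(subset_trans (sub_unfold X)) sXA.
have /set0Pn[x Xx] : X != set0 by rewrite -card_gt0 ltnW.
by have := disjointFr dXA Xx; rewrite (subsetP sXA).
Qed.

Lemma unfold_neq_point X : X \in N2 -> E X != v.
Proof.
case/graft_out=> _ dXA X1; apply/eqP=> eXv.
have /(congr1 (fun Y => #|Y|)) := unfoldK dXA; rewrite eXv => eX.
have : #|v :\: A| <= #|[set z]|.
  by apply/subset_leq_card/subsetP=> y; rewrite !inE; case: (y \in A); rewrite ?orbF.
by rewrite cards1 eX leqNgt X1.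
Qed.

Lemma point_not_sub : ~~ (v \subset A).
Proof. by rewrite subUset sub1set (negbTE zA). Qed.

Lemma graft_sub_in B : B \subset A -> (B \in N) = (B \in N1).
Proof.
move=> sBA; apply/graftP/idP => [[//|Bv|[X NX BX]]|]; last by move=> h; apply: Or31.
  by have := point_not_sub; rewrite -Bv sBA.
by have := unfold_not_sub NX; rewrite -BX sBA.
Qed.

Lemma graft_mem_z B : B \in N -> z \in B -> v \subset B.
Proof.
case/graftP=> [/graft_in[/proper_sub sBA _] zB|->//|[X NX ->]].
  by case/negP: zA; apply: (subsetP sBA).
by rewrite mem_unfold //; apply: sub_unfold_point.
Qed.

Lemma graft_laminar_on : laminar_on U N.
Proof.
have [[lamN1 _] [lamN2 _]] := (laminar_onP _ _ lam1, laminar_onP _ _ lam2).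
have sAv : A \subset v by apply: subsetUr.
have sAU' : A \subset U by apply: subset_trans sAU (subD1set _ _).
have svU : v \subset U by rewrite subUset sub1set zU.
have n12 B X : B \in N1 -> X \in N2 -> noncrossing B (E X).
  move=> /graft_in[/proper_sub sBA _] /graft_out[_ dXA _].
  rewrite /E /unfold_point; case: ifP => _.
    by rewrite /noncrossing (subset_trans sBA) ?subsetUr.
  by rewrite /noncrossing (disjointWl sBA) ?orbT // disjoint_sym.
have n1v B : B \in N1 -> noncrossing B v.
  by move=> /graft_in[/proper_sub sBA _]; rewrite /noncrossing (subset_trans sBA).
have n2v X : X \in N2 -> noncrossing v (E X).
  move=> /graft_out[_ dXA _]; have [zX|zX] := boolP (z \in X).
    by rewrite /noncrossing sub_unfold_point.
  rewrite /noncrossing; suff -> : [disjoint v & E X] by rewrite !orbT.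
  rewrite /E /unfold_point (negbTE zX) disjoints_subset subUset.
  by rewrite sub1set inE zX -disjoints_subset disjoint_sym.
apply/laminar_onP; split.
  apply/laminarP=> B C /graftP[NB|->|[X NX ->]] /graftP[NC|->|[Y NY ->]].
  - exact: (laminarP _ lamN1).
  - exact: n1v.
  - exact: n12.
  - by rewrite noncrossing_sym n1v.
  - by rewrite /noncrossing subxx.
  - exact: n2v.
  - by rewrite noncrossing_sym n12.
  - by rewrite noncrossing_sym n2v.
  have [[_ dX _] [_ dY _]] := (graft_out NX, graft_out NY).
  case/or3P: (laminarP _ lamN2 X Y NX NY) => h.
  - by rewrite /noncrossing (unfoldS h).
  - by rewrite /noncrossing (unfoldS h) orbT.
  - by rewrite /noncrossing (unfold_disjoint dX dY h) !orbT.
move=> B /graftP[/graft_in[/proper_sub sBA B1]|->|[X /graft_out[sXU dX X1] ->]].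
- by rewrite (subset_trans sBA).
- by rewrite svU cardsU1 zA add1n ltnS card_gt0.
- split; last by apply: leq_trans X1 (subset_leq_card (sub_unfold X)).
  by rewrite /E /unfold_point; case: ifP => // _; rewrite subUset sXU.
Qed.

Lemma graft_lowest : lowest_at_z N && (A \notin N).
Proof.
rewrite graft_sub_in // nA1 andbT; apply/andP; split.
  by apply/graftP; apply: Or32.
by apply/forall_inP=> B NB; apply/implyP; apply: graft_mem_z.
Qed.

Lemma graftK : ungraft N = (N1, N2).
Proof.
congr (_, _).
  apply/setP=> B; rewrite inE; have [sBA|nsBA] := boolP (B \subset A).
    by rewrite andbT graft_sub_in.
  by rewrite andbF; apply/esym/negP=> /graft_in[/proper_sub]; rewrite (negbTE nsBA).
apply/setP=> X; apply/imsetP/idP => [[B]|NX].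
  rewrite inE => /and3P[/graftP[/graft_in[/proper_sub->]//|->|[Y NY ->]]].
    by rewrite eqxx.
  by move=> _ _ ->; have [_ dY _] := graft_out NY; rewrite unfoldK.
have [_ dX _] := graft_out NX; exists (E X); last by rewrite unfoldK.
rewrite inE unfold_not_sub // unfold_neq_point // !andbT.
by apply/graftP; apply: Or33; exists X.
Qed.

Lemma blocks_graft_in B : B \subset A -> blocks N B = blocks N1 B.
Proof.
move=> sBA; apply: eq_blocks => C /proper_sub sCB.
by rewrite graft_sub_in // (subset_trans sCB).
Qed.

(** Every member containing [z] contains [z |: A], so the leaf [z] is a child on its own; as [A] is
    not a member, the other children are those of [A] in [N1]. *)
Lemma blocks_graft_point : #|blocks N v| = (#|blocks N1 A|).+1.
Proof.
have [lamN1 _] := laminar_onP _ _ lam1.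
have blkA x : x \in A -> blk N v x = blk N1 A x.
  move=> Ax; congr (_ |: _); apply: eq_bigl => B.
  have [sBA|nsBA] := boolP (B \subset A).
    rewrite graft_sub_in //; apply: andb_id2l => NB.
    have [-> _] := graft_in NB.
    by rewrite (sub_proper_trans sBA) // properEneq subsetUr andbT;
       apply: contraNneq zA => ->; rewrite setU11.
  have -> : (B \in N1) = false by apply: contraNF nsBA => /graft_in[/proper_sub].
  apply/negbTE/negP=> /and3P[NB /properP[sBv [u vu nBu]] _].
  case: (boolP (z \in B)) => [/(graft_mem_z NB)/subsetP/(_ u vu)|zB].
    by rewrite (negbTE nBu).
  case/negP: nsBA; apply/subsetP=> y By; have := subsetP sBv y By.
  by rewrite !inE; case: eqP => // yz; rewrite -yz By in zB.
have blkz : blk N v z = [set z].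
  apply/setP=> y; rewrite inE; apply/blkP/eqP => [[//|[B [NB pB zB _]]]|->]; last by left.
  by have := graft_mem_z NB zB; rewrite (negbTE (proper_subn pB)).
rewrite /blocks imsetU1 blkz (eq_in_imset blkA) cardsU1.
suff -> : [set z] \notin [set blk N1 A x | x in A] by [].
apply/imsetP=> -[x Ax zx]; have := subsetP (blk_sub N1 Ax) z.
by rewrite -zx set11 (negbTE zA) => /(_ isT).
Qed.

(** Seen from a set of [N2], the node [z |: A] is the point [z]. The delicate points are those of
    [A], which must follow [z] into its block. *)
Lemma blk_unfold X x : X \in N2 -> x \in X -> blk N (E X) x = E (blk N2 X x).
Proof.
move=> NX Xx; have [_ dX X1] := graft_out NX.
have nAx : x \notin A by rewrite (disjointFr dX Xx).
have sb := blk_sub N2 Xx.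
apply/setP=> y; apply/blkP/idP => [[->|[B [NB pB xB yB]]]|].
- by rewrite mem_unfold ?mem_blk.
- case/graftP: NB => [/graft_in[/proper_sub sBA _]|Bv|[Y NY BY]].
  + by rewrite (subsetP sBA _ xB) in nAx.
  + have xz : x = z by move: xB; rewrite Bv !inE (negbTE nAx) orbF => /eqP.
    have zb : z \in blk N2 X x by rewrite -xz mem_blk.
    by apply: (subsetP (sub_unfold_point zb)); rewrite -Bv.
  + have [_ dY _] := graft_out NY.
    rewrite BY in pB xB yB; rewrite mem_unfold // in xB.
    apply: subsetP (yB); apply: unfoldS; apply: sub_blk => //.
    rewrite properEneq; apply/andP; split.
      by apply: contraTneq pB => ->; rewrite properxx.
    by rewrite -(unfoldK dX) -(unfoldK dY) setSD // proper_sub.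
have pE Y : Y \in N2 -> Y \proper X -> E Y \proper E X.
  move=> NY pYX; have [_ dY _] := graft_out NY.
  rewrite properEneq unfoldS ?proper_sub // andbT.
  by apply: contraTneq pYX => e; rewrite -(unfoldK dX) -(unfoldK dY) e properxx.
have NE Y : Y \in N2 -> E Y \in N by move=> NY; apply/graftP; apply: Or33; exists Y.
have case1 : y \in blk N2 X x -> y = x \/
    exists B, [/\ B \in N, B \proper E X, x \in B & y \in B].
  case/blkP=> [->|[Y [NY pY xY yY]]]; first by left.
  by right; exists (E Y); rewrite NE ?pE // !(subsetP (sub_unfold Y)).
rewrite {1}/E /unfold_point; case: ifP => // zb; rewrite inE => /orP[//|Ay].
right; case/blkP: zb => [zx|[Y [NY pY xY zY]]].
  exists v; rewrite -zx !inE eqxx Ay orbT; split=> //.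
    by apply/orP; right; apply/orP; left.
  by rewrite properEneq eq_sym unfold_neq_point // sub_unfold_point // zx.
exists (E Y); rewrite NE ?pE //; split=> //; first exact: subsetP (sub_unfold Y) _ xY.
by apply: (subsetP (sub_unfold_point zY)); rewrite !inE Ay orbT.
Qed.

Lemma blocks_graft_out X : X \in N2 -> #|blocks N (E X)| = #|blocks N2 X|.
Proof.
move=> NX; have [_ dX X1] := graft_out NX.
have lamN : laminar N by case/laminar_onP: graft_laminar_on.
have -> : blocks N (E X) = E @: blocks N2 X.
  rewrite /blocks -imset_comp; apply/setP=> B; apply/imsetP/imsetP => -[x].
    move=> Ex ->; have [Xx|nXx] := boolP (x \in X).
      by exists x => //=; rewrite blk_unfold.
    move: Ex; rewrite {1}/E /unfold_point; case: ifP => zX; last first.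
      by rewrite (negbTE nXx).
    rewrite inE (negbTE nXx) /= => Ax; exists z => //=; rewrite -blk_unfold //.
    apply: blk_eq => //; apply: (subsetP (@sub_blk _ _ _ _ v _ _ _)).
    - by apply/graftP; apply: Or32.
    - by rewrite properEneq eq_sym unfold_neq_point // sub_unfold_point.
    - by rewrite setU11.
    - by rewrite !inE Ax orbT.
  move=> Xx -> /=; exists x; last by rewrite blk_unfold.
  exact: subsetP (sub_unfold X) _ Xx.
rewrite card_in_imset // => B C /imsetP[x Xx ->] /imsetP[y Xy ->] e.
by rewrite -[LHS]unfoldK ?e ?unfoldK //; apply: disjointWl dX; apply: blk_sub.
Qed.

End Graft.

(** A member that is not inside [A] and differs from [z |: A] contains this node or is disjoint from
    it, so removing [A] and then unfolding [z] restores it. *)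
Lemma ungraftK N : laminar_on U N -> lowest_at_z N -> graft (ungraft N) = N.
Proof.
case/laminar_onP=> lamN NU /andP[Nv /forall_inP low].
have out B : B \in N -> ~~ (B \subset A) -> B != v -> E (B :\: A) = B.
  move=> NB nsBA nBv; rewrite /E /unfold_point !inE zA /=.
  case: ifP => zB; first by have := implyP (low B NB) zB; rewrite subUset => /andP[_ sAB];
    rewrite setDE setUIl setUC (setUC _ A) setUCr setIT (setUidPr sAB).
  apply/setDidPl; case/or3P: (laminarP _ lamN B v NB Nv) => [sBv|svB|].
  - case/negP: nsBA; apply/subsetP=> y By; have := subsetP sBv y By.
    by rewrite !inE; case: eqP => // yz; rewrite -yz By in zB.
  - by rewrite (subsetP svB) ?setU11 in zB.
  - by apply: disjointWr; apply: subsetUr.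
apply/setP=> B; apply/graftP/idP => [[|->//|[X /imsetP[C]]]|NB].
- by rewrite inE => /andP[].
- by rewrite inE => /and3P[NC nsCA nCv] -> ->; rewrite out.
have [sBA|nsBA] := boolP (B \subset A); first by apply: Or31; rewrite inE NB.
have [->|nBv] := eqVneq B v; first exact: Or32.
apply: Or33; exists (B :\: A); last by rewrite out.
by apply/imsetP; exists B; rewrite // inE NB nsBA.
Qed.

Lemma ungraft_laminar_on N : laminar_on U N -> lowest_at_z N -> A \notin N ->
  [/\ laminar_on A (ungraft N).1, A \notin (ungraft N).1
     & laminar_on (U :\: A) (ungraft N).2].
Proof.
move=> lamU low nAN; have eN := ungraftK lamU low.
case/laminar_onP: lamU => lamN NU; case/andP: low => Nv /forall_inP low.
split; first 1 last.
- by rewrite inE (negbTE nAN).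
- have mem2 B : B \in N -> ~~ (B \subset A) -> B != v ->
      (z \in B /\ v \proper B) \/ (z \notin B /\ [disjoint B & v]).
    move=> NB nsBA nBv; have [zB|zB] := boolP (z \in B).
      by left; rewrite properEneq eq_sym nBv (implyP (low B NB)).
    right; split=> //.
    case/or3P: (laminarP _ lamN B v NB Nv) => [sBv|svB|//].
      case/negP: nsBA; apply/subsetP=> y By; have := subsetP sBv y By.
      by rewrite !inE; case: eqP => // yz; rewrite -yz By in zB.
    by rewrite (subsetP svB) ?setU11 in zB.
  apply/laminar_onP; split.
    apply/laminarP=> _ _ /imsetP[B] + -> /imsetP[C] + ->.
    rewrite !inE => /and3P[NB _ _] /and3P[NC _ _].
    case/or3P: (laminarP _ lamN B C NB NC) => h.
    - by rewrite /noncrossing (setSD A h).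
    - by rewrite /noncrossing (setSD A h) orbT.
    - rewrite /noncrossing (disjointWl (subsetDl _ _)) ?orbT //.
      exact: disjointWr (subsetDl _ _) h.
  move=> _ /imsetP[B] + ->; rewrite inE => /and3P[NB nsBA nBv].
  have [sBU B1] := NU B NB; split; first exact: setSD.
  case: (mem2 B NB nsBA nBv) => [[zB /properP[_ [u Bu nvu]]]|[_ dBv]].
    rewrite (cardsD1 z) !inE zB zA add1n ltnS card_gt0; apply/set0Pn; exists u.
    by move: nvu; rewrite !inE negb_or Bu andbT.
  suff -> : B :\: A = B by [].
  by apply/setDidPl; apply: disjointWr dBv; apply: subsetUr.
apply/laminar_onP; split; first by apply: laminarS lamN; apply/subsetP=> B; rewrite inE => /andP[].
by move=> B; rewrite inE => /andP[NB sBA]; have [_ B1] := NU B NB.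
Qed.

End Grafting.

(** * The graphic matroid of the complete graph *)

Lemma connect_trap (V : finType) (e1 e2 : rel V) (S : {pred V}) x y :
  (forall a b, a \in S -> e1 a b -> b \in S /\ e2 a b) ->
  x \in S -> connect e1 x y -> y \in S /\ connect e2 x y.
Proof.
move=> step Sx /connectP[p e1p ->]; elim: p x Sx e1p => [|b p IHp] a Sa /=.
  by move=> _; split.
case/andP=> e1ab e1p; have [Sb e2ab] := step a b Sa e1ab.
have [Sl cl] := IHp b Sb e1p; split=> //.
exact: connect_trans (connect1 e2ab) cl.
Qed.

Section CompleteGraphMatroid.

Variable n : nat.
Local Notation V := 'I_n.
Local Notation edge := (Kedge n).
Local Notation rk := (@graphic_rank n).
Local Notation cl := (mclosure rk).
Implicit Types (S : {set V}) (X Y Z F : {set edge}) (a b u v w : V) (e : edge).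

Lemma Kadj_sym X : ssrbool.symmetric (Kadj X).
Proof.
by move=> u v; apply: eq_existsb => e; rewrite setUC.
Qed.

Lemma Kconnect_sym X : connect_sym (Kadj X).
Proof. by apply: sym_connect_sym; apply: Kadj_sym. Qed.

Lemma edgeP e : exists u v, u != v /\ val e = [set u; v].
Proof. by move/cards2P: (valP e) => [u [v [nuv ev]]]; exists u, v. Qed.

Lemma edge_ex u v : u != v -> exists e, val e = [set u; v].
Proof.
move=> nuv; have c2 : #|[set u; v]| == 2 by rewrite cards2 nuv.
by exists (exist _ [set u; v] c2).
Qed.

Lemma KadjP X u v : reflect (exists2 e, e \in X & val e = [set u; v]) (Kadj X u v).
Proof.
apply: (iffP existsP) => [[e /andP[Xe /eqP ev]]|[e Xe ev]]; exists e => //.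
by rewrite Xe ev eqxx.
Qed.

Lemma Kadj_neq X u v : Kadj X u v -> u != v.
Proof.
case/KadjP=> e _ ev; have := valP e; rewrite ev.
by apply: contraTneq => ->; rewrite setUid cards1.
Qed.

Lemma Kadj_sub X Y u v : X \subset Y -> Kadj X u v -> Kadj Y u v.
Proof.
by move=> /subsetP sXY /KadjP[e Xe ev]; apply/KadjP; exists e; rewrite ?sXY.
Qed.

Lemma Kconnect_sub X Y u v : X \subset Y ->
  connect (Kadj X) u v -> connect (Kadj Y) u v.
Proof.
by move=> sXY; apply: connect_sub => a b /(Kadj_sub sXY); apply: connect1.
Qed.

Lemma eq_root_connect (e1 e2 : rel V) u :
  connect e1 u =1 connect e2 u -> fingraph.root e1 u = fingraph.root e2 u.
Proof. by move=> eqc; rewrite /fingraph.root (eq_pick eqc). Qed.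

(** Each component has one [root], so the rank counts the other vertices. As the cardinal of a set
    of vertices, it can be compared by injections and split vertex by vertex. *)
Definition moved X : {set V} := [set x | fingraph.root (Kadj X) x != x].

Lemma in_moved X u : (u \in moved X) = (fingraph.root (Kadj X) u != u).
Proof. by rewrite inE. Qed.

Lemma graphic_rankE X : rk X = #|moved X|.
Proof.
rewrite /graphic_rank /n_comp_mem -[in X in (X - _)%N](card_ord n).
rewrite -(cardC (fun x => fingraph.root (Kadj X) x == x)).
rewrite [X in (_ - X)%N](_ : _ = #|[pred x | fingraph.root (Kadj X) x == x]|).
  by rewrite addKn; apply: eq_card => x; rewrite !inE.
by apply: eq_card => x; rewrite !inE andbT.
Qed.

Lemma rank_eq X Y : (forall u v, connect (Kadj X) u v = connect (Kadj Y) u v) ->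
  rk X = rk Y.
Proof.
move=> eqc; rewrite !graphic_rankE; apply: eq_card => x; rewrite !inE.
by rewrite (eq_root_connect (eqc x)).
Qed.

(** The components of [X] refine those of [Y], so the roots for [Y] inject into those for [X]. The
    injection misses a root because the components of [u] and [v] are merged. *)
Lemma rank_lt X Y u v : X \subset Y -> connect (Kadj Y) u v ->
  ~~ connect (Kadj X) u v -> (rk X < rk Y)%N.
Proof.
move=> sXY cY cX; rewrite !graphic_rankE.
pose fx Z := ~: moved Z.
have fxP Z x : (x \in fx Z) = (fingraph.root (Kadj Z) x == x).
  by rewrite !inE negbK.
have rootE (Z : {set edge}) (a b : V) : (fingraph.root (Kadj Z) a == fingraph.root (Kadj Z) b) =
    connect (Kadj Z) a b by apply: (root_connect (Kconnect_sym Z)).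
have rootK (Z : {set edge}) (a : V) : fingraph.root (Kadj Z) a \in fx Z.
  by rewrite fxP (root_root (Kconnect_sym Z)).
pose g := fingraph.root (Kadj X).
suff : #|fx Y| < #|fx X|.
  by have := cardsC (moved X); have := cardsC (moved Y); rewrite -/(fx X) -/(fx Y); lia.
have ginj : {in fx Y &, injective g}.
  move=> a b; rewrite !fxP => /eqP <- /eqP <- /eqP; rewrite rootE.
  move/(Kconnect_sub sXY); rewrite -rootE !(root_root (Kconnect_sym Y)).
  by move/eqP.
rewrite -(card_in_imset ginj); apply: proper_card; apply/properP; split.
  by apply/subsetP=> _ /imsetP[a _ ->]; apply: rootK.
have [/imsetP[a aY au]|nu] := boolP (g u \in g @: fx Y); last first.
  by exists (g u); first exact: rootK.
exists (g v); first exact: rootK.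
apply/imsetP=> -[b bY bv]; case/negP: cX.
have cau : connect (Kadj X) u a by rewrite -rootE; apply/eqP.
have cbv : connect (Kadj X) v b by rewrite -rootE; apply/eqP.
have cab : connect (Kadj Y) a b.
  apply: connect_trans (Kconnect_sub sXY cbv).
  by apply: connect_trans cY; rewrite Kconnect_sym (Kconnect_sub sXY).
move: aY bY cab; rewrite -rootE !fxP => /eqP-> /eqP-> /eqP ab.
by rewrite -rootE; apply/eqP; rewrite -/g au bv ab.
Qed.

Lemma rank_set0 : rk set0 = 0.
Proof.
rewrite graphic_rankE; apply: eq_card0 => x; rewrite !inE; apply/negbTE.
rewrite negbK; have := connect_root (Kadj set0) x.
case/connectP=> -[|b p] /=; first by move=> _ ->.
by case/andP=> /KadjP[e]; rewrite inE.
Qed.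

Lemma rank_gt0 X e : e \in X -> (0 < rk X)%N.
Proof.
move=> Xe; have [u [v [nuv ev]]] := edgeP e.
rewrite -rank_set0; apply: (@rank_lt _ _ u v); first exact: sub0set.
  by apply: connect1; apply/KadjP; exists e.
apply/connectP=> -[[|b p] /=]; first by move=> _ vu; rewrite vu eqxx in nuv.
by case/andP=> /KadjP[e']; rewrite inE.
Qed.

Lemma mem_cl X e u v : val e = [set u; v] ->
  (e \in cl X) = connect (Kadj X) u v.
Proof.
move=> ev; rewrite inE; have sX : X \subset e |: X by apply: subsetUr.
apply/idP/idP => [/eqP er|cuv].
  apply: contraT => ncuv; suff : (rk X < rk (e |: X))%N by rewrite er ltnn.
  apply: rank_lt ncuv => //; apply: connect1; apply/KadjP; exists e => //.
  by rewrite setU11.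
apply/eqP; apply: rank_eq => a b; apply/idP/idP; last exact: Kconnect_sub.
apply: connect_sub => {a b} a b /KadjP[e']; rewrite !inE.
case/orP=> [/eqP->|Xe'] e'ab; last by apply: connect1; apply/KadjP; exists e'.
have auv : a \in [set u; v] by rewrite -ev e'ab !inE eqxx.
have buv : b \in [set u; v] by rewrite -ev e'ab !inE eqxx orbT.
move: auv buv; rewrite !inE; case/orP=> /eqP-> /orP[]/eqP-> //.
by rewrite Kconnect_sym.
Qed.

Lemma sub_cl X : X \subset cl X.
Proof.
apply/subsetP=> e Xe; have [u [v [_ ev]]] := edgeP e.
by rewrite (mem_cl X ev); apply: connect1; apply/KadjP; exists e.
Qed.

Definition clique S : {set edge} := [set e : edge | val e \subset S].

Lemma mem_clique S e u v : val e = [set u; v] ->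
  (e \in clique S) = (u \in S) && (v \in S).
Proof. by move=> ev; rewrite inE ev subUset !sub1set. Qed.

Lemma Kadj_clique S u v : Kadj (clique S) u v = [&& u != v, u \in S & v \in S].
Proof.
apply/idP/and3P => [adj|[nuv Su Sv]].
  have nuv := Kadj_neq adj; case/KadjP: adj => e eS ev.
  by move: eS; rewrite (mem_clique S ev) => /andP[].
by have [e ev] := edge_ex nuv; apply/KadjP; exists e; rewrite ?(mem_clique S ev) ?Su.
Qed.

Lemma set_gt1_other S u : (1 < #|S|)%N -> exists2 v, v \in S & v != u.
Proof.
move=> S1; have /set0Pn[v] : S :\ u != set0.
  rewrite -card_gt0; move: S1; rewrite (cardsD1 u).
  by case: (u \in S) => //= /ltnW.
by rewrite !inE => /andP[nvu Sv]; exists v.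
Qed.

Lemma clique_sub S S' : (1 < #|S|)%N -> (clique S \subset clique S') = (S \subset S').
Proof.
move=> S1; apply/idP/idP => sS; last first.
  by apply/subsetP=> e; rewrite !inE => h; apply: subset_trans h sS.
apply/subsetP=> u Su; have [v Sv nvu] := set_gt1_other u S1.
have [e ev] := edge_ex nvu; have := subsetP sS e.
by rewrite !(mem_clique _ ev) Sv Su => /(_ isT)/andP[].
Qed.

Lemma clique_inj S S' : (1 < #|S|)%N -> (1 < #|S'|)%N ->
  clique S = clique S' -> S = S'.
Proof.
by move=> S1 S'1 eS; apply/eqP; rewrite eqEsubset -!clique_sub // eS subxx.
Qed.

Lemma cl_sub_clique X S : X \subset clique S -> cl X \subset clique S.
Proof.
move=> sXS; apply/subsetP=> e; have [u [v [nuv ev]]] := edgeP e.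
rewrite (mem_cl X ev) (mem_clique S ev).
have step a b : Kadj X a b -> (a \in S) && (b \in S).
  by move/(Kadj_sub sXS); rewrite Kadj_clique => /and3P[_ -> ->].
have half a b : a != b -> connect (Kadj X) a b -> a \in S.
  move=> nab /connectP[[|c p] /=]; first by move=> _ ba; rewrite ba eqxx in nab.
  by case/andP=> /step/andP[].
move=> cuv; rewrite (half u v) //= (half v u) //; first by rewrite eq_sym.
by rewrite Kconnect_sym.
Qed.

Lemma clique_flat S : flat rk (clique S).
Proof. by apply/eqP/eqP; rewrite eqEsubset cl_sub_clique // sub_cl. Qed.

Lemma clique_neq0 S : (1 < #|S|)%N -> clique S != set0.
Proof.
case/card_gt1P=> u [v [Su Sv nuv]]; have [e ev] := edge_ex nuv.
by apply/set0Pn; exists e; rewrite (mem_clique S ev) Su.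
Qed.

(** A graph or its complement is connected: of the two sets of edges, one connects all of [S] and
    has full rank, while the other has positive rank. *)
Lemma clique_connected S : mconnected rk (clique S).
Proof.
apply/forallP=> X; apply/implyP=> /andP[X0 pX].
pose Y := clique S :\: X.
have sXF : X \subset clique S := proper_sub pX.
have sYF : Y \subset clique S := subsetDl _ _.
have Y0 : Y != set0.
  by have /properP[_ [e eF eX]] := pX; apply/set0Pn; exists e; rewrite inE eX.
have full Z : Z \subset clique S ->
    (forall u v, u \in S -> v \in S -> connect (Kadj Z) u v) -> rk Z = rk (clique S).
  move=> sZ cZ; apply: rank_eq => u v; apply/idP/idP; first exact: Kconnect_sub.
  by apply: connect_sub => a b; rewrite Kadj_clique => /and3P[_]; apply: cZ.
have gt0 Z : Z != set0 -> (0 < rk Z)%N by case/set0Pn=> e; apply: rank_gt0.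
suff [/(full X sXF) eX|/(full Y sYF) eY] :
    (forall u v, u \in S -> v \in S -> connect (Kadj X) u v) \/
    (forall u v, u \in S -> v \in S -> connect (Kadj Y) u v).
- by rewrite eX -/Y; have := gt0 Y Y0; lia.
- by rewrite -/Y eY; have := gt0 X X0; lia.
have [/existsP[u /existsP[v /and3P[Su Sv nc]]]|all] :=
    boolP [exists u, exists v, [&& u \in S, v \in S & ~~ connect (Kadj X) u v]];
  last first.
  left=> u v Su Sv; apply: contraNT all => nc.
  by apply/existsP; exists u; apply/existsP; exists v; rewrite Su Sv.
right; have adjY a b : a \in S -> b \in S -> ~~ connect (Kadj X) a b ->
    connect (Kadj Y) a b.
  move=> Sa Sb nab; have neab : a != b by apply: contraNneq nab => ->.
  have [e ev] := edge_ex neab; apply: connect1; apply/KadjP; exists e => //.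
  rewrite inE (mem_clique S ev) Sa Sb !andbT; apply: contra nab => Xe.
  by apply: connect1; apply/KadjP; exists e.
(* A vertex that [X] joins to [u] is not joined to [v], so in [Y] it reaches [u] through [v]. *)
have tou w : w \in S -> connect (Kadj Y) w u.
  move=> Sw; have [cwu|ncwu] := boolP (connect (Kadj X) w u); last exact: adjY.
  apply: (@connect_trans _ _ v); last by rewrite Kconnect_sym; apply: adjY.
  apply: adjY => //; apply: contra nc => cwv.
  by apply: connect_trans cwv; rewrite Kconnect_sym.
move=> a b Sa Sb; apply: connect_trans (tou a Sa) _.
by rewrite Kconnect_sym tou.
Qed.

(** Let [S] be the component of an edge of [F]. Flatness puts all the edges inside [S] in [F]; no
    edge of [F] leaves [S], so the rank is additive for [clique S] and the rest, and connectedness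
    leaves no rest. *)
Lemma building_clique F : F \in min_building_set rk ->
  exists2 S : {set V}, (1 < #|S|)%N & F = clique S.
Proof.
rewrite inE => /and3P[/set0Pn[e Fe] /eqP flF conF].
have [u [v [nuv ev]]] := edgeP e.
pose S := [set w | connect (Kadj F) u w].
have Su : u \in S by rewrite inE.
have Sv : v \in S by rewrite inE; apply: connect1; apply/KadjP; exists e.
have stepS a b : Kadj F a b -> (a \in S) = (b \in S).
  move=> ab; rewrite !inE; apply/idP/idP => c; apply: connect_trans c _.
    exact: connect1.
  by apply: connect1; rewrite Kadj_sym.
have S1 : (1 < #|S|)%N by apply/card_gt1P; exists u, v.
exists S => //; apply/eqP; rewrite eq_sym.
have sSF : clique S \subset F.
  apply/subsetP=> e'; have [a [b [_ e'v]]] := edgeP e'.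
  rewrite (mem_clique S e'v) -flF (mem_cl F e'v) !inE => /andP[ca cb].
  by apply: connect_trans cb; rewrite Kconnect_sym.
apply: contraT => neF; have pSF : clique S \proper F by rewrite properEneq neF.
have := forallP conF (clique S); rewrite clique_neq0 // pSF /= => /negP[]; apply/eqP.
pose Y := F :\: clique S; rewrite -/Y.
have sYF : Y \subset F := subsetDl _ _.
have sub1 Z w : (forall b, ~~ Kadj Z w b) -> connect (Kadj Z) w =1 pred1 w.
  move=> no b; apply/connectP/eqP => [[[|c p] /=]|->]; first by move=> _ ->.
    by rewrite (negbTE (no c)).
  by exists [::].
have rootid Z w : (forall b, ~~ Kadj Z w b) -> fingraph.root (Kadj Z) w = w.
  move=> no; have := connect_root (Kadj Z) w; rewrite (sub1 _ _ no) => /eqP //.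
have adjS w b : w \in S -> Kadj F w b -> b \in S /\ Kadj (clique S) w b.
  move=> Sw wb; have Sb : b \in S by rewrite -(stepS w b wb).
  by rewrite Kadj_clique (Kadj_neq wb) Sw.
have adjY w b : w \in ~: S -> Kadj F w b -> b \in ~: S /\ Kadj Y w b.
  rewrite in_setC => Sw wb; rewrite in_setC -(stepS w b wb); split=> //.
  case/KadjP: wb => e' Fe' e'v; apply/KadjP; exists e' => //.
  by rewrite inE Fe' (mem_clique S e'v) (negbTE Sw).
have rS w : w \in S -> fingraph.root (Kadj (clique S)) w = fingraph.root (Kadj F) w.
  move=> Sw; apply: eq_root_connect => b; apply/idP/idP; first exact: Kconnect_sub.
  by case/(connect_trap adjS Sw).
have rS' w : w \notin S -> fingraph.root (Kadj (clique S)) w = w.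
  by move=> Sw; apply: rootid => b; rewrite Kadj_clique (negbTE Sw) andbF.
have rY w : w \notin S -> fingraph.root (Kadj Y) w = fingraph.root (Kadj F) w.
  move=> Sw; apply: eq_root_connect => b; apply/idP/idP; first exact: Kconnect_sub.
  by case/(connect_trap adjY (_ : w \in ~: S)); rewrite ?in_setC.
have rY' w : w \in S -> fingraph.root (Kadj Y) w = w.
  move=> Sw; apply: rootid => b; apply/negP=> wb.
  have [_ cb] := adjS w b Sw (Kadj_sub sYF wb).
  case/KadjP: wb => e'; rewrite inE => /andP[ne' _] e'v; case/negP: ne'.
  by rewrite (mem_clique S e'v) Sw; move: cb; rewrite Kadj_clique => /and3P[].
(* A vertex keeps its root in the part on its own side of [S] and is its own root in the other
   part. *)
rewrite !graphic_rankE -(cardsID S (moved F)); congr (_ + _); apply: eq_card => w.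
  rewrite in_setI !in_moved; case: (boolP (w \in S)) => [/rS->|/rS'->].
    by rewrite andbT.
  by rewrite eqxx andbF.
by rewrite in_setD !in_moved; case: (boolP (w \in S)) => [/rY'->|/rY->]; rewrite ?eqxx.
Qed.

Lemma clique_building S : (1 < #|S|)%N -> clique S \in min_building_set rk.
Proof. by move=> S1; rewrite inE clique_neq0 // clique_flat clique_connected. Qed.

(** Two cliques sharing a vertex generate the clique on the union, which is again in the building
    set; crossing makes the pair an antichain. *)
Lemma clique_cross_not_nested S S' : (1 < #|S|)%N -> (1 < #|S'|)%N ->
  ~~ noncrossing S S' ->
  ~~ nested rk (min_building_set rk) [set clique S; clique S'].
Proof.
move=> S1 S'1; rewrite /noncrossing !negb_or => /and3P[nSS' nS'S /pred0Pn[w]].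
case/andP=> /= Sw S'w; rewrite negb_and; apply/orP; right.
apply/forallPn; exists [set clique S; clique S']; rewrite subxx negb_imply negbK /=.
have neqc : clique S != clique S'.
  by apply: contraNneq nSS' => /(clique_inj S1 S'1)->.
rewrite cards2 neqc /=; apply/andP; split.
  apply/forall_inP=> F1; rewrite !inE => F1P; apply/forall_inP=> F2; rewrite !inE => F2P.
  apply/implyP; case/orP: F1P => /eqP->; case/orP: F2P => /eqP->; rewrite ?eqxx //.
    by rewrite clique_sub // (negbTE nSS').
  by rewrite clique_sub // (negbTE nS'S).
suff -> : flat_join rk [set clique S; clique S'] = clique (S :|: S').
  apply: clique_building; apply: leq_trans S1 _.
  by apply: subset_leq_card; apply: subsetUl.
rewrite /flat_join /cover big_setU1 ?inE //= big_set1; apply/eqP.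
rewrite eqEsubset cl_sub_clique; last first.
  by rewrite subUset !clique_sub // subsetUl subsetUr.
apply/subsetP=> e; have [a [b [_ ev]]] := edgeP e.
rewrite (mem_clique _ ev) (mem_cl _ ev).
have tow x : x \in S :|: S' -> connect (Kadj (clique S :|: clique S')) x w.
  have [->|nxw] := eqVneq x w; first by [].
  rewrite inE => /orP[Sx|S'x]; apply: connect1.
    by apply: (@Kadj_sub (clique S)); rewrite ?subsetUl // Kadj_clique nxw Sx.
  by apply: (@Kadj_sub (clique S')); rewrite ?subsetUr // Kadj_clique nxw S'x.
case/andP=> /tow aw /tow bw; apply: connect_trans aw _.
by rewrite Kconnect_sym.
Qed.

(** Without a crossing pair, the antichain would consist of cliques on disjoint vertex sets, with no
    path from one to another; but its join is a single clique containing them all. *)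
Lemma not_nested_cross (N : {set {set edge}}) : N \subset min_building_set rk ->
  ~~ nested rk (min_building_set rk) N ->
  exists S S', [/\ ~~ noncrossing S S', (1 < #|S|)%N, (1 < #|S'|)%N,
                   clique S \in N & clique S' \in N].
Proof.
move=> sNG; rewrite negb_and sNG /= => /forallPn[C]; rewrite negb_imply negbK.
case/andP=> /and3P[sCN /card_gt1P[F1 [F2 [CF1 CF2 neF]]] /forall_inP anti] joinG.
have memG F : F \in C -> exists2 S : {set V}, (1 < #|S|)%N & F = clique S.
  by move/(subsetP sCN)/(subsetP sNG); apply: building_clique.
have [|no] := boolP [exists S : {set V}, exists S' : {set V},
    [&& ~~ noncrossing S S', (1 < #|S|)%N, (1 < #|S'|)%N, clique S \in N
      & clique S' \in N]].
  by move=> /existsP[S /existsP[S' /and5P[*]]]; exists S, S'; split.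
have dis (S S' : {set V}) : (1 < #|S|)%N -> (1 < #|S'|)%N ->
    clique S \in C -> clique S' \in C -> S != S' -> [disjoint S & S'].
  move=> Sg S'g CS CS' neS.
  have cmp (A B : {set V}) : (1 < #|A|)%N -> (1 < #|B|)%N -> clique A \in C ->
      clique B \in C -> A \subset B -> A = B.
    move=> Ag Bg CA CB sAB; apply: clique_inj => //.
    by have := forall_inP (anti _ CA) _ CB; rewrite clique_sub // sAB => /eqP.
  have : noncrossing S S'.
    apply: contraNT no => ncr; apply/existsP; exists S; apply/existsP; exists S'.
    by rewrite ncr Sg S'g !(subsetP sCN).
  case/or3P=> // [/cmp eS|/cmp eS]; case/eqP: neS; first exact: eS.
  by apply/esym/eS.
have [S1 S1g eF1] := memG F1 CF1; have [S2 S2g eF2] := memG F2 CF2.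
rewrite {}eF1 in CF1 neF; rewrite {}eF2 in CF2 neF.
have neS : S1 != S2 by apply: contraNneq neF => ->.
have [U _ eU] := building_clique joinG.
have subU S : (1 < #|S|)%N -> clique S \in C -> S \subset U.
  move=> Sg CS; rewrite -clique_sub // -eU; apply: subset_trans (sub_cl _).
  exact: (bigcup_max (clique S)).
have /set0Pn[u S1u] : S1 != set0 by rewrite -card_gt0 ltnW.
have /set0Pn[v S2v] : S2 != set0 by rewrite -card_gt0 ltnW.
have d12 := dis S1 S2 S1g S2g CF1 CF2 neS.
have nS1v : v \notin S1 by rewrite (disjointFl d12 S2v).
have nuv : u != v by apply: contraNneq nS1v => <-.
have [e ev] := edge_ex nuv.
have : e \in clique U.
  by rewrite (mem_clique U ev) (subsetP (subU S1 S1g CF1)) ?(subsetP (subU S2 S2g CF2)).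
rewrite -eU (mem_cl _ ev) => cuv.
have step a b : a \in S1 -> Kadj (cover C) a b -> b \in S1 /\ Kadj (cover C) a b.
  move=> S1a ab; split=> //; case/KadjP: ab => e' /bigcupP[F CF Fe'] e'v.
  have [S3 S3g eF] := memG F CF; rewrite eF in CF Fe'.
  move: Fe'; rewrite (mem_clique S3 e'v) => /andP[S3a S3b].
  have [->//|neS3] := eqVneq S1 S3.
  by have := disjointFr (dis S1 S3 S1g S3g CF1 CF neS3) S1a; rewrite S3a.
by have [] := connect_trap step S1u cuv; rewrite (negbTE nS1v).
Qed.

Lemma clique2_rank u v : u != v -> rk (clique [set u; v]) = 1.
Proof.
move=> nuv; have c2 : (1 < #|[set u; v]|)%N by rewrite cards2 nuv.
apply/eqP; rewrite eqn_leq andbC; have /set0Pn[e eF] := clique_neq0 c2.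
rewrite (rank_gt0 eF) graphic_rankE.
pose r := fingraph.root (Kadj (clique [set u; v])).
have adj : Kadj (clique [set u; v]) u v by rewrite Kadj_clique nuv !inE !eqxx orbT.
have ruv : r u = r v.
  by apply/eqP; rewrite (root_connect (Kconnect_sym _)); apply: connect1.
have trap w : w \in [set u; v] -> r w \in [set u; v].
  move=> Sw; have := connect_root (Kadj (clique [set u; v])) w.
  case/(@connect_trap _ _ (Kadj (clique [set u; v])) (mem [set u; v])) => // a b _ ab.
  by split=> //; move: ab; rewrite Kadj_clique => /and3P[].
have sub : moved (clique [set u; v]) \subset [set u; v] :\ r u.
  apply/subsetP=> w; rewrite inE => rw.
  have Sw : w \in [set u; v].
    apply: contraNT rw => Sw; apply/eqP.
    have := connect_root (Kadj (clique [set u; v])) w.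
    case/connectP=> -[|b p] /=; first by move=> _ ->.
    by rewrite Kadj_clique (negbTE Sw) andbF.
  rewrite inE Sw andbT inE; apply: contraNneq rw => w_ru; rewrite -/(r w).
  have -> : r w = r u by move: Sw; rewrite !inE => /orP[]/eqP->.
  by rewrite -w_ru.
apply: leq_trans (subset_leq_card sub) _.
have := cardsD1 (r u) [set u; v]; rewrite trap ?inE ?eqxx // cards2 nuv.
by move=> e2; rewrite -(leq_add2l true) -e2.
Qed.

Lemma flat_atomP F : reflect (exists u v, u != v /\ F = clique [set u; v])
  (flat_atom rk F).
Proof.
apply: (iffP andP) => [[flF /eqP rF]|[u [v [nuv ->]]]]; last first.
  by rewrite clique_flat clique2_rank.
have [F0|[e Fe]] := set_0Vmem F; first by rewrite F0 rank_set0 in rF.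
have [u [v [nuv ev]]] := edgeP e; exists u, v; split=> //.
have sF : clique [set u; v] \subset F.
  apply/subsetP=> e'; rewrite inE => se'; suff -> : e' = e by [].
  apply: val_inj; apply/eqP; rewrite ev eqEcard se' cards2 nuv.
  by rewrite (eqP (valP e')).
apply/eqP; rewrite eq_sym; apply: contraT => neF.
have /properP[_ [e' Fe' ne']] : clique [set u; v] \proper F by rewrite properEneq neF.
have [a [b [_ e'v]]] := edgeP e'.
have : (rk (clique [set u; v]) < rk F)%N.
  apply: (@rank_lt _ _ a b) => //.
    by apply: connect1; apply/KadjP; exists e'.
  rewrite -(mem_cl _ e'v); have /eqP -> := clique_flat [set u; v].
  exact: ne'.
by rewrite rF clique2_rank.
Qed.

End CompleteGraphMatroid.

Local Open Scope ring_scope.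

(** * The closed formula *)

Section TruncatedSeries.

Variable R : comNzRingType.
Implicit Types p q : {poly R}.

(** Congruence modulo ['X^m]. Differentiation loses one order, hence the two bounds [M.+1] and [M]
    in the sequel. *)
Definition eqX (m : nat) p q := forall i, (i < m)%N -> p`_i = q`_i.

Lemma eqX_refl m p : eqX m p p. Proof. by []. Qed.

Lemma eqX_sym m p q : eqX m p q -> eqX m q p.
Proof. by move=> h i lt_im; rewrite h. Qed.

Lemma eqX_trans m p q s : eqX m p q -> eqX m q s -> eqX m p s.
Proof. by move=> h1 h2 i lt_im; rewrite h1 // h2. Qed.

Lemma eqX_leq m n p q : (n <= m)%N -> eqX m p q -> eqX n p q.
Proof. by move=> le_nm h i lt_in; apply: h; apply: leq_trans lt_in le_nm. Qed.

Lemma eqXD m p1 p2 q1 q2 :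
  eqX m p1 q1 -> eqX m p2 q2 -> eqX m (p1 + p2) (q1 + q2).
Proof. by move=> h1 h2 i lt_im; rewrite !coefD h1 // h2. Qed.

Lemma eqXM m p1 p2 q1 q2 :
  eqX m p1 q1 -> eqX m p2 q2 -> eqX m (p1 * p2) (q1 * q2).
Proof.
move=> h1 h2 i lt_im; rewrite !coefM; apply: eq_bigr => j _.
by rewrite h1 ?h2 //; have := ltn_ord j; lia.
Qed.

Lemma eqXX m p q n : eqX m p q -> eqX m (p ^+ n) (q ^+ n).
Proof.
by move=> h; elim: n => // n IHn; rewrite !exprS; apply: eqXM.
Qed.

Lemma eqXMn m p q n : eqX m p q -> eqX m (p *+ n) (q *+ n).
Proof. by move=> h i lt_im; rewrite !coefMn h. Qed.

Lemma eqX_deriv m p q : eqX m.+1 p q -> eqX m p^`() q^`().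
Proof. by move=> h i lt_im; rewrite !coef_deriv h. Qed.

End TruncatedSeries.

(** * Lagrange inversion over a ring without integer torsion *)

Section Lagrange.

Variables (R : comNzRingType) (M : nat) (psi phi : {poly R}).
Hypothesis natmul_inj : forall n (r : R), r *+ n.+1 = 0 -> r = 0.
Hypothesis phi0 : phi`_0 = 1.
Hypothesis phiM : eqX M.+1 (phi * psi) 1.

Lemma natmulI n (r s : R) : r *+ n.+1 = s *+ n.+1 -> r = s.
Proof.
move=> e; apply/eqP; rewrite -subr_eq0; apply/eqP.
by apply: (@natmul_inj n); rewrite mulrnBl e subrr.
Qed.

Lemma phiX_psiX i : eqX M.+1 (phi ^+ i * psi ^+ i) 1.
Proof. by rewrite -exprMn -(expr1n _ i); apply: eqXX. Qed.

Lemma phiX0 m : (phi ^+ m)`_0 = 1.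
Proof.
elim: m => [|m IHm]; first by rewrite expr0 coef1.
by rewrite exprS coefM big_ord_recl big_ord0 /= phi0 subnn IHm mulr1 addr0.
Qed.

Lemma deriv_phi : eqX M phi^`() (- (phi ^+ 2 * psi^`())).
Proof.
have h1 : eqX M (phi^`() * psi + phi * psi^`()) 0.
  by rewrite -derivM -(derivC (1 : R)); apply: eqX_deriv; rewrite polyC1.
have h2 : eqX M (phi * psi) 1 by apply: eqX_leq phiM.
have h3 : eqX M (phi^`() * (phi * psi)) phi^`().
  by rewrite -[X in eqX _ _ X]mulr1; apply: eqXM.
apply: eqX_trans (eqX_sym h3) _.
have -> : phi^`() * (phi * psi) =
   phi * (phi^`() * psi + phi * psi^`()) - phi ^+ 2 * psi^`() by ring.
rewrite -[X in eqX _ _ X]add0r; apply: eqXD => //.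
by rewrite -[X in eqX _ _ X](mulr0 phi); apply: eqXM.
Qed.

Lemma deriv_phiX r :
  eqX M (phi ^+ r)^`() (- (phi ^+ r.+1 * psi^`() *+ r)).
Proof.
case: r => [|r]; first by rewrite expr0 mulr0n oppr0 -polyC1 derivC.
rewrite deriv_exp /= -mulNrn; apply: eqXMn.
have -> : - (phi ^+ r.+2 * psi^`()) = - (phi ^+ 2 * psi^`()) * phi ^+ r.
  by rewrite !exprS; ring.
by apply: eqXM => //; apply: deriv_phi.
Qed.

(** With [g = 'X * psi], this is the residue of [d(g^i) / g^m]: zero for [i != m], where the form is
    proportional to [d(g^(i-m))], and [m] for the logarithmic derivative. *)
Lemma coef_deriv_XpsiX_phiX i m : (0 < i)%N -> (0 < m)%N -> (m <= M)%N ->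
  (((('X * psi) ^+ i)^`()) * phi ^+ m)`_m.-1 = (i == m)%:R *+ m.
Proof.
case: i => // i _; case: m => // m _ lt_mM /=.
rewrite deriv_exp /= derivM derivX mul1r exprMn mulrnAl coefMn.
have -> : (psi + 'X * psi^`()) * ('X^i * psi ^+ i) * phi ^+ m.+1 =
          'X^i * ((psi + 'X * psi^`()) * psi ^+ i * phi ^+ m.+1) by ring.
rewrite coefXnM; case: ltnP => [lt_mi | le_im].
  have /negbTE -> : i.+1 != m.+1 by lia.
  by rewrite !mul0rn.
have [r Er] : exists r, m = (r + i)%N by exists (m - i)%N; rewrite subnK.
rewrite {m le_im}Er in lt_mM *; rewrite addnK -addSn exprD.
have e1 : eqX M.+1 ((psi + 'X * psi^`()) * psi ^+ i * (phi ^+ r.+1 * phi ^+ i))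
            (phi ^+ r + 'X * (phi ^+ r.+1 * psi^`())).
  have -> : (psi + 'X * psi^`()) * psi ^+ i * (phi ^+ r.+1 * phi ^+ i) =
     (phi ^+ i * psi ^+ i) * (phi ^+ r * (phi * psi)
     + 'X * (phi ^+ r.+1 * psi^`())) by rewrite exprS; ring.
  rewrite -[X in eqX _ _ X]mul1r; apply: eqXM; first exact: phiX_psiX.
  apply: eqXD => //; rewrite -[X in eqX _ _ X]mulr1.
  by apply: eqXM.
rewrite {}e1; last by lia.
rewrite coefD coefXM; case: r lt_mM => [|r'] lt_mM /=.
  by rewrite expr0 coef1 eqxx addr0 eqxx.
have /negbTE -> : i.+1 != (r'.+1 + i).+1 by lia.
(* The second series is minus the derivative of [phi ^+ r'.+1] divided by [r'.+1], so the two
   coefficients cancel. *)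
rewrite mul0rn; suff -> : (phi ^+ r'.+1)`_r'.+1 +
   (phi ^+ r'.+2 * psi^`())`_r' = 0 by rewrite mul0rn.
apply: (@natmul_inj r'); rewrite mulrnDl -coef_deriv deriv_phiX; last by lia.
by rewrite coefN coefMn addNr.
Qed.

Variable f : nat -> R.
Hypothesis fE : forall i, (i < M)%N -> f i.+1 *+ i.+1 = (phi ^+ i.+1)`_i.

(** The [f i] are the coefficients of the compositional inverse of ['X * psi]. The residues give one
    equation for each power of [phi] on the derivative of the difference of the two sides; as [phi]
    starts with 1, the system is triangular. *)
Lemma lagrange :
  eqX M.+1 (\sum_(1 <= i < M.+1) f i *: ('X * psi) ^+ i) 'X.
Proof.
set h := \sum_(_ <= _ < _) _.
have hm m : (m < M)%N -> ((h - 'X)^`() * phi ^+ m.+1)`_m = 0.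
  move=> lt_mM; rewrite derivB derivX mulrBl mul1r coefB -fE //.
  apply/eqP; rewrite subr_eq0 raddf_sum /= mulr_suml coef_sum; apply/eqP.
  rewrite (bigD1_seq m.+1) /= ?mem_index_iota ?ltnS ?lt_mM ?iota_uniq //=.
  rewrite derivZ -scalerAl coefZ (@coef_deriv_XpsiX_phiX m.+1 m.+1) //.
  rewrite eqxx mulrnAr mulr1 big_nat_cond big1 ?addr0 // => i.
  case/andP=> /andP[i_gt0 _] ne_im.
  rewrite derivZ -scalerAl coefZ (@coef_deriv_XpsiX_phiX i m.+1) //.
  by rewrite (negbTE ne_im) mul0rn mulr0.
have dk m : (m < M)%N -> ((h - 'X)^`())`_m = 0.
  elim/ltn_ind: m => m IHm lt_mM.
  have := hm m lt_mM; rewrite coefM big_ord_recr /= subnn phiX0 mulr1.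
  rewrite big1 ?add0r // => j _; rewrite IHm ?mul0r ?ltn_ord //.
  exact: ltn_trans (ltn_ord j) lt_mM.
move=> [|j] lt_jM.
  rewrite coefX coef_sum big_nat_cond big1 // => i /andP[/andP[i_gt0 _] _].
  by rewrite coefZ exprMn coefXnM i_gt0 mulr0.
apply/eqP; rewrite -subr_eq0 -coefB; apply/eqP.
by apply: (@natmul_inj j); rewrite -coef_deriv dk.
Qed.

(** The inversion identity is multiplied by [phi ^+ n.+1], in which [phi ^+ i] cancels [psi ^+ i],
    and read in degree [n]. *)
Lemma lagrange_convolution n : (n < M)%N ->
  \sum_(1 <= i < n.+1) f i * (phi ^+ (n.+1 - i))`_(n - i) =
  if n is n'.+1 then (phi ^+ n.+1)`_n' else 0.
Proof.
move=> lt_nM.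
have h : eqX M.+1 ((\sum_(1 <= i < M.+1) f i *: ('X * psi) ^+ i) * phi ^+ n.+1)
                  ('X * phi ^+ n.+1) by apply: eqXM => //; exact: lagrange.
have := h n (ltnW lt_nM); rewrite coefXM => hn.
have -> : (if n is n'.+1 then (phi ^+ n.+1)`_n' else 0) =
          if n == 0%N then 0 else (phi ^+ n.+1)`_n.-1 by case: (n).
rewrite -{}hn mulr_suml coef_sum [RHS](@big_cat_nat _ _ _ n.+1) //=; last by lia.
rewrite [X in _ = _ + X]big_nat_cond [X in _ = _ + X]big1 ?addr0 => [|i]; last first.
  case/andP=> /andP[lt_ni _] _.
  by rewrite exprMn -scalerAl coefZ -mulrA coefXnM lt_ni mulr0.
rewrite big_nat_cond [RHS]big_nat_cond; apply: eq_bigr => i.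
rewrite andbT => /andP[i_gt0]; rewrite ltnS => le_in.
rewrite exprMn -scalerAl coefZ -mulrA coefXnM ltnNge le_in /=; congr (_ * _).
have -> : phi ^+ n.+1 = phi ^+ i * phi ^+ (n.+1 - i).
  by rewrite -exprD; congr (_ ^+ _); lia.
rewrite mulrA (mulrC (psi ^+ i)) -[LHS](congr1 (fun p : {poly R} => p`_(n - i)) (mul1r _)).
by apply: (eqXM (eqX_sym (phiX_psiX i)) (@eqX_refl _ M.+1 _)); lia.
Qed.

End Lagrange.

(** * Weighted sums over set partitions *)

Section SetPartitionSum.

Variables (a : nat -> {poly rat}) (T : finType).

(** The parameter [m] is independent of [#|U|]: taking a block out shrinks [U] but raises [m] by
    one. *)
Definition partition_sum (m : nat) (U : {set T}) : {poly rat} :=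
  \sum_(L : {set {set T}} | partition L U)
    ((m + #|L|)`!%:R / m`!%:R) *: \prod_(B in L) a #|B|.

Lemma partition_sum0 m : partition_sum m set0 = 1.
Proof.
rewrite /partition_sum (big_pred1 set0) => [|L]; last by rewrite /= partition_set0.
by rewrite cards0 addn0 divff ?pnatr_eq0 -?lt0n ?fact_gt0 // big_set0 scale1r.
Qed.

(** Partitions are sorted by the block [B] of [z]. With one block fewer, the quotient of factorials
    becomes [m.+1] times the same quotient for [m.+1]. *)
Lemma partition_sumD1 m (U : {set T}) z : z \in U ->
  partition_sum m U =
  (\sum_(B : {set T} | (B \subset U) && (z \in B))
     a #|B| * partition_sum m.+1 (U :\: B)) *+ m.+1.
Proof.
move=> Uz; rewrite /partition_sum.
rewrite (partition_big (fun L => pblock L z)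
   (fun B : {set T} => (B \subset U) && (z \in B))) /=; last first.
  move=> L partL; have covL := cover_partition partL.
  rewrite mem_pblock covL Uz andbT -covL.
  by apply: (bigcup_max (pblock L z)); rewrite // pblock_mem ?covL.
rewrite -sumrMnl; apply: eq_bigr => B /andP[sBU zB].
rewrite (reindex_onto (fun L' => B |: L') (fun L => L :\ B)) /=; last first.
  move=> L /andP[partL /eqP defB]; rewrite setD1K // -defB pblock_mem //.
  by rewrite (cover_partition partL).
rewrite mulr_sumr -sumrMnl; apply: eq_big => [L | L].
  apply/andP/idP => [[/andP[partL /eqP defB] /eqP defL] | partL].
    by rewrite -defL; apply: partitionD1 => //; rewrite setU11.
  have disB : [disjoint B & U :\: B] by rewrite disjoint_sym disjoints_subset setDE subsetIr.
  have nB0 : B != set0 by apply/set0Pn; exists z.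
  have nLB : B \notin L.
    apply: contraTN partL => LB; apply/negP=> partL.
    have : z \in cover L by apply/bigcupP; exists B.
    by rewrite (cover_partition partL) !inE zB.
  have partBL : partition (B |: L) U.
    have := partitionU1 partL nB0 disB; congr (partition _ _).
    by apply/setP=> y; rewrite !inE; case: (y \in B) (subsetP sBU y) => //= ->.
  rewrite partBL setU1K // eqxx; split=> //; rewrite andTb.
  by rewrite (def_pblock (B := B)) ?setU11 //; case/and3P: partBL.
case/andP=> /andP[partL _] /eqP defL.
have nLB : B \notin L by rewrite -defL !inE eqxx.
rewrite cardsU1 nLB big_setU1 //= add1n addnS -scalerAr -scaler_nat scalerA.
congr (_ *: _); rewrite addSn [in RHS](factS m) natrM.
set b := (_.+1`!)%:R; have b0 : (m`!)%:R != 0 :> rat.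
  by rewrite pnatr_eq0 -lt0n fact_gt0.
have c0 : m.+1%:R != 0 :> rat by rewrite pnatr_eq0.
by move: (m.+1%:R) (m`!%:R) b c0 b0 => e h b e0 h0; field; rewrite e0 h0.
Qed.

End SetPartitionSum.

Lemma poly_rat_natmul_inj n (r : {poly rat}) : r *+ n.+1 = 0 -> r = 0.
Proof.
by move/eqP; rewrite -scaler_nat scaler_eq0 pnatr_eq0 /= => /eqP.
Qed.

Lemma sum_subset_card (T : finType) (V : nmodType) (U : {set T}) (F : nat -> V) :
  \sum_(A : {set T} | A \subset U) F #|A| =
  \sum_(0 <= k < #|U|.+1) F k *+ 'C(#|U|, k).
Proof.
rewrite big_mkord (partition_big (fun A : {set T} => inord #|A| : 'I_#|U|.+1)
  predT) //=; apply: eq_bigr => k _.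
rewrite (eq_bigr (fun=> F k)) => [|A /andP[sAU /eqP <-]]; last first.
  by rewrite inordK // ltnS subset_leq_card.
rewrite sumr_const -cards_draws; congr (_ *+ _); rewrite -sum1_card -[RHS]sum1_card.
apply: eq_bigl => A; rewrite !inE; apply: andb_id2l => sAU.
by rewrite -val_eqE /= inordK // ltnS subset_leq_card.
Qed.

(** * The exponential formula for these sums *)

Section PartitionSeries.

Variables (a : nat -> {poly rat}) (M : nat).

Definition block_series : {poly {poly rat}} :=
  \poly_(k < M.+1) (if k == 0%N then 0 else k`!%:R^-1 *: a k).

Definition block_geom : {poly {poly rat}} := \sum_(l < M.+1) block_series ^+ l.

Let u := block_series.
Let phi := block_geom.

Lemma block_series0 : u`_0 = 0.
Proof. by rewrite coef_poly. Qed.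

Lemma block_geomM : eqX M.+1 (phi * (1 - u)) 1.
Proof.
have -> : phi * (1 - u) = 1 - u ^+ M.+1.
  by rewrite mulrC -[in RHS](expr1n _ M.+1) subrXX; congr (_ * _);
     apply: eq_bigr => i _; rewrite expr1n mul1r.
have uX : exists v, u = 'X * v.
  exists (\poly_(i < M) u`_i.+1); apply/polyP=> -[|i].
    by rewrite block_series0 coefXM.
  rewrite coefXM /= [RHS]coef_poly; case: ltnP => // le_Mi.
  by rewrite coef_poly ltnS ltnNge le_Mi.
case: uX => v ->; rewrite exprMn => i lt_iM.
by rewrite coefB coefXnM lt_iM subr0.
Qed.

Lemma block_geom0 : phi`_0 = 1.
Proof.
rewrite coef_sum big_ord_recl expr0 coef1 /= big1 ?addr0 // => i _.
by rewrite exprS coefM big_ord_recl big_ord0 block_series0 mul0r addr0.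
Qed.

(** Removing the block of a point mirrors differentiation: the derivative of [phi ^+ m.+1] is [m.+1]
    times [phi ^+ m.+2] times that of the block series. *)
Lemma partition_sum_coef (T : finType) m (U : {set T}) : (#|U| <= M)%N ->
  partition_sum a m U = (phi ^+ m.+1)`_#|U| *+ #|U|`!.
Proof.
have [k leUk] := ubnP #|U|; elim: k => // k IHk in m U leUk *.
have [-> _|[z Uz] leUM] := set_0Vmem U.
  rewrite partition_sum0 cards0 mulr1n; symmetry.
  exact: (phiX0 block_geom0).
rewrite (partition_sumD1 a m Uz).
pose N := #|U :\ z|; have UN : #|U| = N.+1 by rewrite (cardsD1 z U) Uz.
(* Here [k] counts the points of the block of [z] other than [z]. *)
pose F k := a k.+1 * (phi ^+ m.+2)`_(N - k) *+ (N - k)`!.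
have -> : \sum_(B : {set T} | (B \subset U) && (z \in B))
     a #|B| * partition_sum a m.+1 (U :\: B) =
   \sum_(A : {set T} | A \subset U :\ z) F #|A|.
  rewrite (reindex_onto (fun A => z |: A) (fun B => B :\ z)) /=; last first.
    by move=> B /andP[_ zB]; rewrite setD1K.
  apply: eq_big => [A | A /andP[/andP[sAU _] /eqP defA]].
    rewrite setU11 andbT subUset sub1set Uz subsetD1 /=; congr (_ && _).
    apply/eqP/idP => [<-|nAz]; first by rewrite !inE eqxx.
    by rewrite setU1K.
  have nAz : z \notin A by rewrite -defA !inE eqxx.
  have cA : #|z |: A| = #|A|.+1 by rewrite cardsU1 nAz.
  have cUA : #|U :\: (z |: A)| = (N - #|A|)%N.
    by rewrite cardsD (setIidPr sAU) cA UN subSS.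
  by rewrite IHk cUA ?cA ?mulrnAr //; lia.
rewrite sum_subset_card -/N -sumrMnl UN factS mulrnA -coef_deriv.
rewrite (deriv_phiX block_geomM); last by rewrite -UN.
rewrite coefN coefMn derivB -polyC1 derivC sub0r mulrN coefN !mulNrn opprK.
rewrite mulrC coefM [LHS]sumrMnl -mulrnA mulnC mulrnA; congr (_ *+ _).
rewrite big_mkord -sumrMnl; apply: eq_bigr => i _; rewrite /F.
have le_iN : (i <= N)%N by rewrite -ltnS ltn_ord.
rewrite coef_deriv coef_poly; have -> : (i.+1 < M.+1)%N by lia.
rewrite -mulrnA mulrnAl -mulrnA -scalerAl -!scaler_nat scalerA; congr (_ *: _).
rewrite -(bin_fact le_iN) factS !natrM.
have i0 : (i`!)%:R != 0 :> rat by rewrite pnatr_eq0 -lt0n fact_gt0.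
have i1 : (i.+1)%:R != 0 :> rat by rewrite pnatr_eq0.
by move: (i.+1%:R) (i`!%:R) ((N - i)`!%:R) i1 i0 => e h b e0 h0; field; rewrite e0 h0.
Qed.

End PartitionSeries.

Definition chi_weight (k : nat) : {poly rat} := k.+1%:R^-1 *: chibar k.+1.

Definition M0bar_formula (n : nat) : {poly rat} :=
  partition_sum chi_weight n.-1 [set: 'I_n.-1].

Lemma chibarS m : (2 <= m)%N -> chibar m.+1 = chibar m * ('X - m%:R%:P).
Proof. by move=> m_ge2; rewrite /chibar big_nat_recr. Qed.

(** * The differential equation and the recurrence of the closed formula *)

Section Recurrence.

Variable M : nat.

Let psi : {poly {poly rat}} := 1 - block_series chi_weight M.
Let phi := block_geom chi_weight M.
Let c m i := (phi ^+ m)`_i.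

Let phiM : eqX M.+1 (phi * psi) 1 := @block_geomM chi_weight M.
Let phi0 : phi`_0 = 1 := @block_geom0 chi_weight M.

Lemma psi_coef k : (k <= M)%N ->
  psi`_k = if k == 0%N then 1 else - ((k.+1 * k`!)%N%:R^-1 *: chibar k.+1).
Proof.
move=> le_kM; rewrite coefB coef1 coef_poly ltnS le_kM.
case: k le_kM => [|k] le_kM /=; first by rewrite subr0.
by rewrite sub0r scalerA natrM invfM mulrC.
Qed.

(* With [g = 'X * psi], this is [g' (1 + w) = 1 + x g - x w]. *)
Lemma psi_ode :
  eqX M.+1 ((psi + 'X * psi^`()) * (1 + 'X))
           (1 + 'X%:P * 'X * psi - 'X%:P * 'X).
Proof.
have := psi_coef; move: psi => p pE i; rewrite ltnS => le_iM.
have dE j : (p + 'X * p^`())`_j = p`_j *+ j.+1.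
  rewrite coefD coefXM; case: j => [|j] /=; first by rewrite addr0.
  by rewrite coef_deriv -mulrS.
rewrite mulrDr mulr1 coefD coefMX !dE coefB coefD coef1 -mulrA !coefCM !coefXM coefX.
(* Degrees 0 and 1 are separate because [chibar] has no factor ['X - 1]; the last term of the
   equation compensates for this in degree 1. *)
case: i le_iM => [|[|i]] le_iM /=.
- by rewrite pE // mulr0 !addr0 subr0.
- rewrite !pE ?(ltnW le_iM) //= mulr1 add0r subrr mulr1n muln1.
  rewrite /chibar big_geq // mulNrn -scaler_nat scalerA divff ?pnatr_eq0 //.
  by rewrite scale1r addNr.
rewrite !pE ?(ltnW le_iM) //= mulr0 subr0 add0r chibarS //.
rewrite !mulNrn -!scaler_nat !scalerA mulrN -opprD; congr (- _).
have i0 : (i.+1`!)%:R != 0 :> rat by rewrite pnatr_eq0 -lt0n fact_gt0.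
have n0 k : (k.+1)%:R != 0 :> rat by rewrite pnatr_eq0.
have -> : (i.+3)%:R / (i.+3 * i.+2`!)%:R = (i.+2 * i.+1`!)%:R^-1 :> rat.
  by rewrite natrM invfM mulrA divff ?n0 // mul1r factS.
set K := _^-1; set x := chibar _; rewrite mulrBr scalerBr.
by rewrite (mulrC x _%:P) mul_polyC scalerA (mulrC K) subrK -scalerAr mulrC.
Qed.

(** The differential equation is multiplied by [phi ^+ n.+1] and read in degree [n]. There the
    derivative of [psi] turns into that of [phi ^+ n], up to the factor [- n], so the coefficients
    [c n n] cancel. *)
Lemma phi_recurrence n : (0 < n <= M)%N ->
  c n.+1 n *+ n = 'X * c n.+1 n.-1 *+ n + c n n.-1 - 'X * c n n.-1 *+ n.
Proof.
case: n => // n /andP[_ le_nM] /=.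
pose E := phi ^+ n.+2 * psi^`().
have EE j : (j < M)%N -> E`_j *+ n.+1 = - (c n.+1 j.+1 *+ j.+1).
  move=> lt_jM; rewrite -coefMn -[LHS]opprK -coefN.
  by rewrite -(deriv_phiX phiM n.+1 lt_jM) coef_deriv.
have h1 : eqX M.+1 (phi ^+ n.+2 * psi) (phi ^+ n.+1).
  rewrite exprSr -mulrA -[X in eqX _ _ X]mulr1.
  exact: eqXM (@eqX_refl _ _ _) phiM.
have h2 : eqX M.+1 ((phi ^+ n.+1 + 'X * E) * (1 + 'X))
   (phi ^+ n.+2 + 'X%:P * 'X * phi ^+ n.+1 - 'X%:P * 'X * phi ^+ n.+2).
  apply: (@eqX_trans _ _ _ (phi ^+ n.+2 * ((psi + 'X * psi^`()) * (1 + 'X)))).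
    have -> : phi ^+ n.+2 * ((psi + 'X * psi^`()) * (1 + 'X)) =
       (phi ^+ n.+2 * psi + 'X * E) * (1 + 'X) by rewrite /E; ring.
    by apply: eqXM => //; apply: eqXD => //; apply: eqX_sym.
  apply: eqX_trans (eqXM (@eqX_refl _ _ _) psi_ode) _.
  have -> : phi ^+ n.+2 * (1 + 'X%:P * 'X * psi - 'X%:P * 'X) =
    phi ^+ n.+2 + 'X%:P * 'X * (phi ^+ n.+2 * psi)
      - 'X%:P * 'X * phi ^+ n.+2 by ring.
  by apply: eqXD => //; apply: eqXD => //; apply: eqXM.
have := h2 n.+1 le_nM.
rewrite mulrDr mulr1 coefD coefMX /= coefB !coefD -!mulrA !coefCM !coefXM /=.
rewrite -/(c n.+1 n.+1) -/(c n.+1 n) -/(c n.+2 n.+1) -/(c n.+2 n).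
move/(congr1 (fun r => r *+ n.+1)); rewrite !mulrnDl EE //.
have -> : (if n == 0%N then 0 else E`_n.-1) *+ n.+1 = - (c n.+1 n *+ n).
  case: n le_nM E EE {h1 h2} => [|n'] le_nM E EE /=; first by rewrite mul0rn oppr0.
  by rewrite EE //; lia.
move=> h; apply/eqP; rewrite -subr_eq0; apply/eqP; rewrite mulNrn in h.
have -> : c n.+2 n.+1 *+ n.+1 = c n.+1 n.+1 *+ n.+1 - c n.+1 n.+1 *+ n.+1 +
   (c n.+1 n *+ n.+1 - c n.+1 n *+ n) - 'X * c n.+1 n *+ n.+1
   + 'X * c n.+2 n *+ n.+1.
  by rewrite h; ring.
by rewrite [c n.+1 n *+ n.+1]mulrS; ring.
Qed.

End Recurrence.

(** Any truncation order [M >= n] will do, so all the terms of a recurrence can be read from the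
    same [phi]. *)
Lemma M0bar_formulaE M n : (0 < n <= M)%N ->
  M0bar_formula n = (block_geom chi_weight M ^+ n)`_n.-1 *+ n.-1`!.
Proof.
case: n => // n /andP[_ le_nM]; rewrite /M0bar_formula /=.
by rewrite (@partition_sum_coef _ M) ?cardsT ?card_ord // ltnW.
Qed.

Lemma M0bar_formula1 : M0bar_formula 1 = 1.
Proof. by rewrite (@M0bar_formulaE 1) //= expr1 mulr1n block_geom0. Qed.

(** Divided by factorials, the formula gives the Lagrange coefficients [f], and the sum becomes a
    convolution that Lagrange inversion evaluates; what remains is [phi_recurrence]. *)
Lemma M0bar_formulaS n : (0 < n)%N ->
  M0bar_formula n.+1 = M0bar_formula n +
    'X * \sum_(2 <= k < n.+1)
           M0bar_formula k * M0bar_formula (n.+1 - k) *+ 'C(n, k).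
Proof.
move=> n_gt0; pose M := n.+1.
pose phi := block_geom chi_weight M; pose c m i := (phi ^+ m)`_i.
pose f i := i%:R^-1 *: c i i.-1.
have fE i : (0 < i)%N -> f i *+ i = c i i.-1.
  move=> i_gt0; rewrite -scaler_nat scalerA divff ?scale1r //.
  by rewrite pnatr_eq0 -lt0n.
have QE k : (0 < k <= M)%N -> M0bar_formula k = f k *+ k`!.
  move=> h; have /andP[k_gt0 _] := h; rewrite (M0bar_formulaE h) -/(c k k.-1).
  by rewrite -fE // -mulrnA; congr (_ *+ _); case: (k) k_gt0.
have conv : \sum_(1 <= i < n.+1) f i * c (n.+1 - i)%N (n - i)%N = c n.+1 n.-1.
  have := @lagrange_convolution _ M _ phi poly_rat_natmul_inj
     (block_geom0 _ _) (@block_geomM chi_weight M) f.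
  move=> /(_ (fun i _ => fE i.+1 isT) n (ltnSn n)) ->.
  by case: (n) n_gt0.
have rec := @phi_recurrence M n; rewrite n_gt0 leqnSn in rec.
have {}rec := rec isT; rewrite -/phi -!/(c _ _) in rec.
have sumE : \sum_(2 <= k < n.+1)
     M0bar_formula k * M0bar_formula (n.+1 - k) *+ 'C(n, k) =
   (c n.+1 n.-1 - c n n.-1) *+ n`!.
  have f1 : f 1%N = 1 by rewrite /f invr1 scale1r /c expr1 block_geom0.
  (* The convolution starts at 1 but the sum at 2; the difference is the term [c n n.-1]. *)
  rewrite -conv [in RHS]big_ltn // f1 mul1r subn1 /= subn1.
  rewrite addrAC subrr add0r -sumrMnl.
  rewrite big_nat_cond [RHS]big_nat_cond; apply: eq_bigr => k.
  rewrite andbT => /andP[k_ge2]; rewrite ltnS => le_kn.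
  rewrite !QE; [|lia..].
  have -> : f (n.+1 - k)%N *+ (n.+1 - k)`! = c (n.+1 - k)%N (n - k)%N *+ (n - k)`!.
    rewrite subSn // factS mulrnA fE //.
  rewrite mulrnAl mulrnAr -!mulrnA; congr (_ *+ _).
  by rewrite -(bin_fact le_kn); move: 'C(n, k) (k`!) ((n - k)`!) => x y z; ring.
rewrite sumE !QE; [|lia..].
rewrite factS mulrnA fE //= mulrnAr -mulrnDl; congr (_ *+ _).
apply: (@natmulI _ poly_rat_natmul_inj n.-1); rewrite prednK //.
rewrite rec mulrnDl fE // mulrBr mulrnBl; ring.
Qed.

(** * Counting the basis *)

Section NestedCount.

Variable T : finType.
Implicit Types (A B S U : {set T}) (N : {set {set T}}).

(* The exponents allowed at a node with [c] children are [1, .., c - 2]. *)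
Definition node_weight (c : nat) : {poly rat} := \sum_(1 <= j < c.-1) 'X^j.

Definition nested_weight N : {poly rat} :=
  \prod_(S in N) node_weight #|blocks N S|.

Definition nested_poly U : {poly rat} :=
  \sum_(N | laminar_on U N) nested_weight N.

Lemma node_weightS c : (1 < c)%N -> node_weight c.+1 = 'X * (1 + node_weight c).
Proof.
case: c => [|[|c]] // _; rewrite /node_weight /= big_ltn // expr1 mulrDr mulr1.
congr (_ + _); rewrite mulr_sumr [LHS]big_add1 /=.
by apply: eq_bigr => j _; rewrite exprS.
Qed.

Lemma nested_weight_point A N : laminar_on A N -> A \notin N ->
  nested_weight (A |: N) = node_weight #|blocks N A| * nested_weight N.
Proof.
move=> /laminar_onP[lamN NA] nNA.
have eqb S : S \subset A -> blocks (A |: N) S = blocks N S.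
  move=> sSA; apply: eq_blocks => B pBS; rewrite !inE.
  by case: eqP => // BA; rewrite BA properE sSA andbF in pBS.
rewrite /nested_weight big_setU1 //= eqb //; congr (_ * _).
by apply: eq_bigr => S NS; rewrite eqb //; have [] := NA S NS.
Qed.

Lemma laminar_on_point A N : (1 < #|A|)%N ->
  laminar_on A (A |: N) = laminar_on A N.
Proof.
move=> A1; apply/laminar_onP/laminar_onP => -[lamN NA]; split.
- by apply: laminarS lamN; apply: subsetUr.
- by move=> B NB; apply: NA; rewrite !inE NB orbT.
- apply/laminarP=> B C; rewrite !inE.
  case/orP=> [/eqP->|NB] /orP[/eqP->|NC].
  + by rewrite /noncrossing subxx.
  + by rewrite /noncrossing; have [-> _] := NA C NC; rewrite orbT.
  + by rewrite /noncrossing; have [-> _] := NA B NB.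
  + exact: (laminarP _ lamN).
- by move=> B; rewrite !inE => /orP[/eqP->|/NA].
Qed.

(** Whether or not [A] is a node contributes [node_weight c] or 1; their sum times ['X] is the
    weight of a node with one more child. *)
Lemma nested_poly_root A : (1 < #|A|)%N ->
  'X * nested_poly A = \sum_(N | laminar_on A N && (A \notin N))
     nested_weight N * node_weight #|blocks N A|.+1.
Proof.
move=> A1; rewrite /nested_poly (bigID (fun N => A \in N)) /=.
have -> : \sum_(N | laminar_on A N && (A \in N)) nested_weight N =
   \sum_(N | laminar_on A N && (A \notin N))
      nested_weight N * node_weight #|blocks N A|.
  rewrite (reindex_onto (fun N => A |: N) (fun N => N :\ A)) /=; last first.
    by move=> N /andP[_ NA]; rewrite setD1K.
  have nN N : ((A |: N) :\ A == N) = (A \notin N).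
    apply/eqP/idP => [<-|nNA]; first by rewrite !inE eqxx.
    by rewrite setU1K.
  apply: eq_big => [N | N]; first by rewrite laminar_on_point // setU11 andbT nN.
  rewrite laminar_on_point // nN => /andP[/andP[lamN _] nNA].
  by rewrite nested_weight_point // mulrC.
rewrite -big_split mulr_sumr; apply: eq_bigr => N /andP[/laminar_onP[lamN _] _] /=.
rewrite node_weightS; last exact: card_blocks_gt1.
by rewrite [RHS]mulrCA [in RHS]mulrDr mulr1 addrC.
Qed.

(** Grafting multiplies the weights of the two forests and that of [z |: A], which has one child
    more than [A]; [nested_poly_root] absorbs this extra child. *)
Lemma nested_poly_graft U A z : z \in U -> A \subset U :\ z -> A != set0 ->
  \sum_(N | laminar_on U N && lowest_at_z A z N) nested_weight N =
  if (1 < #|A|)%N then 'X * nested_poly A * nested_poly (U :\: A) else 0.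
Proof.
move=> zU sAU A0; have zA : z \notin A.
  by apply: contraTN sAU => zA; apply/subsetPn; exists z; rewrite ?inE ?eqxx.
(* If [A] is a member, the only children of [z |: A] are [z] and [A], and a node with two children
   has weight 0. *)
rewrite (bigID (fun N => A \in N)) /= big1 ?add0r => [|N]; last first.
  case/andP=> /andP[/laminar_onP[lamN NU] /andP[Nv /forall_inP low]] NA.
  rewrite /nested_weight (bigD1 (z |: A)) //=.
  suff -> : #|blocks N (z |: A)| = 2%N by rewrite /node_weight big_geq // mul0r.
  have pA : A \proper z |: A.
    by rewrite properEneq subsetUr andbT; apply: contraNneq zA => ->; rewrite setU11.
  have bz : blk N (z |: A) z = [set z].
    apply/setP=> y; rewrite inE; apply/blkP/eqP => [[//|[B [NB pB zB _]]]|->]; last by left.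
    by have := implyP (low B NB) zB; rewrite (negbTE (proper_subn pB)).
  have bA x : x \in A -> blk N (z |: A) x = A.
    move=> Ax; apply/eqP; rewrite eqEsubset sub_blk // andbT.
    apply/subsetP=> y /blkP[->//|[B [NB pB xB yB]]].
    have := subsetP (proper_sub pB) y yB; rewrite !inE => /orP[/eqP yz|//].
    rewrite yz in yB; have := implyP (low B NB) yB.
    by rewrite (negbTE (proper_subn pB)).
  rewrite /blocks imsetU1 bz (eq_in_imset bA).
  have /set0Pn[x Ax] := A0.
  have -> : [set A | _ in A] = [set A].
    apply/setP=> B; rewrite inE; apply/imsetP/eqP => [[]//|->]; by exists x.
  rewrite cards2; case: eqP => // zA'; by rewrite -zA' set11 in zA.
rewrite [LHS](reindex_onto (graft A z) (ungraft A z)) /=; last first.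
  by move=> N /andP[/andP[lamU low] _]; apply: (ungraftK sAU).
rewrite [LHS](eq_bigl (fun N12 : {set {set T}} * {set {set T}} =>
                             (laminar_on A N12.1 && (A \notin N12.1)) &&
                             laminar_on (U :\: A) N12.2)) => [|[N1 N2]]; last first.
  apply/andP/andP => [[/andP[/andP[lamU low] nA] /eqP e]|[/andP[lam1 nA1] lam2]].
    have [] := ungraft_laminar_on sAU lamU low nA.
    by rewrite e /= => -> -> ->.
  have lamG := graft_laminar_on zU sAU A0 lam1 nA1 lam2.
  have /andP[low nA] := graft_lowest sAU lam1 nA1 lam2.
  by rewrite lamG low nA (graftK sAU lam1 nA1 lam2) eqxx.
have wE N1 N2 : laminar_on A N1 -> A \notin N1 -> laminar_on (U :\: A) N2 ->
    nested_weight (graft A z (N1, N2)) =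
    nested_weight N1 * node_weight #|blocks N1 A|.+1 * nested_weight N2.
  move=> lam1 nA1 lam2; rewrite {1}/nested_weight /graft /=.
  set V := unfold_point A z @: N2.
  have nV : z |: A \notin V.
    apply/imsetP=> -[X NX e].
    by have := unfold_neq_point z lam2 NX; rewrite e eqxx.
  have dis : [disjoint N1 & (z |: A) |: V].
    apply/pred0P=> B /=; apply/negbTE/negP=> /andP[N1B].
    have [/proper_sub sBA _] := graft_in lam1 nA1 N1B.
    rewrite !inE => /orP[/eqP e|/imsetP[X NX e]].
      by have := point_not_sub sAU; rewrite -e sBA.
    by have := unfold_not_sub z lam2 NX; rewrite -e sBA.
  rewrite (eq_bigl [predU N1 & (z |: A) |: V]) => [|B]; last by rewrite !inE.
  rewrite bigU //= big_setU1 //= -mulrA; congr (_ * (_ * _)).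
  - apply: eq_bigr => S NS; rewrite (blocks_graft_in sAU N1 lam2) //.
    by have [/proper_sub] := graft_in lam1 nA1 NS.
  - by rewrite (blocks_graft_point sAU lam1 nA1 lam2).
  rewrite big_imset /=; last first.
    move=> X Y NX NY e; have [_ dX _] := graft_out lam2 NX.
    have [_ dY _] := graft_out lam2 NY.
    by rewrite -(unfoldK z dX) -(unfoldK z dY) e.
  by apply: eq_bigr => X NX; rewrite (blocks_graft_out zU sAU A0 lam1 nA1 lam2).
rewrite [LHS](eq_bigr (fun N12 : {set {set T}} * {set {set T}} =>
   nested_weight N12.1 * node_weight #|blocks N12.1 A|.+1 *
   nested_weight N12.2)) => [|[N1 N2] /andP[/andP[h1 h2] h3]]; last exact: wE.
rewrite -(pair_big_dep (fun N1 => laminar_on A N1 && (A \notin N1))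
  (fun _ N2 => laminar_on (U :\: A) N2)
  (fun N1 N2 => nested_weight N1 * node_weight #|blocks N1 A|.+1 * nested_weight N2)) /=.
rewrite (eq_bigr _ (fun N1 _ => esym (mulr_sumr _ _ _ _))) -mulr_suml.
case: ifP => [A1|A1]; first by rewrite nested_poly_root.
(* When [A] is a single point, [z |: A] again has only two children. *)
rewrite [X in X * _]big1 ?mul0r // => N1 _.
suff -> : #|blocks N1 A| = 1%N by rewrite /node_weight big_geq ?mulr0.
have cA : #|A| = 1%N by have := A0; rewrite -card_gt0; lia.
by apply/eqP; rewrite eqn_leq -{1}cA leq_imset_card card_gt0;
   have /set0Pn[x Ax] := A0; apply/set0Pn; exists (blk N1 A x); apply: imset_f.
Qed.

(** Either no member contains [z], or the smallest one that does is [z |: A] for a unique nonempty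
    [A]. *)
Lemma nested_polyD1 U z : z \in U ->
  nested_poly U = nested_poly (U :\ z) +
    'X * \sum_(A : {set T} | (A \subset U :\ z) && (1 < #|A|)%N)
       nested_poly A * nested_poly (U :\: A).
Proof.
move=> zU; rewrite {1}/nested_poly (bigID (fun N => z \notin cover N)) /=.
congr (_ + _).
  apply: eq_bigl => N; apply/andP/idP => [[/laminar_onP[lamN NU] nz]|].
    apply/laminar_onP; split=> // B NB; have [sBU B1] := NU B NB; split=> //.
    rewrite subsetD1 sBU; apply: contra nz => zB.
    by apply/bigcupP; exists B.
  case/laminar_onP=> lamN NU; split.
    apply/laminar_onP; split=> // B NB; have [sBU B1] := NU B NB; split=> //.
    by apply: subset_trans sBU (subD1set _ _).
  apply/bigcupP=> -[B NB zB]; have [sBU _] := NU B NB.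
  by have := subsetP sBU z zB; rewrite !inE eqxx.
have lowP N : laminar_on U N && ~~ (z \notin cover N) -> exists A0, forall A,
    ((A \subset U :\ z) && (A != set0)) && lowest_at_z A z N = (A == A0).
  rewrite negbK => /andP[/laminar_onP[lamN NU] /bigcupP[B0 NB0 zB0]].
  have PB0 : (B0 \in N) && (z \in B0) by rewrite NB0.
  have [v /andP[Nv zv] vmin] :=
    @arg_minnP _ B0 (fun B => (B \in N) && (z \in B)) (fun B => #|B|) PB0.
  have {}vmin B : B \in N -> z \in B -> v \subset B.
    move=> NB zB; have := laminar_mem_cmp lamN Nv NB zv zB.
    case/orP=> // sBv; have := vmin B; rewrite NB zB => /(_ isT) le_vB.
    by have /eqP-> : B == v by rewrite eqEcard sBv.
  exists (v :\ z) => A; apply/andP/eqP => [[/andP[sAU _] /andP[NA /forall_inP low]]|->].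
    have zA : z \notin A.
      by apply: contraTN sAU => zA; apply/subsetPn; exists z; rewrite ?inE ?eqxx.
    suff <- : z |: A = v by rewrite setU1K.
    by apply/eqP; rewrite eqEsubset (implyP (low v Nv)) // vmin // setU11.
  have [svU v1] := NU v Nv.
  rewrite setSD //= /lowest_at_z setD1K // Nv; split.
    by rewrite -card_gt0; move: v1; rewrite (cardsD1 z) zv.
  by apply/forall_inP=> B NB; apply/implyP; apply: vmin.
transitivity (\sum_(A : {set T} | (A \subset U :\ z) && (A != set0))
   \sum_(N | laminar_on U N && lowest_at_z A z N) nested_weight N); last first.
  rewrite mulr_sumr (bigID (fun A : {set T} => (1 < #|A|)%N)) /=.
  rewrite [X in _ + X]big1 ?addr0 => [|A /andP[/andP[sA A0] A1]]; last first.
    by rewrite nested_poly_graft // (negbTE A1).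
  apply: eq_big => [A|A /andP[/andP[sA A0] A1]].
    rewrite -andbA; congr (_ && _); rewrite -card_gt0.
    by case: (#|A|) => [|[]].
  by rewrite nested_poly_graft // A1 mulrA.
rewrite (exchange_big_dep (fun N => laminar_on U N && ~~ (z \notin cover N))) /=.
  apply: eq_bigr => N PN; have [A0 A0P] := lowP N PN.
  rewrite (big_pred1 A0) // => A /=; case/andP: PN => -> _.
  exact: A0P.
move=> A N _ /andP[-> /andP[Nv _]]; rewrite negbK.
by apply/bigcupP; exists (z |: A) => //; rewrite setU11.
Qed.

Lemma nested_poly_set1 z : nested_poly [set z] = 1.
Proof.
rewrite /nested_poly (big_pred1 set0) ?/nested_weight ?big_set0 // => N /=.
apply/laminar_onP/eqP => [[_ NU]|->]; last first.
  by split=> [|B]; [apply/laminarP=> B C|]; rewrite inE.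
apply/setP=> B; rewrite inE; apply/negP=> /NU[/subset_leq_card].
by rewrite cards1 leqNgt => /negP.
Qed.

End NestedCount.

Lemma nested_polyE (T : finType) (U : {set T}) : U != set0 ->
  nested_poly U = M0bar_formula #|U|.
Proof.
have [n] := ubnP #|U|; elim: n => // n IHn in U *; rewrite ltnS => leUn U0.
have /set0Pn[z zU] := U0; have cU := cardsD1 z U; rewrite zU in cU.
have [Uz0|Uz0] := eqVneq (U :\ z) set0.
  rewrite cU Uz0 cards0 M0bar_formula1.
  by rewrite -(setD1K zU) Uz0 setU0 nested_poly_set1.
rewrite (nested_polyD1 zU) IHn //; last by lia.
rewrite [in RHS]cU M0bar_formulaS ?card_gt0 //; congr (_ + _ * _).
set m := #|U :\ z| in cU *.
(* The extension by 0 lets the sum range over all the subsets of [U :\ z], grouped by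
   cardinality. *)
pose F k := if (1 < k)%N then M0bar_formula k * M0bar_formula (m.+1 - k) else 0.
transitivity (\sum_(A : {set T} | A \subset U :\ z) F #|A|).
  rewrite [RHS](bigID (fun A : {set T} => (1 < #|A|)%N)) /= [X in _ = _ + X]big1; last first.
    by move=> A /andP[_ /negbTE nA]; rewrite /F nA.
  rewrite addr0; apply: eq_bigr => A /andP[sA A1]; rewrite /F A1.
  have leA := subset_leq_card sA; rewrite -/m in leA.
  have sAU : A \subset U := subset_trans sA (subD1set _ _).
  have cUA : #|U :\: A| = (m.+1 - #|A|)%N by rewrite cardsD (setIidPr sAU) cU.
  rewrite !IHn ?cUA //; try lia; last by rewrite -card_gt0; lia.
  by rewrite -card_gt0 cUA; lia.
rewrite sum_subset_card -/m big_ltn // {1}/F mul0rn add0r.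
have m_gt0 : (0 < m)%N by rewrite card_gt0.
rewrite big_ltn // {1}/F mul0rn add0r big_nat_cond [RHS]big_nat_cond.
by apply: eq_bigr => k /andP[/andP[k1 _] _]; rewrite /F k1.
Qed.

(** * Relations in the ring *)

Section NestedRing.

Variables (T : finType) (A : comNzRingType) (I : A -> Prop) (gx : {set T} -> A).
Hypothesis I0 : I 0.
Hypothesis ID : forall a b, I a -> I b -> I (a + b).
Hypothesis IM : forall a b, I b -> I (a * b).
Hypothesis gx_cross : forall S S', ~~ noncrossing S S' -> I (gx S * gx S').
Hypothesis gx_edge : forall i j : T, i != j ->
  I (\sum_(S : {set T} | [set i; j] \subset S) gx S).

Implicit Types (B S U V v : {set T}) (BB N : {set {set T}}) (f g : {set T} -> nat).

Lemma IMr a b : I a -> I (a * b).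
Proof. by rewrite mulrC; apply: IM. Qed.

Lemma IN a : I a -> I (- a).
Proof. by rewrite -mulN1r; apply: IM. Qed.

Lemma I_sum (J : Type) (r : seq J) (P : pred J) (F : J -> A) :
  (forall j, P j -> I (F j)) -> I (\sum_(j <- r | P j) F j).
Proof. by move=> IF; elim/big_ind: _. Qed.

Definition gy S : A := \sum_(U : {set T} | S \subset U) gx U.

(** Singletons are skipped so that the product makes sense for [blocks], where they stand for
    leaves. *)
Definition xprod BB : A := \prod_(B in BB | (1 < #|B|)%N) gx B.

Definition ymon f : A := \prod_S gy S ^+ f S.

Definition single S : {set T} -> nat := fun S' => nat_of_bool (S' == S).

Lemma gyD1 S : gy S = gx S + \sum_(U : {set T} | S \proper U) gx U.
Proof.
rewrite /gy (bigD1 S) //=; congr (_ + _); apply: eq_bigl => U.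
by rewrite properEneq andbC eq_sym.
Qed.

Lemma eq_ymon f g : f =1 g -> ymon f = ymon g.
Proof. by move=> fg; apply: eq_bigr => S _; rewrite fg. Qed.

Lemma ymonD f g : ymon (fun S => (f S + g S)%N) = ymon f * ymon g.
Proof. by rewrite -big_split /=; apply: eq_bigr => S _; rewrite exprD. Qed.

Lemma ymon_single k S : ymon (fun S' => (k * single S S')%N) = gy S ^+ k.
Proof.
rewrite /ymon (bigD1 S) //= /single eqxx muln1 big1 ?mulr1 // => S' /negbTE->.
by rewrite muln0.
Qed.

Lemma ymon_dvd f g : (forall S, f S <= g S)%N -> exists c, ymon g = c * ymon f.
Proof.
move=> le_fg; exists (ymon (fun S => g S - f S)%N).
by rewrite -ymonD; apply: eq_ymon => S; rewrite subnK.
Qed.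

Lemma xprod_dvd BB N : BB \subset N -> exists c, xprod N = c * xprod BB.
Proof.
move=> /subsetP sBN; exists (\prod_(B in N | (B \notin BB) && (1 < #|B|)%N) gx B).
rewrite /xprod (bigID (fun B => B \in BB)) /= mulrC; congr (_ * _); apply: eq_bigl => B.
  by rewrite -andbA; congr (_ && _); rewrite andbC.
by have [BB_B|] := boolP (B \in BB); rewrite ?andbF // sBN ?andbT.
Qed.

Lemma xprodU1 B BB : (1 < #|B|)%N -> B \notin BB ->
  xprod (B |: BB) = gx B * xprod BB.
Proof. by move=> B1 nB; rewrite /xprod !big_mkcondr /= big_setU1 //= B1. Qed.

Lemma xprod_cross BB B S : B \in BB -> (1 < #|B|)%N -> ~~ noncrossing B S ->
  I (xprod BB * gx S).
Proof.
move=> BB_B B1 BS; have [|c ->] := @xprod_dvd [set B] BB; first by rewrite sub1set.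
have -> : xprod [set B] = gx B.
  by rewrite -[[set B]]setU0 xprodU1 ?inE // /xprod big1 ?mulr1 // => C; rewrite inE.
by rewrite -mulrA; apply/IM/gx_cross.
Qed.

(* For disjoint [BB]: [S] meets at least two of the blocks. *)
Definition spread BB S :=
  [&& (1 < #|S|)%N, S \subset cover BB & [forall B in BB, ~~ (S \subset B)]].

Lemma ymon_split f (P : pred {set T}) :
  ymon f = ymon (fun S => if P S then f S else 0%N) *
           ymon (fun S => if P S then 0%N else f S).
Proof.
by rewrite -ymonD; apply: eq_ymon => S; case: (P S); rewrite ?addn0.
Qed.

(* If [i] and [j] are points of [S1] in different blocks, then
   [y_S1 = y_ij - \sum_U x_U] over the [U] containing [i], [j] but not [S1].
   Such a [U] merges some of the blocks; by pigeonhole, either the blocks inside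
   [U], or [U] together with the other blocks, receive enough factors [y_S]. *)
Lemma vanishing BB f : trivIset BB -> (forall S, 0 < f S -> spread BB S)%N ->
  (0 < \sum_S f S)%N -> (#|BB| <= (\sum_S f S).+1)%N -> I (xprod BB * ymon f).
Proof.
have [n] := ubnP #|BB|; elim: n => // n IHn in BB f *.
rewrite ltnS => leBn triv fP f_gt0 leBf.
have [S1 fS1] : exists S1, (0 < f S1)%N.
  have [S1 h|no] := pickP (fun S => 0 < f S)%N; first by exists S1.
  by move: f_gt0; rewrite big1 // => S _; have := no S; case: (f S).
have /and3P[S1_gt1 S1cov /forall_inP S1B] := fP S1 fS1.
have /set0Pn[i Si] : S1 != set0 by rewrite -card_gt0 ltnW.
have /bigcupP[B1 BB1 B1i] := subsetP S1cov i Si.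
have /subsetPn[j Sj nB1j] := S1B B1 BB1.
have /bigcupP[B2 BB2 B2j] := subsetP S1cov j Sj.
have neq_ij : i != j by apply: contraNneq nB1j => <-.
have neqB : B1 != B2 by apply: contraNneq nB1j => ->.
pose f' S := (f S - single S1 S)%N.
have fE S : f S = (f' S + single S1 S)%N.
  by rewrite /f' /single; case: eqP => [->|_]; rewrite ?subn0 ?addn0 // subnK.
have f'P S : (0 < f' S -> spread BB S)%N.
  by move=> h; apply: fP; rewrite fE; apply: leq_trans h (leq_addr _ _).
have sumf : (\sum_S f S = (\sum_S f' S).+1)%N.
  rewrite (eq_bigr _ (fun S _ => fE S)) big_split /= -addn1; congr (_ + _)%N.
  rewrite (bigD1 S1) //= big1 ?addn0 /single ?eqxx // => S /negbTE->; by [].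
have -> : ymon f = ymon f' * gy S1.
  rewrite (eq_ymon fE) ymonD; congr (_ * _).
  by rewrite -[RHS]expr1 -ymon_single; apply: eq_ymon => S; rewrite mul1n.
have -> : gy S1 = \sum_(S : {set T} | [set i; j] \subset S) gx S
    - \sum_(U : {set T} | ([set i; j] \subset U) && ~~ (S1 \subset U)) gx U.
  rewrite [X in X - _](bigID (fun U : {set T} => S1 \subset U)) /= addrK.
  apply: eq_bigl => U; apply/idP/andP => [sSU|[]//]; split=> //.
  by rewrite subUset !sub1set !(subsetP sSU).
rewrite mulrA mulrBr; apply: ID; first by apply/IM/gx_edge.
apply: IN; rewrite mulr_sumr; apply: I_sum => U /andP[].
rewrite subUset !sub1set => /andP[Ui Uj] nS1U.
(* A block crossing [U] makes the term vanish at once. Otherwise each block is inside [U] or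
   disjoint from it, since a block containing [U] would contain both [i] and [j]. *)
have [B /and3P[BB_B B_gt1 ncB] | noncr] :=
    pickP (fun B => [&& B \in BB, (1 < #|B|)%N & ~~ noncrossing B U]).
  by rewrite mulrAC; apply: IMr; apply: xprod_cross B_gt1 ncB.
have inU B : B \in BB -> ~~ [disjoint B & U] -> B \subset U.
  move=> BB_B /pred0Pn[u /andP[/= Bu Uu]].
  have [B_gt1|B_le1] := ltnP 1 #|B|; last first.
    apply/subsetP=> w Bw; suff -> : w = u by [].
    by apply: (card_le1_eqP B_le1).
  have := noncr B; rewrite /= BB_B B_gt1 /= => /negbFE /or3P[//|sUB|dBU].
    have [Bi Bj] := (subsetP sUB i Ui, subsetP sUB j Uj).
    have e1 : B = B1 by rewrite -(def_pblock triv BB_B Bi) (def_pblock triv BB1 B1i).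
    by rewrite -e1 Bj in nB1j.
  by rewrite (disjointFr dBU Bu) in Uu.
pose BU := [set B in BB | B \subset U].
have sBU : BU \subset BB by apply/subsetP=> B; rewrite inE => /andP[].
have BUout B : B \in BB -> B \notin BU -> [disjoint B & U].
  by move=> BB_B; rewrite inE BB_B; apply: contraNT => /(inU B BB_B).
have BU1 : B1 \in BU.
  by rewrite inE BB1 inU //; apply/pred0Pn; exists i; rewrite /= B1i Ui.
have BU2 : B2 \in BU.
  by rewrite inE BB2 inU //; apply/pred0Pn; exists j; rewrite /= B2j Uj.
have card2 : (2 <= #|BU|)%N.
  have : [set B1; B2] \subset BU by rewrite subUset !sub1set BU1.
  by move/subset_leq_card; rewrite cards2 neqB.
have card_lt : (#|BU| < #|BB|)%N.
  rewrite ltn_neqAle subset_leq_card // andbT; apply: contraNneq nS1U => eqc.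
  have eBU : BU = BB by apply/eqP; rewrite eqEcard sBU eqc leqnn.
  apply: subset_trans S1cov _; apply/bigcupsP=> B; rewrite -eBU inE => /andP[] //.
pose f1 S := if S \subset U then f' S else 0%N.
pose f2 S := if S \subset U then 0%N else f' S.
have sumf' : (\sum_S f' S = \sum_S f1 S + \sum_S f2 S)%N.
  rewrite -big_split /=; apply: eq_bigr => S _.
  by rewrite /f1 /f2; case: ifP; rewrite ?addn0.
rewrite (ymon_split f' (fun S => S \subset U)) -/f1 -/f2.
(* The [b] blocks inside [U] require [b - 1] factors, and [U] with the other blocks requires
   [#|BB| - b]; at least [#|BB| - 2] factors are left, so one of the two counts is reached. *)
have [le1|lt1] := leqP #|BU| (\sum_S f1 S).+1.
  have [c ->] := xprod_dvd sBU.
  have -> : c * xprod BU * (ymon f1 * ymon f2) * gx U =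
            c * ymon f2 * gx U * (xprod BU * ymon f1) by ring.
  apply: IM; apply: (IHn _ _ (leq_trans card_lt leBn) (trivIsetS sBU triv)).
  2: by rewrite -ltnS; apply: leq_trans card2 le1.
  2: exact: le1.
  move=> S; rewrite /f1; case: ifP => // sSU /f'P/and3P[S1' Scov /forall_inP SB].
  rewrite /spread S1' /=; apply/andP; split.
    apply/subsetP=> u Su; have /bigcupP[B BB_B Bu] := subsetP Scov u Su.
    apply/bigcupP; exists B => //; rewrite inE BB_B inU //.
    by apply/pred0Pn; exists u; rewrite /= Bu (subsetP sSU).
  by apply/forall_inP=> B /(subsetP sBU); apply: SB.
pose BB' := U |: (BB :\: BU).
have U_gt1 : (1 < #|U|)%N.
  have : [set i; j] \subset U by rewrite subUset !sub1set Ui.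
  by move/subset_leq_card; rewrite cards2 neq_ij.
have nUB : U \notin BB :\: BU.
  rewrite !inE subxx andbT; case: (U \in BB) => //.
have cBB' : #|BB'| = (#|BB| - #|BU|).+1.
  by rewrite cardsU1 nUB cardsD (setIidPr sBU).
have [c Ec] : exists c, xprod BB = c * xprod (BB :\: BU).
  by apply: xprod_dvd; apply: subsetDl.
have -> : xprod BB * (ymon f1 * ymon f2) * gx U =
          c * ymon f1 * (xprod BB' * ymon f2) by rewrite Ec xprodU1 //; ring.
have [h1 h2 h3] :
    [/\ #|BB'| < n, 0 < \sum_S f2 S & #|BB'| <= (\sum_S f2 S).+1]%N.
  rewrite cBB'; move: card2 card_lt lt1 sumf' leBf leBn; rewrite sumf.
  move: (\sum_S f1 S)%N (\sum_S f2 S)%N (\sum_S f' S)%N #|BU| #|BB|.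
  by clear=> s1 s2 s b B *; split; lia.
apply: IM; apply: (IHn _ _ h1) => //.
  apply/trivIsetP=> B C; rewrite !in_setU1.
  have dis D : D \in BB :\: BU -> [disjoint D & U].
    by rewrite inE => /andP[nBD BD]; apply: BUout.
  case/orP=> [/eqP->|hB] /orP[/eqP->|hC] neBC; first by rewrite eqxx in neBC.
  - by rewrite disjoint_sym dis.
  - exact: dis.
  - move: hB hC => /setDP[hB _] /setDP[hC _].
    exact: (trivIsetP triv).
move=> S; rewrite /f2; case: ifP => // nsSU /f'P/and3P[S1' Scov /forall_inP SB].
rewrite /spread S1' /=; apply/andP; split.
  apply/subsetP=> u Su; have /bigcupP[B BB_B Bu] := subsetP Scov u Su.
  apply/bigcupP; have [BUB|nBUB] := boolP (B \in BU).
    exists U; rewrite ?setU11 //; by move: BUB; rewrite inE => /andP[_ /subsetP/(_ u Bu)].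
  by exists B; rewrite // !inE BB_B; move: nBUB; rewrite inE BB_B => ->; rewrite orbT.
apply/forall_inP=> B; rewrite !inE => /orP[/eqP->|/andP[_ BB_B]]; first by rewrite nsSU.
exact: SB.
Qed.

(** One difference sums [x_U] over the [U] containing [S] but not [S'], the other [x_V] over the [V]
    containing [S'] but not [S]; such [U] and [V] share a point and cross. *)
Lemma gy_cross S S' : ~~ [disjoint S & S'] ->
  I ((gy S - gy (S :|: S')) * (gy S' - gy (S :|: S'))).
Proof.
case/pred0Pn=> u /andP[/= Su S'u].
have yE U V : gy U - gy (U :|: V) =
    \sum_(W : {set T} | (U \subset W) && ~~ (V \subset W)) gx W.
  rewrite /gy (bigID (fun W : {set T} => V \subset W)) /= addrAC.
  rewrite [X in X - _](eq_bigl (fun W : {set T} => U :|: V \subset W)) => [|W].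
    by rewrite subrr add0r.
  by rewrite subUset.
rewrite yE [S :|: S']setUC yE mulr_suml; apply: I_sum => U /andP[sSU nS'U].
rewrite mulr_sumr; apply: I_sum => V /andP[sS'V nSV]; apply: gx_cross.
apply/or3P=> -[sUV|sVU|dUV].
- by rewrite (subset_trans sSU sUV) in nSV.
- by rewrite (subset_trans sS'V sVU) in nS'U.
- by have := disjointFr dUV (subsetP sSU u Su); rewrite (subsetP sS'V).
Qed.

Definition degf f : nat := \sum_S f S.
Definition wtf f : nat := \sum_S f S * #|S|.
Definition faddf f g S : nat := (f S + g S)%N.
Definition supp f : {set {set T}} := [set S | (0 < f S)%N].
Definition supp_gt1 f := forall S, (0 < f S)%N -> (1 < #|S|)%N.

Definition std_exponent f :=
  laminar_on setT (supp f) /\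
  forall S, (0 < f S)%N -> (f S + 2 <= #|blocks (supp f) S|)%N.

Lemma degfD f g : degf (faddf f g) = (degf f + degf g)%N.
Proof. exact: big_split. Qed.

Lemma wtfD f g : wtf (faddf f g) = (wtf f + wtf g)%N.
Proof. by rewrite -big_split; apply: eq_bigr => S _; rewrite /= -mulnDl. Qed.

Lemma degf_single k S : degf (fun S' => k * single S S')%N = k.
Proof.
rewrite /degf (bigD1 S) //= /single eqxx muln1 big1 ?addn0 // => S' /negbTE->.
by rewrite muln0.
Qed.

Lemma wtf_single k S : wtf (fun S' => k * single S S')%N = (k * #|S|)%N.
Proof.
rewrite /wtf (bigD1 S) //= /single eqxx muln1 big1 ?addn0 // => S' /negbTE->.
by rewrite muln0 mul0n.
Qed.

Lemma degf_single1 S : degf (single S) = 1%N.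
Proof. by rewrite -[RHS](degf_single 1 S); apply: eq_bigr => S' _; rewrite mul1n. Qed.

Lemma wtf_single1 S : wtf (single S) = #|S|.
Proof.
by rewrite -[RHS]mul1n -wtf_single; apply: eq_bigr => S' _; rewrite mul1n.
Qed.

Lemma ymon_single1 S : ymon (single S) = gy S.
Proof. by rewrite -[RHS]expr1 -ymon_single; apply: eq_ymon => S'; rewrite mul1n. Qed.

Lemma degf_count (s : seq {set T}) : degf (fun S => count_mem S s) = size s.
Proof.
elim: s => [|C s IHs]; first by rewrite /degf big1.
rewrite /= -[RHS]add1n -IHs -(degf_single1 C) -degfD.
by apply: eq_bigr => S _; rewrite /faddf /single eq_sym.
Qed.

Lemma wtf_count (s : seq {set T}) :
  wtf (fun S => count_mem S s) = (\sum_(S <- s) #|S|)%N.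
Proof.
elim: s => [|C s IHs]; first by rewrite /wtf big_nil big1.
rewrite /= big_cons -IHs -(wtf_single1 C) -wtfD.
by apply: eq_bigr => S _; rewrite /faddf /single eq_sym.
Qed.

Lemma ymonDf f g : ymon (faddf f g) = ymon f * ymon g.
Proof. exact: ymonD. Qed.

Lemma wtf_leq f : (wtf f <= degf f * #|T|)%N.
Proof.
rewrite /degf big_distrl /=; apply: leq_sum => S _.
by rewrite leq_mul2l max_card orbT.
Qed.

Lemma supp_gt1_single S : (1 < #|S|)%N -> supp_gt1 (single S).
Proof. by move=> S1 S'; rewrite /single; case: eqP => // ->. Qed.

Lemma supp_gt1D f g : supp_gt1 f -> supp_gt1 g -> supp_gt1 (faddf f g).
Proof. by move=> hf hg S; rewrite addn_gt0 => /orP[/hf|/hg]. Qed.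

(** * Standard monomials span each degree *)

Section Spanning.

Variables (d : nat) (Sp : A -> Prop).
Hypothesis SpI : forall a, I a -> Sp a.
Hypothesis SpB : forall a b, Sp a -> Sp b -> Sp (a - b).
Hypothesis Sp_std : forall f, std_exponent f -> degf f = d -> Sp (ymon f).

Lemma SpN a : Sp a -> Sp (- a).
Proof. by rewrite -sub0r; apply: SpB; apply: SpI. Qed.

Lemma SpD a b : Sp a -> Sp b -> Sp (a + b).
Proof. by move=> ha /SpN; rewrite -[b in a + b]opprK; apply: SpB. Qed.

Lemma Sp_sum (J : Type) (r : seq J) (P : pred J) (F : J -> A) :
  (forall j, P j -> Sp (F j)) -> Sp (\sum_(j <- r | P j) F j).
Proof.
by move=> SpF; elim/big_ind: _ => //; [exact: SpI | exact: SpD].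
Qed.

(* [gx C] is [gy C] up to a sum of [gy V] with [V] larger than [C], and
   monomials of larger weight are already spanned. *)
Lemma Sp_replace k :
  (forall h, supp_gt1 h -> degf h = d -> (k < wtf h)%N -> Sp (ymon h)) ->
  forall (s : seq {set T}) g, supp_gt1 g -> all (fun S => 1 < #|S|)%N s ->
  (degf g + size s)%N = d -> (k <= wtf g + \sum_(S <- s) #|S|)%N ->
  Sp (\prod_(S <- s) gx S * ymon g
      - ymon (faddf g (fun S => count_mem S s))).
Proof.
move=> Spk; elim=> [|C s IHs] g g1.
  move=> _ _ _; rewrite big_nil mul1r [X in _ - X](@eq_ymon _ g) => [|S].
    by rewrite subrr; apply: SpI.
  by rewrite /faddf /= addn0.
(* Removing [x_C] creates variables [x_V] with [V] larger than [C], handled by a second induction on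
   [#|T| - #|C|]. *)
move=> /= /andP[C1 s1]; have [m] := ubnP (#|T| - #|C|).
elim: m => // m IHm in C C1 *; rewrite ltnS => leCm Ed lek.
rewrite !big_cons in lek *.
pose gC := faddf g (single C).
have EgC : ymon gC = gy C * ymon g by rewrite ymonDf ymon_single1 mulrC.
have gC1 : supp_gt1 gC by apply: supp_gt1D => //; apply: supp_gt1_single.
have -> : ymon (faddf g (fun S => ((C == S) + count_mem S s)%N)) =
          ymon (faddf gC (fun S => count_mem S s)).
  by apply: eq_ymon => S; rewrite /faddf /gC /faddf /single eq_sym addnA.
have -> : gx C * \prod_(S <- s) gx S * ymon g -
    ymon (faddf gC (fun S => count_mem S s)) =
    (\prod_(S <- s) gx S * ymon gC - ymon (faddf gC (fun S => count_mem S s)))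
    - \sum_(V : {set T} | C \proper V) gx V * \prod_(S <- s) gx S * ymon g.
  rewrite EgC gyD1 -!mulr_suml; ring.
apply: SpB.
  apply: IHs => //; first by rewrite degfD degf_single1 -Ed; lia.
  by rewrite wtfD wtf_single1; apply: leq_trans lek _; lia.
apply: Sp_sum => V pCV; have ltCV := proper_card pCV.
have V1 : (1 < #|V|)%N by apply: ltn_trans C1 ltCV.
pose gV := faddf (faddf g (single V)) (fun S => count_mem S s).
rewrite -[X in Sp X](subrK (ymon gV)); apply: SpD.
  have := IHm V V1; rewrite !big_cons.
  have -> : ymon (faddf g (fun S => ((V == S) + count_mem S s)%N)) = ymon gV.
    by apply: eq_ymon => S; rewrite /gV /faddf /single eq_sym addnA.
  apply=> //; last by apply: leq_trans lek _; move: ltCV; clear; lia.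
  have leVT : (#|V| <= #|T|)%N by apply: max_card.
  by move: leVT leCm ltCV; clear; lia.
apply: Spk.
- apply: supp_gt1D; first by apply: supp_gt1D => //; apply: supp_gt1_single.
  move=> S; rewrite -has_count has_pred1 => Ss; exact: (allP s1).
- by rewrite !degfD degf_single1 degf_count -Ed /=; lia.
- by rewrite !wtfD wtf_single1 wtf_count; apply: leq_ltn_trans lek _; lia.
Qed.

(** Induction from heavy to light monomials. If the support is laminar and the exponent at [S] too
    large, turning [y_B] into [x_B] for the children [B] of [S] costs only heavier monomials and
    gives an element of the ideal. *)
Lemma Sp_ymon f : supp_gt1 f -> degf f = d -> Sp (ymon f).
Proof.
have [m] := ubnP (d * #|T| - wtf f); elim: m => // m IHm in f *.
rewrite ltnS => lem f1 fd.
have IHw h : supp_gt1 h -> degf h = d -> (wtf f < wtf h)%N -> Sp (ymon h).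
  move=> h1 hd lt_w; apply: IHm => //.
  have := wtf_leq h; rewrite hd; move: lem lt_w; clear; lia.
pose N := supp f.
have NE S : (S \in N) = (0 < f S)%N by rewrite inE.
have [lamN|] := boolP (laminar N); last first.
  rewrite negb_forall => /existsP[S]; rewrite negb_imply NE => /andP[fS].
  rewrite negb_forall => /existsP[S']; rewrite negb_imply NE => /andP[fS' ncr].
  have neSS' : S != S' by apply: contraNneq ncr => ->; rewrite /noncrossing subxx.
  pose g V := (f V - single S V - single S' V)%N.
  have fE : ymon f = ymon g * gy S * gy S'.
    rewrite -(ymon_single1 S) -(ymon_single1 S') -!ymonDf; apply: eq_ymon => V.
    rewrite /faddf /g /single; case: eqP => [->|_]; first by rewrite (negbTE neSS'); lia.
    by case: eqP => [->|_]; lia.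
  have gD : forall U V, degf (faddf (faddf g (single U)) (single V)) = d.
    move=> U V; rewrite !degfD !degf_single1 -fd.
    have -> : degf f = degf (faddf (faddf g (single S)) (single S')).
      apply: eq_bigr => W _; rewrite /faddf /g /single.
      case: eqP => [->|_]; first by rewrite (negbTE neSS'); lia.
      by case: eqP => [->|_]; lia.
    by rewrite !degfD !degf_single1.
  have gW : wtf f = (wtf g + #|S| + #|S'|)%N.
    have -> : wtf f = wtf (faddf (faddf g (single S)) (single S')).
      apply: eq_bigr => W _; congr (_ * _)%N; rewrite /faddf /g /single.
      case: eqP => [->|_]; first by rewrite (negbTE neSS'); lia.
      by case: eqP => [->|_]; lia.
    by rewrite !wtfD !wtf_single1.
  have g1 : supp_gt1 g.
    by move=> V gV; apply: f1; move: gV; rewrite /g; clear; lia.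
  pose W := S :|: S'.
  move: ncr; rewrite /noncrossing !negb_or => /and3P[nSS' nS'S ndSS'].
  have ltSW : (#|S| < #|W|)%N.
    by apply: proper_card; rewrite properE subsetUl /= subUset subxx.
  have ltS'W : (#|S'| < #|W|)%N.
    by apply: proper_card; rewrite properE subsetUr /= subUset subxx andbT.
  have [S1 S'1] := (f1 S fS, f1 S' fS').
  have W1 : (1 < #|W|)%N by apply: ltn_trans S1 ltSW.
  have Sp2 U V : (1 < #|U|)%N -> (1 < #|V|)%N -> (#|S| + #|S'| < #|U| + #|V|)%N ->
      Sp (ymon g * gy U * gy V).
    move=> U1 V1 lt; rewrite -(ymon_single1 U) -(ymon_single1 V) -!ymonDf.
    apply: IHw => //; last by rewrite !wtfD !wtf_single1 gW -!addnA ltn_add2l.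
    by do 2![apply: supp_gt1D; last exact: supp_gt1_single].
  (* This expands [gy_cross]; the three other products are heavier because [W] is larger than both
     [S] and [S']. *)
  have -> : ymon f = ymon g * ((gy S - gy W) * (gy S' - gy W)) +
      ymon g * gy S * gy W + ymon g * gy W * gy S' - ymon g * gy W * gy W.
    by rewrite fE; ring.
  apply: SpB; last by apply: Sp2 => //; lia.
  apply: SpD; last by apply: Sp2 => //; lia.
  apply: SpD; last by apply: Sp2 => //; lia.
  by apply: SpI; apply: IM; apply: gy_cross.
have lamT : laminar_on setT N.
  by apply/laminar_onP; split=> // S; rewrite NE subsetT => /f1.
have [S /andP[fS ltS] | isstd] :=
    pickP (fun S => (0 < f S) && (#|blocks N S| < f S + 2))%N; last first.
  apply: Sp_std => //; split=> // S fS.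
  by have := isstd S; rewrite /= fS /= ltnNge => /negbFE.
have S1 := f1 S fS; set BB := blocks N S in ltS.
have BB_gt1 : (1 < #|BB|)%N by apply: card_blocks_gt1.
(* This is the power of [y_S] killed by the children of [S], and the exponent of [S] in [f] is at
   least [c]. *)
pose c := #|BB|.-1.
have BBN B : B \in BB -> (1 < #|B|)%N -> (0 < f B)%N /\ B != S.
  move=> BB_B B1; have [NB pB] := blocks_mem lamN BB_B B1.
  by rewrite -NE; split=> //; apply: contraTneq pB => ->; rewrite properxx.
have vanS : I (xprod BB * gy S ^+ c).
  rewrite -ymon_single; apply: vanishing.
  - exact: blocks_trivIset.
  - move=> V; rewrite /single; case: eqP => [->|_]; last by rewrite muln0.
    move=> _; rewrite /spread S1 blocks_cover // subxx /=.
    apply/forall_inP=> B BB_B.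
    by have := proper_subn (blocks_proper lamN S1 BB_B).
  - by rewrite -/(degf _) degf_single /c -ltnS prednK // ltnW.
  - by rewrite -/(degf _) degf_single /c prednK // ltnW.
pose s := enum [set B in BB | (1 < #|B|)%N].
have sE V : count_mem V s = ((V \in BB) && (1 < #|V|))%N :> nat.
  by rewrite count_uniq_mem ?enum_uniq // mem_enum inE.
pose g V := (f V - count_mem V s)%N.
have fE : f =1 faddf g (fun V => count_mem V s).
  move=> V; rewrite /faddf /g subnK // sE.
  by case: andP => // -[hV V1]; have [] := BBN V hV V1.
have := @Sp_replace (wtf f) IHw s g.
rewrite -(eq_ymon fE) => Hs.
rewrite -[ymon f](subKr (\prod_(V <- s) gx V * ymon g)); apply: SpB.
  apply: SpI; have -> : \prod_(V <- s) gx V = xprod BB.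
    by rewrite /xprod /s big_enum /=; apply: eq_bigl => B; rewrite inE.
  have [|e ->] := @ymon_dvd (fun V => c * single S V)%N g.
    move=> V; rewrite /single /g; case: eqP => [->|_]; last by rewrite muln0.
    rewrite sE; case: andP => [[hV V1]|_].
      by have [_] := BBN S hV V1; rewrite eqxx.
    by move: ltS; rewrite /c muln1 subn0; clear; lia.
  by rewrite ymon_single mulrCA; apply: IM.
apply: Hs.
- by move=> V gV; apply: f1; move: gV; rewrite /g; clear; lia.
- by apply/allP=> V; rewrite mem_enum inE => /andP[].
- by rewrite -degf_count -degfD -fd; apply: eq_bigr => V _; rewrite fE.
- by rewrite -wtf_count -wtfD leq_eqVlt; apply/orP; left; apply/eqP; apply: eq_bigr => V _;
     rewrite fE.
Qed.

End Spanning.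

Lemma xprod_nontrivial BB : xprod BB = xprod [set B in BB | (1 < #|B|)%N].
Proof. by apply: eq_bigl => B; rewrite inE -andbA andbb. Qed.

Lemma xprod_sub_dvd BB N :
  (forall B, B \in BB -> (1 < #|B|)%N -> B \in N) ->
  exists c, xprod N = c * xprod BB.
Proof.
move=> sBN; rewrite (xprod_nontrivial BB); apply: xprod_dvd.
by apply/subsetP=> B; rewrite inE => /andP[]; apply: sBN.
Qed.

Lemma gyT : gy setT = gx setT.
Proof. by rewrite /gy (big_pred1 setT) // => U; rewrite /= subTset. Qed.

(** * Dual monomials and the triangular pairing *)

Section Duality.

Hypothesis T_gt1 : (1 < #|T|)%N.

Let cardT_gt1 : (1 < #|[set: T]|)%N.
Proof. by rewrite cardsT. Qed.

Definition defect N f v : nat :=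
  if v \in setT |: N then (#|blocks N v| - 2 - f v)%N else 0%N.

(** No factor [x] for the whole set: in a tree with [#|T|] leaves, the other nodes already bring the
    degree of the product with [ymon f] to [#|T| - 2]. *)
Definition dual_mon f : A := xprod (supp f :\ setT) * ymon (defect (supp f) f).

Definition node N S : {set T} :=
  [arg min_(v < setT | (v \in setT |: N) && (S \subset v)) #|v|].

Lemma nodeP N S : [/\ node N S \in setT |: N, S \subset node N S
  & forall v, v \in setT |: N -> S \subset v -> (#|node N S| <= #|v|)%N].
Proof.
rewrite /node; case: arg_minnP => [|v /andP[Nv sSv] vmin].
  by rewrite setU11 subsetT.
by split=> // w Nw sSw; apply: vmin; rewrite Nw.
Qed.

Lemma blocks_setTD N v : blocks (N :\ setT) v = blocks N v.
Proof.
apply: eq_blocks => B pB; rewrite !inE; case: eqP => // BT.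
by move: pB; rewrite BT properE subsetT andbF.
Qed.

(** This is [vanishing] for the children of [v], whose variables all occur in the product; a set
    inside [v] but in no smaller member is spread over them. *)
Lemma vanishing_node N v f : laminar N -> (1 < #|v|)%N ->
  (forall S, 0 < f S -> [/\ 1 < #|S|, S \subset v
      & forall B, B \in N -> B \proper v -> ~~ (S \subset B)])%N ->
  (#|blocks N v| <= (degf f).+1)%N -> I (xprod (N :\ setT) * ymon f).
Proof.
move=> lamN v1 fP lef.
have [|c ->] := @xprod_sub_dvd (blocks N v) (N :\ setT).
  move=> B vB B1; have [NB pB] := blocks_mem lamN vB B1.
  rewrite !inE NB andbT; apply: contraTneq pB => ->.
  by rewrite properE subsetT andbF.
have b1 := card_blocks_gt1 lamN v1.
rewrite -mulrA; apply: IM; apply: vanishing => //.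
- exact: blocks_trivIset.
- move=> S /fP[S1 sSv Sn]; rewrite /spread S1 blocks_cover // sSv /=.
  apply/forall_inP=> B vB; apply/negP=> sSB.
  have B1 : (1 < #|B|)%N by apply: leq_trans S1 (subset_leq_card sSB).
  by have [NB pB] := blocks_mem lamN vB B1; have := Sn B NB pB; rewrite sSB.
- by rewrite -/(degf f); move: lef b1; case: (degf f) => // le1 /leq_trans/(_ le1).
Qed.

Lemma std_defect f v : std_exponent f -> v \in setT |: supp f ->
  (f v + 2 <= #|blocks (supp f) v|)%N.
Proof.
case=> /laminar_onP[lamN _] fle; rewrite !inE => /orP[/eqP->|]; last exact: fle.
have [fT|/fle//] := posnP (f setT).
by rewrite fT card_blocks_gt1.
Qed.

(* Each [S] in the support of [g] is charged to the smallest node of [f]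
   containing it: an overcharged node gives a vanishing product, and otherwise
   the sets of [g] are no larger than the nodes they are charged to. *)
Lemma dual_triangular f g : std_exponent f -> supp_gt1 g -> degf g = degf f ->
  [\/ I (ymon g * dual_mon f), (wtf g < wtf f)%N | g =1 f].
Proof.
move=> stdf g1 gd; pose N := supp f; pose nd := node N.
have [/laminar_onP[lamN N1] fle] := stdf.
have Np v : v \in setT |: N -> (1 < #|v|)%N.
  by rewrite in_setU1 => /orP[/eqP->|/N1[]].
pose load v := (\sum_(S | nd S == v) g S)%N.
have [v /andP[Nv ltv] | small] := pickP (fun v => (v \in setT |: N) && (f v < load v)%N).
  (* As [load v] exceeds [f v], the factors charged to [v] and the defect at [v] are together at
     least one fewer than the children of [v], as required by [vanishing_node]. *)
  apply: Or31; pose h S := ((if nd S == v then g S else 0) +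
     (#|blocks N v| - 2 - f v) * single v S)%N.
  have cle := std_defect stdf Nv.
  have hd : degf h = (load v + (#|blocks N v| - 2 - f v))%N.
    rewrite -[in RHS](degf_single (#|blocks N v| - 2 - f v) v) /load big_mkcond.
    exact: big_split.
  have [|c Ec] := @ymon_dvd h (faddf g (defect N f)).
    move=> S; rewrite /h /faddf; apply: leq_add; first by case: ifP.
    rewrite /single; case: eqP => [->|_]; last by rewrite muln0.
    by rewrite /defect Nv muln1.
  have -> : ymon g * dual_mon f = c * (xprod (N :\ setT) * ymon h).
    by rewrite [RHS]mulrCA -Ec ymonDf /dual_mon mulrCA.
  apply: IM; apply: (@vanishing_node N v h) => //; first exact: Np.
    move=> S; rewrite addn_gt0 => /orP[|].
      case: eqP => // ndS gS; have [_ sS minS] := nodeP N S.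
      split; [exact: g1|by rewrite -ndS|] => B NB pB; apply/negP=> sSB.
      have := minS B; rewrite in_setU1 NB orbT => /(_ isT sSB).
      by rewrite -/(nd S) ndS leqNgt proper_card.
    rewrite /single; case: eqP => [->|_]; last by rewrite muln0.
    move=> _; split=> //; first exact: Np.
    by move=> B _ /proper_subn.
  rewrite hd; move: ltv cle; rewrite -/N.
  by move: (load v) (f v) #|blocks N v| => a b c'; clear; lia.
have outN v : v \notin setT |: N -> f v = 0%N.
  by rewrite !inE negb_or -leqNgt leqn0 => /andP[_ /eqP].
have le_load v : v \in setT |: N -> (load v <= f v)%N.
  by move=> Nv; have := small v; rewrite /= Nv /= => /negbT; rewrite -leqNgt.
have sumload (F : {set T} -> nat) : (\sum_S g S * F (nd S) =
    \sum_(v in setT |: N) load v * F v)%N.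
  rewrite (partition_big nd (fun v => v \in setT |: N)) => [|S _] /=.
    apply: eq_bigr => v _; rewrite big_distrl /=.
    by apply: eq_bigr => S /eqP->.
  by have [] := nodeP N S.
have sumf (F : {set T} -> nat) :
    (\sum_S f S * F S = \sum_(v in setT |: N) f v * F v)%N.
  rewrite (bigID (fun v => v \in setT |: N)) /= [X in (_ + X)%N]big1 ?addn0 //.
  by move=> v /outN->.
(* No node is overcharged and the total degrees agree, so all these inequalities are equalities. *)
have load_eq : {in setT |: N, forall v, load v = f v}.
  have := sumload (fun=> 1%N); have := sumf (fun=> 1%N).
  rewrite (eq_bigr f) => [|S _]; last by rewrite muln1.
  rewrite [in X in _ -> X -> _](eq_bigr g) => [|S _]; last by rewrite muln1.
  rewrite -/(degf f) -/(degf g) gd => -> esum.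
  have := leqif_sum (fun v (Nv : v \in setT |: N) => leqif_eq (le_load v Nv)).
  move/leqifP; rewrite (eq_bigr (fun v => load v * 1)%N) => [|v _]; last by rewrite muln1.
  rewrite -esum [X in (X < _)%N](eq_bigr f) => [|v _]; last by rewrite muln1.
  case: ifP => [/forall_inP h _ v Nv|_]; first by apply/eqP/h.
  by rewrite ltnn.
have wtg : wtf f = (\sum_S g S * #|nd S|)%N.
  rewrite (sumload (fun v => #|v|)) /wtf (sumf (fun v => #|v|)).
  by apply: eq_bigr => v Nv; rewrite load_eq.
have le_nd S : (g S * #|S| <= g S * #|nd S| ?= iff ((g S == 0) || (S == nd S)))%N.
  have [_ sS _] := nodeP N S; split; first by rewrite leq_mul2l subset_leq_card ?orbT.
  rewrite eqn_mul2l; congr (_ || _); apply/eqP/eqP => [eS|<-//].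
  by apply/eqP; rewrite eqEcard sS eS leqnn.
have := leqif_sum (fun S (_ : true) => le_nd S); move/leqifP; rewrite -wtg.
case: ifP => [/forallP allS _|_ lt]; last by apply: Or32.
apply: Or33 => v.
have gnd S : (0 < g S)%N -> nd S = S.
  by move=> gS; have := allS S; case: eqP gS => [->|_ _ /eqP].
have [Nv|nNv] := boolP (v \in setT |: N); last first.
  rewrite outN //; apply/eqP; rewrite -leqn0 leqNgt; apply: contra nNv => gv.
  by rewrite -(gnd v gv); have [] := nodeP N v.
rewrite -(load_eq v Nv) /load (bigD1 v) /=; last first.
  have [_ sv minv] := nodeP N v; rewrite eq_sym eqEcard sv /=; exact: minv.
rewrite big1 ?addn0 // => S /andP[/eqP ndS neS].
by apply/eqP; rewrite -leqn0 leqNgt; apply: contraNN neS => /gnd; rewrite ndS => ->.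
Qed.

Definition node_count N v : nat :=
  if v \in setT |: N then (#|blocks N v| - 2)%N else 0%N.

(** The product of a standard monomial and its dual: it depends only on the set [N] of nodes other
    than the whole set. *)
Definition diag_mon N : A := xprod N * ymon (node_count N).

Lemma card_blocks0 : #|blocks set0 [set: T]| = #|T|.
Proof.
rewrite /blocks (eq_imset (g := set1)) => [|x]; last first.
  by apply/setP=> y; rewrite inE; apply/blkP/eqP => [[//|[B []]]|->];
     [rewrite inE | left].
by rewrite card_imset ?cardsT //; apply: set1_inj.
Qed.

(** * Deleting a largest node from a forest *)

Section RemoveMaximal.

Variables (N : {set {set T}}) (S : {set T}).
Hypotheses (lamN : laminar N) (NS : S \in N).
Hypothesis N_gt1 : {in N, forall B, (1 < #|B|)%N}.
Hypothesis N_proper : setT \notin N.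
Hypothesis S_max : {in N, forall B, (#|B| <= #|S|)%N}.

Let N' := N :\ S.
Let BB := blocks N [set: T].

Let S_gt1 : (1 < #|S|)%N. Proof. exact: N_gt1. Qed.

Let S_proper : S \proper [set: T].
Proof. by rewrite properT; apply: contraNneq N_proper => <-. Qed.

Lemma sub_maximal B : B \in N -> S \subset B -> B = S.
Proof. by move=> NB sSB; apply/esym/eqP; rewrite eqEcard sSB S_max. Qed.

Lemma blk_maximal x : x \in S -> blk N setT x = S.
Proof.
move=> Sx; have sS : S \subset blk N setT x by apply: sub_blk.
have [e|[NB _]] := blk_cases setT x lamN; last exact: sub_maximal.
have := subset_leq_card sS; rewrite e cards1 => le1.
by move: (leq_trans S_gt1 le1).
Qed.

Lemma maximal_block : S \in BB.
Proof.
have /set0Pn[x Sx] : S != set0 by rewrite -card_gt0 ltnW.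
by apply/imsetP; exists x; rewrite ?inE // blk_maximal.
Qed.

Lemma blocks_remove v : (#|v| <= #|S|)%N -> blocks N' v = blocks N v.
Proof.
move=> le_vS; apply: eq_blocks => B pB; rewrite !inE; case: eqP => // BS.
by move: (proper_card pB); rewrite BS ltnNge le_vS.
Qed.

Lemma card_blocks_remove :
  (#|blocks N' [set: T]|).+1 = (#|BB| + #|blocks N S|)%N.
Proof.
have e1 x : x \in S -> blk N' setT x = blk N S x.
  move=> Sx; congr (_ |: _); apply: eq_bigl => B; rewrite !inE.
  apply/andP/andP => [[/andP[nBS NB] /andP[_ xB]]|[NB /andP[pB xB]]].
    rewrite NB xB andbT properEneq nBS /=; split=> //.
    case/orP: (laminar_mem_cmp lamN NB NS xB Sx) => // /(sub_maximal NB) BS.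
    by rewrite BS eqxx in nBS.
  rewrite NB xB andbT (sub_proper_trans _ S_proper) ?proper_sub // andbT.
  by split=> //; apply: contraTneq pB => ->; rewrite properxx.
have e2 x : x \in ~: S -> blk N' setT x = blk N setT x.
  rewrite inE => nSx; congr (_ |: _); apply: eq_bigl => B; rewrite !inE.
  by case: eqP => // ->; rewrite (negbTE nSx) !andbF.
have eT : [set: T] = S :|: ~: S by rewrite setUCr.
pose Q := [set blk N setT x | x in ~: S].
have EBB : BB = S |: Q.
  rewrite /BB /blocks {2}eT imsetU; congr (_ :|: _).
  apply/setP=> B; rewrite inE; apply/imsetP/eqP => [[x Sx ->]|->].
    exact: blk_maximal.
  have /set0Pn[x Sx] : S != set0 by rewrite -card_gt0 ltnW.
  by exists x; rewrite ?blk_maximal.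
have EB' : blocks N' [set: T] = blocks N S :|: Q.
  by rewrite {1}/blocks {2}eT imsetU (eq_in_imset e1) (eq_in_imset e2).
have nSQ : S \notin Q.
  apply/imsetP=> -[x]; rewrite inE => nSx eS.
  by have := mem_blk N setT x; rewrite -eS (negbTE nSx).
have dis : blocks N S :&: Q = set0.
  apply/setP=> B; rewrite !inE; apply/negP=> /andP[/imsetP[x Sx ->] /imsetP[y]].
  rewrite inE => nSy e; have := subsetP (blk_sub N Sx) y.
  by rewrite e mem_blk (negbTE nSy) => /(_ isT).
by rewrite EB' EBB cardsU dis cards0 subn0 cardsU1 nSQ add1n addnC.
Qed.

(** The blocks of [BB] inside [V] are merged into [V]. There are at least two of them, or just [S]
    when [V] is [S], which explains the bound; [S] is always one of them, so its variable may be
    absent. *)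
Lemma vanishing_above (V : {set T}) e : S \subset V -> V != setT ->
  (#|BB| <= e + 2 - (V == S))%N -> I (xprod N' * gx V * gy setT ^+ e).
Proof.
move=> sSV VT leBe.
have [B /and4P[BB_B nBS B_gt1 ncr] | noncr] :=
    pickP (fun B => [&& B \in BB, B != S, (1 < #|B|)%N & ~~ noncrossing B V]).
  apply: IMr; apply: (xprod_cross _ B_gt1 ncr).
  by have [NB _] := blocks_mem lamN BB_B B_gt1; rewrite !inE nBS.
pose BV := [set B in BB | B \subset V].
have sBV : BV \subset BB by apply/subsetP=> B; rewrite inE => /andP[].
have triv := blocks_trivIset setT lamN; have cov := blocks_cover setT lamN.
have SBV : S \in BV by rewrite inE maximal_block.
have inV B : B \in BB -> ~~ [disjoint B & V] -> B \subset V.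
  move=> BB_B /pred0Pn[u /andP[/= Bu Vu]].
  have [->//|nBS] := eqVneq B S.
  have [B_gt1|B_le1] := ltnP 1 #|B|; last first.
    apply/subsetP=> w Bw; suff -> : w = u by [].
    by apply: (card_le1_eqP B_le1).
  have := noncr B; rewrite /= BB_B B_gt1 nBS /= => /negbFE /or3P[//|sVB|dBV].
    have := trivIsetP triv B S BB_B maximal_block nBS.
    move/disjointFl => /(_ _ _); have /set0Pn[x Sx] : S != set0 by rewrite -card_gt0 ltnW.
    by move/(_ x Sx); rewrite (subsetP sVB) ?(subsetP sSV).
  by rewrite (disjointFr dBV Bu) in Vu.
pose BB' := V |: (BB :\: BV).
have V_gt1 : (1 < #|V|)%N by apply: leq_trans S_gt1 (subset_leq_card sSV).
have nVB : V \notin BB :\: BV by rewrite !inE subxx andbT; case: (V \in BB).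
have cBB' : #|BB'| = (#|BB| - #|BV|).+1.
  by rewrite cardsU1 nVB cardsD (setIidPr sBV).
have BVlt : (#|BV| < #|BB|)%N.
  rewrite ltn_neqAle subset_leq_card // andbT; apply: contraNneq VT => eqc.
  have eBV : BV = BB by apply/eqP; rewrite eqEcard sBV eqc leqnn.
  rewrite -subTset -cov; apply/bigcupsP=> B; rewrite -/BB -eBV inE => /andP[] //.
have BVge : (2 <= #|BV| + (V == S))%N.
  have [_|nVS] := eqVneq V S; first by rewrite addn1 ltnS card_gt0; apply/set0Pn; exists S.
  have /properP[_ [x Vx nSx]] : S \proper V by rewrite properEneq eq_sym nVS.
  have xBV : blk N setT x \in BV.
    rewrite inE imset_f ?inE //= inV ?imset_f ?inE //.
    by apply/pred0Pn; exists x; rewrite /= mem_blk Vx.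
  have : [set S; blk N setT x] \subset BV by rewrite subUset !sub1set SBV.
  move/subset_leq_card; rewrite cards2 addn0; case: eqP => // eS.
  by have := mem_blk N setT x; rewrite -eS (negbTE nSx).
have [|c ->] := @xprod_sub_dvd (BB :\: BV) N'.
  move=> B; rewrite !inE => /andP[nBV BB_B] B_gt1.
  have [-> _] := blocks_mem lamN BB_B B_gt1; rewrite andbT.
  by apply: contraNneq nBV => ->; rewrite maximal_block sSV.
have -> : c * xprod (BB :\: BV) * gx V * gy setT ^+ e =
          c * (xprod BB' * ymon (fun U => (e * single setT U)%N)).
  by rewrite xprodU1 // ymon_single; ring.
apply: IM; apply: vanishing.
- apply/trivIsetP=> B C; rewrite !in_setU1.
  have dis D : D \in BB :\: BV -> [disjoint D & V].
    rewrite inE => /andP[nBD BD]; apply: contraNT nBD => /(inV D BD).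
    by rewrite inE BD.
  case/orP=> [/eqP->|hB] /orP[/eqP->|hC] neBC; first by rewrite eqxx in neBC.
  + by rewrite disjoint_sym dis.
  + exact: dis.
  + move: hB hC => /setDP[hB _] /setDP[hC _].
    exact: (trivIsetP triv).
- move=> U; rewrite /single; case: eqP => [->|_]; last by rewrite muln0.
  move=> _; rewrite /spread cardT_gt1 /=; apply/andP; split.
    apply/subsetP=> u _.
    have /bigcupP[B BB_B Bu] : u \in cover BB by rewrite cov inE.
    apply/bigcupP; have [BVB|nBVB] := boolP (B \in BV).
      by exists V; rewrite ?setU11 //; move: BVB; rewrite inE => /andP[_ /subsetP/(_ u Bu)].
    by exists B; rewrite // !inE BB_B; move: nBVB; rewrite inE BB_B => ->; rewrite orbT.
  apply/forall_inP=> B; rewrite in_setU1 subTset => /orP[/eqP->|] //.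
  case/setDP=> BB_B _; have := blocks_proper lamN cardT_gt1 BB_B.
  by rewrite properT.
- rewrite -/(degf _) degf_single; move: BVlt BVge leBe.
  by move: #|BV| #|BB| (V == S) => b B w; clear; case: w; lia.
rewrite -/(degf _) degf_single cBB'; move: BVlt BVge leBe.
by move: #|BV| #|BB| (V == S) => b B w; clear; case: w; lia.
Qed.

(** Deleting a set of largest size changes the children of the root only, from [r] to [r + s - 1].
    With [y = gx S + t + R], the sum is a combination of [K * y ^+ (s - 1)], [K * R * t ^+ (r - 2)]
    and [K * (gx S + R) * t ^+ (r - 1)], all in the ideal. *)
Lemma diag_mon_remove : I (diag_mon N + diag_mon N').
Proof.
pose K := xprod N' * ymon (fun v => if v \in N' then node_count N v else 0%N).
set s := #|blocks N S|; set r := #|BB|.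
have s_gt1 : (1 < s)%N by apply: card_blocks_gt1.
have r_gt1 : (1 < r)%N by apply: card_blocks_gt1.
have NT : setT \notin N' by rewrite !inE (negbTE N_proper) andbF.
have ST : S != setT by apply: contraNneq N_proper => <-.
have nSN' : S \notin N' by rewrite !inE eqxx.
have EN : diag_mon N = K * gx S * gy S ^+ (s - 2) * gy setT ^+ (r - 2).
  rewrite /diag_mon -{1}(setD1K NS) -/N' xprodU1 // /K.
  have -> : ymon (node_count N) =
      ymon (fun v => if v \in N' then node_count N v else 0%N) *
      gy S ^+ (s - 2) * gy setT ^+ (r - 2).
    rewrite -2!ymon_single -!ymonDf; apply: eq_ymon => v; rewrite /faddf /single.
    have [->|nvT] := eqVneq v setT.
      rewrite (negbTE NT) eq_sym (negbTE ST) muln0 muln1 !add0n.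
      by rewrite /node_count setU11.
    have [->|nvS] := eqVneq v S.
      by rewrite (negbTE nSN') muln0 muln1 addn0 add0n /node_count !inE NS orbT.
    by rewrite !muln0 !addn0 /node_count !inE (negbTE nvT) nvS; case: (v \in N).
  by move: (gy S ^+ _) (gy setT ^+ _) (ymon _) => p q u; ring.
have EN' : diag_mon N' = K * gy setT ^+ (r + s - 3).
  rewrite /diag_mon /K -mulrA; congr (_ * _).
  rewrite -ymon_single -ymonDf; apply: eq_ymon => v; rewrite /faddf /single.
  have [->|nvT] := eqVneq v setT.
    rewrite (negbTE NT) muln1 add0n /node_count setU11.
    by move: card_blocks_remove; rewrite -/r -/s; clear; lia.
  rewrite muln0 addn0 /node_count !in_setU1 (negbTE nvT) /=.
  have [vN'|//] := boolP (v \in N').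
  have vN : v \in N by move: vN'; rewrite inE => /andP[].
  by rewrite vN blocks_remove // S_max.
pose t := gy setT; pose y := gy S.
pose R := \sum_(V : {set T} | (S \proper V) && (V != setT)) gx V.
have yE : y = gx S + t + R.
  by rewrite /y gyD1 (bigD1 setT) //= -gyT addrA.
have Ia : I (K * y ^+ (s - 1)).
  have Ey : y ^+ (s - 1) = ymon (fun V => ((s - 1) * single S V)%N) by rewrite ymon_single.
  have : I (xprod (N' :\ setT) * y ^+ (s - 1)).
    rewrite Ey; apply: (@vanishing_node N' S).
    - by apply: laminarS lamN; apply: subsetDl.
    - exact: S_gt1.
    - move=> V; rewrite /single; case: eqP => [->|_]; last by rewrite muln0.
      by move=> _; split=> // B _ /proper_subn.
    - by rewrite degf_single blocks_remove // -/s; move: s_gt1; clear; lia.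
  have -> : N' :\ setT = N' by apply/setDidPl; rewrite disjoint_sym disjoints1.
  by move=> h; rewrite /K mulrAC; apply: IMr.
have Ib (V : {set T}) e : S \subset V -> V != setT -> (r <= e + 2 - (V == S))%N ->
    I (K * gx V * t ^+ e).
  move=> h1 h2 h3; have := vanishing_above h1 h2 h3.
  move/(IM (ymon (fun v => if v \in N' then node_count N v else 0%N))).
  by congr (I _); rewrite /K /t; ring.
have Ib1 : I (K * R * t ^+ (r - 2)).
  rewrite /R mulr_sumr mulr_suml; apply: I_sum => V /andP[pSV VT].
  apply: Ib => //; first exact: proper_sub.
  have /negbTE-> : V != S by apply: contraTneq pSV => ->; rewrite properxx.
  by move: r_gt1; clear; lia.
have Ic1 : I (K * (gx S + R) * t ^+ (r - 1)).
  rewrite mulrDr mulrDl; apply: ID.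
    by apply: Ib => //; rewrite eqxx; move: r_gt1; clear; lia.
  rewrite /R mulr_sumr mulr_suml; apply: I_sum => V /andP[pSV VT].
  apply: Ib => //; first exact: proper_sub.
  by case: (V == S); move: r_gt1; clear; lia.
rewrite EN EN' -/y -/t.
have -> : (r + s - 3 = (r - 2) + (s - 2).+1)%N by move: r_gt1 s_gt1; clear; lia.
have Es : (s - 1 = (s - 2).+1)%N by move: s_gt1; clear; lia.
have Er : (r - 1 = (r - 2).+1)%N by move: r_gt1; clear; lia.
rewrite Es in Ia; rewrite Er in Ic1; move: (s - 2)%N (r - 2)%N Ia Ib1 Ic1 => s' r'.
move=> Ia Ib1 Ic1; have Eg : gx S = y - t - R by rewrite yE; ring.
have -> : K * gx S * y ^+ s' * t ^+ r' + K * t ^+ (r' + s'.+1) =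
   t ^+ r' * (K * y ^+ s'.+1) - y ^+ s' * (K * R * t ^+ r')
   - K * t ^+ r'.+1 * (y ^+ s' - t ^+ s').
  by rewrite Eg exprD !exprS; ring.
apply: ID; last first.
  apply: IN; rewrite subrXX.
  have -> : y - t = gx S + R by rewrite yE; ring.
  by rewrite mulrA; apply: IMr; rewrite mulrAC.
apply: ID; first exact: IM.
by apply: IN; apply: IM.
Qed.

End RemoveMaximal.

Lemma diag_monE N : laminar N -> {in N, forall B, (1 < #|B|)%N} ->
  setT \notin N -> I (diag_mon N - (-1) ^+ #|N| * gy setT ^+ (#|T| - 2)).
Proof.
have [n] := ubnP #|N|; elim: n => // n IHn in N *.
rewrite ltnS => leNn lamN N1 NT; have [N0|[B0 NB0]] := set_0Vmem N.
  rewrite N0 cards0 mul1r /diag_mon.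
  have -> : xprod set0 = 1 by rewrite /xprod big1 // => B; rewrite inE.
  rewrite mul1r -ymon_single (@eq_ymon _ (fun S => (#|T| - 2) * single setT S)%N).
    by rewrite subrr.
  move=> v; rewrite /node_count /single !inE orbF; case: eqP => [->|_].
    by rewrite card_blocks0 muln1.
  by rewrite muln0.
case: (@arg_maxnP _ B0 (fun B => B \in N) (fun B => #|B|) NB0) => S NS S_max.
have cN := cardsD1 S N; rewrite NS /= add1n in cN.
have lam' : laminar (N :\ S) by apply: laminarS lamN; apply: subsetDl.
have h : I (diag_mon (N :\ S) - (-1) ^+ #|N :\ S| * gy setT ^+ (#|T| - 2)).
  apply: IHn => //; first by rewrite -cN.
    by move=> B; rewrite inE => /andP[_ /N1].
  by rewrite !inE (negbTE NT) andbF.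
rewrite cN exprS mulN1r mulNr opprK.
have h' := diag_mon_remove lamN NS N1 NT S_max.
move: (_ * gy setT ^+ _) (diag_mon (N :\ S)) h h' => p q h h'.
have -> : diag_mon N + p = (diag_mon N + q) - (q - p) by ring.
by apply: ID => //; apply: IN.
Qed.

End Duality.

Lemma dual_mon_diag f : (1 < #|T|)%N -> std_exponent f ->
  ymon f * dual_mon f = diag_mon (supp f :\ setT).
Proof.
move=> T_gt1 stdf; rewrite /dual_mon /diag_mon mulrCA -ymonDf; congr (_ * _).
apply: eq_ymon => v; rewrite /faddf /defect /node_count blocks_setTD.
have -> : (v \in setT |: supp f :\ setT) = (v \in setT |: supp f).
  by rewrite !in_setU1 in_setD1; case: eqP.
case: ifP => [Nv|].
  by have := std_defect T_gt1 stdf Nv; move: (f v) #|_| => a b; clear; lia.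
by rewrite !inE => /norP[_]; rewrite -leqNgt leqn0 => /eqP->.
Qed.

End NestedRing.

(** * The degree functional *)

Section HallCondition.

Variable T : finType.
Implicit Types (e : {set T} -> nat) (P Q W : {set T}).

(* Equivalent to the condition on unions of sets [S_i] when [e W] is the number
   of [S_i] contained in [W]. *)
Definition hall e := [forall W : {set T}, (0 < e W) ==> (e W + 2 <= #|W|)]%N.

(** The contribution of one more factor [y_P] to the count of sets inside [W]. *)
Definition above P W : nat := (P \subset W).

Definition supermodular e :=
  forall W1 W2, (e W1 + e W2 <= e (W1 :|: W2) + e (W1 :&: W2))%N.

Lemma hallE e P Q :
  hall (fun W => e W + above P W + above Q W)%N =
  [&& hall e,
      [forall W : {set T}, (P \subset W) ==> (e W + 3 <= #|W|)%N],
      [forall W : {set T}, (Q \subset W) ==> (e W + 3 <= #|W|)%N]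
    & [forall W : {set T}, (P :|: Q \subset W) ==> (e W + 4 <= #|W|)%N]].
Proof.
rewrite /above; apply/forallP/and4P.
  move=> h; split; apply/forallP=> W; apply/implyP; have /implyP := h W.
  - by case: (P \subset W); case: (Q \subset W) => /=; lia.
  - by move=> h1 h2; move: h1; rewrite h2 /=; case: (Q \subset W) => /=; lia.
  - by move=> h1 h2; move: h1; rewrite h2 /=; case: (P \subset W) => /=; lia.
  - by rewrite subUset => h1 /andP[h2 h3]; move: h1; rewrite h2 h3 /=; lia.
case=> /forallP he /forallP hP /forallP hQ /forallP hPQ W; apply/implyP.
move: (implyP (he W)) (implyP (hP W)) (implyP (hQ W)) (implyP (hPQ W)).
rewrite subUset; case: (P \subset W); case: (Q \subset W) => /=.
- by move=> _ _ _ /(_ isT); lia.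
- by move=> _ /(_ isT); lia.
- by move=> _ _ /(_ isT); lia.
- by rewrite !addn0.
Qed.

(** All four unions equal [P :|: Q], so only the conditions above each single set vary, and the
    identity says that a product of two differences is 0. The condition above [P] implies the one
    above [s |: P], and likewise for [Q]; by supermodularity, sets violating those above [P] and
    above [Q] cannot both exist. *)
Lemma hall_exchange e P Q s t u : supermodular e ->
  u \in P -> u \in Q -> s \in Q -> t \in P ->
  (hall (fun W => e W + above P W + above Q W) +
   hall (fun W => e W + above (s |: P) W + above (t |: Q) W) =
   hall (fun W => e W + above (s |: P) W + above Q W) +
   hall (fun W => e W + above P W + above (t |: Q) W))%N.
Proof.
move=> sup Pu Qu Qs Pt; rewrite !hallE.
have -> : s |: P :|: (t |: Q) = P :|: Q.
  apply/setP=> w; rewrite !inE; case: eqP => [->|_]; case: eqP => [->|_];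
  by rewrite ?Qs ?Pt /= ?orbT.
have -> : s |: P :|: Q = P :|: Q.
  by apply/setP=> w; rewrite !inE; case: eqP => [->|_]; rewrite ?Qs /= ?orbT.
have -> : P :|: (t |: Q) = P :|: Q.
  by apply/setP=> w; rewrite !inE; case: eqP => [->|_]; rewrite ?Pt /= ?orbT.
set c := [forall W : {set T}, (P :|: Q \subset W) ==> _].
pose al P := [forall W : {set T}, (P \subset W) ==> (e W + 3 <= #|W|)%N].
rewrite -/(al P) -/(al Q) -/(al (s |: P)) -/(al (t |: Q)).
have alS P1 w : al P1 -> al (w |: P1).
  move=> /forallP h; apply/forallP=> W; apply/implyP; rewrite subUset => /andP[_].
  exact/implyP.
have [/forallP he|] := boolP (hall e); last by [].
have [/forallP hc|] := boolP c; last by rewrite !andbF.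
have alPQ : al P || al Q.
  apply: contraT; rewrite negb_or => /andP[].
  rewrite negb_forall => /existsP[W1]; rewrite negb_imply -ltnNge => /andP[sP lt1].
  rewrite negb_forall => /existsP[W2]; rewrite negb_imply -ltnNge => /andP[sQ lt2].
  have := implyP (hc (W1 :|: W2)); rewrite setUSS // => /(_ isT) hU.
  have := sup W1 W2; have := cardsUI W1 W2; have := implyP (he (W1 :&: W2)).
  (* If [e] vanishes on the intersection, [hall] says nothing there, and the common point [u]
     provides the bound. *)
  have : (0 < #|W1 :&: W2|)%N.
    by rewrite card_gt0; apply/set0Pn; exists u; rewrite inE (subsetP sP) // (subsetP sQ).
  by move: hU lt1 lt2; move: #|W1 :|: W2| #|W1 :&: W2| => a b; lia.
move: (alS P s) (alS Q t) alPQ; rewrite !andbT.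
case: (al P) => [/(_ isT)->|_].
  by case: (al Q) => [/(_ isT)-> _|_ _]; case: (al _).
by case: (al Q) => // /(_ isT)-> _; case: (al _).
Qed.

End HallCondition.

(** * The linear form defined by the Hall condition *)

Section DegreeFunctional.

Variables (T : finType) (m : nat) (vs : 'I_m -> {set T}).
Hypothesis vs_inj : injective vs.
Hypothesis vs_gt1 : forall i, (1 < #|vs i|)%N.
Hypothesis vs_surj : forall S : {set T}, (1 < #|S|)%N -> exists i, vs i = S.

Local Notation A := {mpoly rat[m]}.
Implicit Types (S U W : {set T}) (mm : 'X_{1..m}) (p q : A).

(** Extends the variables to all sets, with value 0 on those with at most one point. *)
Definition xvar S : A := \sum_(i | vs i == S) 'X_i.

Lemma xvarE i : xvar (vs i) = 'X_i.
Proof. by rewrite /xvar (big_pred1 i) // => j; rewrite /= (inj_eq vs_inj). Qed.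

Lemma xvar_small S : (#|S| <= 1)%N -> xvar S = 0.
Proof.
move=> S1; rewrite /xvar big_pred0 // => i; apply/eqP=> iS.
by have := vs_gt1 i; rewrite iS ltnNge S1.
Qed.

Lemma sum_xvar (V : nmodType) (F : A -> V) (P : pred {set T}) : F 0 = 0 ->
  \sum_(S | P S) F (xvar S) = \sum_(i | P (vs i)) F 'X_i.
Proof.
move=> F0; rewrite (bigID (fun S => 1 < #|S|)%N) /= [X in _ + X]big1 ?addr0.
  rewrite [RHS](partition_big vs (fun S => P S && (1 < #|S|)%N)) => [|i] /=.
    apply: eq_bigr => S /andP[PS S1]; have [i iS] := vs_surj S1; subst S.
    rewrite xvarE (big_pred1 i) // => j /=; rewrite (inj_eq vs_inj).
    by case: eqP => [->|_]; rewrite ?PS ?andbF.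
  by rewrite vs_gt1 => ->.
by move=> S /andP[_]; rewrite -leqNgt => /xvar_small->.
Qed.

(* [mobius k i] expresses [xvar (vs i)] through the [gy (vs j)], written ['X_j];
   [k] is a recursion bound, large enough when it exceeds [#|T| - #|vs i|]. *)
Fixpoint mobius (k : nat) (i : 'I_m) : A :=
  if k is k'.+1 then 'X_i - \sum_(j | vs i \proper vs j) mobius k' j else 0.

Lemma mobius_stable k k' i : (#|T| - #|vs i| < k)%N -> (#|T| - #|vs i| < k')%N ->
  mobius k i = mobius k' i.
Proof.
elim: k k' i => // k IHk [//|k'] i /= ltk ltk'; congr (_ - _).
apply: eq_bigr => j /proper_card lt_ij.
have le_jT : (#|vs j| <= #|T|)%N by apply: max_card.
by apply: IHk; move: ltk ltk' lt_ij le_jT; move: #|T| #|vs i| #|vs j| => t a b;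
  clear; lia.
Qed.

Definition zvar i : A := mobius #|T|.+1 i.

Lemma zvar_sum i : \sum_(j | vs i \subset vs j) zvar j = 'X_i.
Proof.
rewrite (bigD1 i) //= {1}/zvar /=.
have -> : \sum_(j | (vs i \subset vs j) && (j != i)) zvar j =
          \sum_(j | vs i \proper vs j) mobius #|T| j.
  apply: eq_big => [j|j /andP[sij nij]].
    by rewrite properEneq andbC (inj_eq vs_inj) eq_sym.
  apply: mobius_stable; first by rewrite ltnS leq_subr.
  by rewrite ltn_subrL (ltn_trans _ (vs_gt1 j)) // (leq_trans (ltnW (vs_gt1 j))) // max_card.
by rewrite subrK.
Qed.

(** Change of variables, after which ['X_i] stands for [gy xvar (vs i)]. *)
Definition yx (p : A) : A := p \mPo [tuple zvar i | i < m].

Lemma yxX i : yx 'X_i = zvar i.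
Proof. by rewrite /yx comp_mpolyXU -tnth_nth tnth_mktuple. Qed.

Lemma yxD p q : yx (p + q) = yx p + yx q. Proof. exact: comp_mpolyD. Qed.

Lemma yxM p q : yx (p * q) = yx p * yx q. Proof. exact: rmorphM. Qed.

Lemma yx_sum (J : Type) (r : seq J) (P : pred J) (F : J -> A) :
  yx (\sum_(j <- r | P j) F j) = \sum_(j <- r | P j) yx (F j).
Proof. exact: raddf_sum. Qed.

Lemma gy_xvar S : gy xvar S = \sum_(j | S \subset vs j) 'X_j.
Proof. exact: (sum_xvar (F := id)). Qed.

Lemma yx_gy i : yx (gy xvar (vs i)) = 'X_i.
Proof.
by rewrite gy_xvar yx_sum -(zvar_sum i); apply: eq_bigr => j _; apply: yxX.
Qed.

Definition load mm W : nat := (\sum_(i | vs i \subset W) mm i)%N.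

(** The Hall condition on the whole set bounds the degree by [#|T| - 2], so the truncation loses no
    nonzero value. *)
Definition hallL (p : A) : rat :=
  \sum_(mm : 'X_{1..m < #|T|.+1}) p@_mm * (hall (load mm))%:R.

Lemma hallLD p q : hallL (p + q) = hallL p + hallL q.
Proof.
by rewrite /hallL -big_split; apply: eq_bigr => mm _; rewrite mcoeffD mulrDl.
Qed.

Lemma hallLZ c p : hallL (c *: p) = c * hallL p.
Proof.
by rewrite /hallL mulr_sumr; apply: eq_bigr => mm _; rewrite mcoeffZ mulrA.
Qed.

Lemma hallL0 : hallL 0 = 0.
Proof. by rewrite -(scale0r 0) hallLZ mul0r. Qed.

Lemma hallL_sum (J : Type) (r : seq J) (P : pred J) (F : J -> A) :
  hallL (\sum_(j <- r | P j) F j) = \sum_(j <- r | P j) hallL (F j).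
Proof. exact: (big_morph _ hallLD hallL0). Qed.

Lemma loadD mm mm' W : load (mm + mm')%MM W = (load mm W + load mm' W)%N.
Proof. by rewrite /load -big_split /=; apply: eq_bigr => i _; rewrite mnmDE. Qed.

Lemma loadU i W : load U_(i) W = above (vs i) W.
Proof.
rewrite /load /above; have [iW|niW] := boolP (vs i \subset W).
  rewrite (bigD1 i) //= mnm1E eqxx big1 // => j /andP[_ /negbTE nij].
  by rewrite mnm1E eq_sym nij.
rewrite big1 // => j jW; rewrite mnm1E; case: eqP => // ij.
by rewrite ij jW in niW.
Qed.

Lemma load_setT mm : load mm setT = mdeg mm.
Proof. by rewrite mdegE; apply: eq_bigl => i; rewrite subsetT. Qed.

Lemma load_supermodular mm : supermodular (load mm).
Proof.
move=> W1 W2; rewrite /load !(big_mkcond (fun i => vs i \subset _)) -!big_split /=; apply: leq_sum => i _.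
rewrite subsetI; have [s1|_] := boolP (vs i \subset W1).
  rewrite (subset_trans s1 (subsetUl _ _)) /=.
  by case: (vs i \subset W2).
have [s2|_] := boolP (vs i \subset W2); last by case: ifP.
by rewrite (subset_trans s2 (subsetUr _ _)) add0n addn0.
Qed.

Lemma eq_hall (e e' : {set T} -> nat) : e =1 e' -> hall e = hall e'.
Proof. by move=> ee'; apply: eq_forallb => W; rewrite ee'. Qed.

Lemma hallLX mm : hallL 'X_[mm] = (hall (load mm))%:R.
Proof.
rewrite /hallL; have [lt_mm|ge_mm] := ltnP (mdeg mm) #|T|.+1.
  rewrite (bigD1 (BMultinom lt_mm)) //= mcoeffX eqxx mul1r big1 ?addr0 // => b nb.
  rewrite mcoeffX; case: eqP => [eb|_]; last by rewrite mul0r.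
  by case/eqP: nb; apply: val_inj.
rewrite big1 => [|b _]; last first.
  rewrite mcoeffX; case: eqP => [eb|_]; last by rewrite mul0r.
  by have := bmdeg b; rewrite -eb ltnNge ge_mm.
suff /negbTE-> : ~~ hall (load mm) by [].
apply/forallPn; exists setT; rewrite load_setT cardsT negb_imply -ltnNge.
by move: ge_mm; clear; lia.
Qed.

Lemma hallLX2 mm i j : hallL ('X_[mm] * 'X_i * 'X_j) =
  (hall (fun W => load mm W + above (vs i) W + above (vs j) W)%N)%:R.
Proof.
rewrite -!mpolyXD hallLX; congr (nat_of_bool _)%:R; apply: eq_hall => W.
by rewrite !loadD !loadU.
Qed.

(* ['X_j] stands for [gy (vs j)], whose difference with [gy (s |: vs j)] is the
   sum of the [xvar U] over [U] containing [vs j] but not [s]. *)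
Lemma zvar_kill (F : A -> rat) (s : T) i :
  (forall p q, F (p + q) = F p + F q) -> s \notin vs i ->
  (forall j k, vs i \subset vs j -> s \notin vs j -> vs k = s |: vs j ->
     F 'X_j = F 'X_k) -> F (zvar i) = 0.
Proof.
move=> FD; have F0 : F 0 = 0.
  by apply: (addrI (F 0)); rewrite -FD !addr0.
have Fsum := big_morph F FD F0.
have [n] := ubnP (#|T| - #|vs i|); elim: n => // n IHn in i *.
rewrite ltnS => le_n si Fx.
have [k kE] : exists k, vs k = s |: vs i.
  by apply: vs_surj; rewrite (leq_trans (vs_gt1 i)) // subset_leq_card ?subsetUr.
have := Fx i k (subxx _) si kE; rewrite -(zvar_sum i) -(zvar_sum k).
rewrite (bigID (fun j => s \in vs j)) /= [X in _ + X](bigD1 i) /= ?subxx //.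
have -> : \sum_(j | (vs i \subset vs j) && (s \in vs j)) zvar j =
          \sum_(j | vs k \subset vs j) zvar j.
  by apply: eq_bigl => j; rewrite kE subUset sub1set andbC.
rewrite FD -[X in _ = X]addr0 => /addrI; rewrite FD Fsum big1 ?addr0 //.
move=> j /andP[/andP[sij sj] nij].
have pij : vs i \proper vs j by rewrite properEneq (inj_eq vs_inj) eq_sym nij.
have le_jT : (#|vs j| <= #|T|)%N by apply: max_card.
apply: IHn => //.
  move: (proper_card pij) le_jT le_n; move: #|T| #|vs i| #|vs j| => t a b.
  by clear; lia.
by move=> j' k' sjj'; apply: Fx; apply: subset_trans sij sjj'.
Qed.

(** Two uses of [zvar_kill], with a point [s] of [vs j] outside [vs i] and a point [t] of [vs i]
    outside [vs j], reduce this to [hall_exchange]. *)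
Lemma hallL_cross mm i j : ~~ noncrossing (vs i) (vs j) ->
  hallL ('X_[mm] * zvar i * zvar j) = 0.
Proof.
rewrite /noncrossing !negb_or => /and3P[/subsetPn[t it jt] /subsetPn[s js is_]].
case/pred0Pn=> u /andP[/= iu ju].
apply: (@zvar_kill (fun p => hallL ('X_[mm] * p * zvar j)) s) => //.
  by move=> p q; cbv beta; rewrite (mulrDr _ p q) mulrDl hallLD.
move=> P P' siP sP EP'.
apply/eqP; rewrite -subr_eq0; apply/eqP.
pose F q := hallL ('X_[mm] * 'X_P * q) - hallL ('X_[mm] * 'X_P' * q).
rewrite -/(F (zvar j)); apply: (@zvar_kill F t) => //.
  by move=> p q; rewrite /F !(mulrDr _ p q) !hallLD opprD addrACA.
move=> Q Q' sjQ tQ EQ'; rewrite /F !hallLX2 EP' EQ'.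
have Pu := subsetP siP u iu; have Qu := subsetP sjQ u ju.
have := hall_exchange (load_supermodular mm) Pu Qu (subsetP sjQ s js) (subsetP siP t it).
move=> /(congr1 (fun k => k%:R : rat)); rewrite !natrD.
move=> h; apply: (canRL (addrK _)).
by rewrite addrAC h addrAC subrr add0r.
Qed.

Definition degD p : rat := hallL (yx p).

Lemma degDD p q : degD (p + q) = degD p + degD q.
Proof. by rewrite /degD yxD hallLD. Qed.

Lemma degDZ c p : degD (c *: p) = c * degD p.
Proof. by rewrite /degD /yx comp_mpolyZ hallLZ. Qed.

Lemma degD_mon_kill g : (forall mm, hallL ('X_[mm] * yx g) = 0) ->
  forall q, degD (q * g) = 0.
Proof.
move=> h q; rewrite /degD yxM [yx q]mpolyE mulr_suml hallL_sum big1_seq // => mm _.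
by rewrite -scalerAl hallLZ h mulr0.
Qed.

Lemma degD_cross S S' q : ~~ noncrossing S S' -> degD (q * (xvar S * xvar S')) = 0.
Proof.
move=> ncr; apply: degD_mon_kill => mm.
have [i iS] := vs_surj (crossing_gt1 ncr).
have [j jS] : exists j, vs j = S'.
  by apply: vs_surj; apply: (@crossing_gt1 _ _ S); rewrite noncrossing_sym.
by rewrite -iS -jS !xvarE yxM !yxX mulrA hallL_cross // iS jS.
Qed.

(** A factor [y] on a pair of points violates the Hall condition on that pair. *)
Lemma degD_edge x y q : x != y -> degD (q * gy xvar [set x; y]) = 0.
Proof.
move=> nxy; have [|i iE] := @vs_surj [set x; y]; first by rewrite cards2 nxy.
apply: degD_mon_kill => mm; rewrite -iE yx_gy -mpolyXD hallLX.
suff /negbTE-> : ~~ hall (load (mm + U_(i))%MM) by [].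
apply/forallPn; exists (vs i); rewrite loadD loadU /above subxx negb_imply.
have -> : #|vs i| = 2%N by rewrite iE cards2 nxy.
by rewrite -ltnNge; clear; lia.
Qed.

Lemma degD_top : (1 < #|T|)%N -> degD (gy xvar setT ^+ (#|T| - 2)) = 1.
Proof.
move=> T1; have [|i iE] := @vs_surj setT; first by rewrite cardsT.
have yxX' k : yx (gy xvar setT ^+ k) = 'X_[U_(i) *+ k].
  rewrite -mpolyXn -yx_gy iE; elim: k => [|k IHk]; last by rewrite !exprS yxM IHk.
  by rewrite !expr0 /yx comp_mpoly1.
rewrite /degD yxX' hallLX; suff -> : hall (load (U_(i) *+ (#|T| - 2))%MM) by [].
apply/forallP=> W; have -> : load (U_(i) *+ (#|T| - 2))%MM W =
   ((#|T| - 2) * above setT W)%N.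
  rewrite -iE -loadU /load big_distrr /=; apply: eq_bigr => j _.
  by rewrite mulmnE mulnC.
rewrite /above subTset; case: eqP => [->|_]; last by rewrite muln0.
by rewrite cardsT muln1 subnK ?leqnn ?implybT.
Qed.

End DegreeFunctional.

(** * The Hilbert series *)

Section HilbertSeries.

Variable T : finType.
Hypothesis T_gt1 : (1 < #|T|)%N.

(** Standard exponents are bounded by [#|T|], so they can be counted in a finite type. *)
Definition exponent := {ffun {set T} -> 'I_#|T|.+1}.

Definition expf (a : exponent) (S : {set T}) : nat := a S.

Definition std_bool (a : exponent) : bool :=
  laminar_on setT (supp (expf a)) &&
  [forall S, (0 < expf a S) ==> (expf a S + 2 <= #|blocks (supp (expf a)) S|)]%N.

Lemma std_boolP a : reflect (std_exponent (expf a)) (std_bool a).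
Proof.
apply: (iffP andP) => -[lam h]; split=> //.
  by move=> S aS; apply: implyP (forallP h S) aS.
by apply/forallP=> S; apply/implyP; apply: h.
Qed.

Lemma std_expf f : std_exponent f -> exists2 a, std_bool a & expf a =1 f.
Proof.
move=> stdf; have [lam le] := stdf.
have fle S : (f S < #|T|.+1)%N.
  have [->//|/le leS] := posnP (f S); rewrite ltnS.
  apply: leq_trans (leq_addr 2 _) (leq_trans leS _).
  by apply: leq_trans (leq_imset_card _ _) (max_card _).
pose a : exponent := [ffun S => inord (f S)].
have aE : expf a =1 f by move=> S; rewrite /expf ffunE inordK.
exists a => //; apply/std_boolP.
have sE : supp (expf a) = supp f by apply/setP=> S; rewrite !inE aE.
by split; rewrite sE // => S; rewrite aE; apply: le.
Qed.

(** Expanding the node weights chooses an exponent at each node; a set outside the forest gets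
    exponent 0. *)
Lemma nested_poly_std :
  nested_poly [set: T] = \sum_(a | std_bool a) 'X^(degf (expf a)).
Proof.
rewrite /nested_poly (partition_big (fun a => supp (expf a)) (laminar_on setT)) => [|a].
  apply: eq_bigr => N lamN; rewrite /nested_weight.
  pose Q S := [pred j : 'I_#|T|.+1 | if S \in N then
     (0 < j < #|blocks N S|.-1)%N else j == ord0].
  transitivity (\prod_S \sum_(j in Q S) ('X^j : {poly rat})).
    rewrite big_mkcond /=; apply: eq_bigr => S _; case: ifP => NS; last first.
      rewrite (big_pred1 ord0) ?expr0 // => j; by rewrite inE NS.
    rewrite /node_weight.
    have le : (#|blocks N S|.-1 <= #|T|.+1)%N.
      apply: leq_trans (leq_pred _) (leq_trans (leq_imset_card _ _) _).
      by apply: leqW; apply: max_card.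
    rewrite (big_nat_widen _ _ _ _ _ le) (big_nat_widenl _ 0) // big_mkord.
    by apply: eq_bigl => j; rewrite inE NS /= andbC.
  rewrite bigA_distr_big_dep; apply: eq_big => [f|f _]; last first.
    by rewrite /degf -expr_sum.
  apply/familyP/andP.
    move=> fQ; have sN : supp (expf f) = N.
      apply/setP=> S; rewrite inE; have := fQ S; rewrite inE /expf.
      by case: (S \in N) => [/andP[->]//|/eqP->].
    rewrite sN eqxx; split=> //; apply/andP; split; first by rewrite sN.
    apply/forallP=> S; apply/implyP=> fS; have := fQ S; rewrite inE.
    have -> : S \in N by rewrite -sN inE.
    by case/andP=> _; rewrite sN /expf; move: (nat_of_ord (f S)) #|blocks _ _| => a b; clear; lia.
  case=> /andP[_ /forallP h] /eqP sN S; rewrite inE -sN inE.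
  have := h S; rewrite /expf; case: (posnP (f S)) => [f0 _|f0 /=].
    by apply/eqP/val_inj.
  by rewrite /expf; move: (nat_of_ord (f S)) #|blocks _ _| => a b; clear; lia.
by case/andP.
Qed.

Variables (m : nat) (vs : 'I_m -> {set T}).
Hypothesis vs_inj : injective vs.
Hypothesis vs_gt1 : forall i, (1 < #|vs i|)%N.
Hypothesis vs_surj : forall S : {set T}, (1 < #|S|)%N -> exists i, vs i = S.

Local Notation A := {mpoly rat[m]}.
Local Notation gx := (xvar vs).

Variable gen : A -> Prop.
(** Two-sided comparison with the crossing and edge relations: [genP] makes the form vanish on the
    ideal, and the next two hypotheses supply the relations behind spanning and duality. *)
Hypothesis genP : forall g, gen g ->
  (exists S S' q, ~~ noncrossing S S' /\ g = q * (gx S * gx S')) \/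
  (exists x y : T, x != y /\ g = gy gx [set x; y]).
Hypothesis gen_cross : forall S S', ~~ noncrossing S S' ->
  ideal_of gen (gx S * gx S').
Hypothesis gen_edge : forall x y : T, x != y -> ideal_of gen (gy gx [set x; y]).

Let I := ideal_of gen.
Let I0 : I 0 := @ideal_of0 _ gen.
Let ID : forall a b, I a -> I b -> I (a + b) := @ideal_ofD _ gen.
Let IM : forall a b, I b -> I (a * b) := @ideal_ofM _ gen.

Lemma degD_ideal p : I p -> degD vs p = 0.
Proof.
case=> k [q [g [gg ->]]]; rewrite /degD yx_sum hallL_sum big1 // => j _.
change (degD vs (q j * g j) = 0); case: (genP (gg j)) => [[S [S' [q' [ncr ->]]]]|[x [y [nxy ->]]]].
  by rewrite (mulrA (q j)); apply: degD_cross.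
exact: degD_edge.
Qed.

Lemma gy_homog S : gy gx S \is 1.-homog.
Proof.
rewrite (gy_xvar vs_inj) //; apply: rpred_sum => i _.
by rewrite dhomogX; apply/eqP; apply: mdeg1.
Qed.

Lemma ymon_homog f : ymon gx f \is (degf f).-homog.
Proof.
rewrite /ymon /degf; elim/big_rec2: _ => [|S d p _ hp]; first exact: dhomog1.
by apply: dhomogM => //; have := dhomogMn (f S) (gy_homog S); rewrite mul1n.
Qed.

Lemma mpolyX_xvar_seq (mm : 'X_{1..m}) : exists s : seq {set T},
  [/\ all (fun S : {set T} => 1 < #|S|)%N s, size s = mdeg mm
    & 'X_[mm] = \prod_(S <- s) gx S].
Proof.
rewrite mpolyXE_id mdegE.
elim/big_rec2: _ => [|i d p _ [s [s1 ss ->]]]; first by exists [::]; rewrite big_nil.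
exists (nseq (mm i) (vs i) ++ s); rewrite all_cat all_nseq vs_gt1 orbT s1.
rewrite size_cat size_nseq ss big_cat /=; split=> //; congr (_ * _).
elim: (mm i) => [|k IHk]; first by rewrite big_nil.
by rewrite /= big_cons -IHk exprS (xvarE vs_inj).
Qed.

Section Degree.

Variable d : nat.

Let Bd : {set exponent} := [set a | std_bool a && (degf (expf a) == d)].

Let b (j : 'I_#|Bd|) : A := ymon gx (expf (enum_val j)).

Let Sp (p : A) := exists c : 'I_#|Bd| -> rat, I (p - \sum_j c j *: b j).

Lemma Bd_std (j : 'I_#|Bd|) :
  std_exponent (expf (enum_val j)) /\ degf (expf (enum_val j)) = d.
Proof.
have := enum_valP j; rewrite inE => /andP[/std_boolP h /eqP e].
by split.
Qed.

Lemma SpI p : I p -> Sp p.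
Proof.
move=> Ip; exists (fun=> 0); rewrite big1 ?subr0 // => j _.
by rewrite scale0r.
Qed.

Lemma SpL e p q : Sp p -> Sp q -> Sp (p + e *: q).
Proof.
move=> [c1 h1] [c2 h2]; exists (fun j => c1 j + e * c2 j).
have -> : p + e *: q - \sum_j (c1 j + e * c2 j) *: b j =
   (p - \sum_j c1 j *: b j) + e%:MP * (q - \sum_j c2 j *: b j).
  rewrite mulrBr !mul_mpolyC scaler_sumr addrACA -opprD -big_split /=.
  by congr (_ - _); apply: eq_bigr => j _; rewrite scalerDl scalerA.
by apply: ID => //; apply: IM.
Qed.

Lemma Sp_std f : std_exponent f -> degf f = d -> Sp (ymon gx f).
Proof.
move=> /std_expf[a stda aE] fd.
have aB : a \in Bd.
  by rewrite inE stda; apply/eqP; rewrite -fd; apply: eq_bigr => S _; apply: aE.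
exists (fun j => (j == enum_rank_in aB a)%:R).
rewrite (bigD1 (enum_rank_in aB a)) //= eqxx scale1r big1 ?addr0 => [|j /negbTE->].
  by rewrite /b enum_rankK_in // (eq_ymon _ aE) subrr.
by rewrite scale0r.
Qed.

Lemma Sp_homog p : p \is d.-homog -> Sp p.
Proof.
move=> hp; rewrite [p]mpolyE.
have SpB a c : Sp a -> Sp c -> Sp (a - c).
  by move=> ha hc; rewrite -scaleN1r; apply: SpL.
have Spy f : supp_gt1 f -> degf f = d -> Sp (ymon gx f).
  exact: (Sp_ymon I0 ID IM gen_cross gen_edge SpI SpB Sp_std).
rewrite big_seq; elim/big_rec: _ => [|mm q mmp hq]; first exact: SpI.
rewrite addrC; apply: SpL => //.
have [s [s1 ss ->]] := mpolyX_xvar_seq mm.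
have dmm : mdeg mm = d by move/dhomogP: hp => /(_ _ mmp).
have zd : degf (fun _ : {set T} => 0%N) = 0%N by rewrite /degf big1.
(* All monomials in the [y] variables are spanned by now, so the weight bound can be 0; the monomial
   in the [x] variables is replaced as a whole. *)
have := @Sp_replace T A I gx I0 d Sp SpI SpB 0 (fun h h1 h2 _ => Spy h h1 h2) s
  (fun=> 0%N).
have -> : ymon gx (fun=> 0%N) = 1 by rewrite /ymon big1.
rewrite zd mulr1 add0n ss => /(_ (fun S (h : (0 < 0)%N) => ltac:(by [])) s1 dmm (leq0n _)) h.
set F := faddf _ _ in h.
rewrite -[\prod_(_ <- _) _](subrK (ymon gx F)) -[ymon gx F]scale1r; apply: SpL.
  by rewrite scale1r.
apply: Spy.
  by move=> S; rewrite /F /faddf add0n -has_count has_pred1 => /(allP s1).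
rewrite /F degfD zd add0n -dmm -ss.
exact: degf_count.
Qed.

Lemma Bd_dual_neq0 (j : 'I_#|Bd|) :
  degD vs (b j * dual_mon gx (expf (enum_val j))) != 0.
Proof.
have [stdj _] := Bd_std j; rewrite /b dual_mon_diag //.
have [/laminar_onP[lamN N1] _] := stdj.
set N := supp _ in lamN N1 *.
have sN : N :\ setT \subset N := subsetDl _ _.
have h1 : laminar (N :\ setT) by apply: laminarS lamN.
have h2 : {in N :\ setT, forall B : {set T}, (1 < #|B|)%N}.
  by move=> B /(subsetP sN)/N1[].
have h3 : setT \notin N :\ setT by rewrite !inE eqxx.
have /degD_ideal := diag_monE I0 ID IM gen_cross gen_edge T_gt1 h1 h2 h3.
have degDN q : degD vs (- q) = - degD vs q.
  by rewrite -scaleN1r degDZ mulN1r.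
rewrite degDD degDN => /eqP; rewrite subr_eq0 => /eqP->.
have := degD_top vs_inj vs_gt1 vs_surj T_gt1.
rewrite -signr_odd; case: odd; rewrite ?expr0 ?mul1r ?expr1 ?mulN1r ?degDN => ->.
  by rewrite oppr_eq0 oner_eq0.
exact: oner_neq0.
Qed.

(** The relation is paired with the dual of a monomial of least weight among those with nonzero
    coefficient; triangularity leaves only that term. *)
Lemma b_free (c : 'I_#|Bd| -> rat) : I (\sum_j c j *: b j) -> forall j, c j = 0.
Proof.
move=> Ic; have [j0 nz0|allz] := pickP (fun j => c j != 0); last first.
  by move=> j; apply/eqP; have := allz j => /negbFE.
pose w (j : 'I_#|Bd|) := wtf (expf (enum_val j)).
case: (@arg_minnP _ j0 (fun j => c j != 0) w nz0) => j nz minj.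
have /(IM (dual_mon gx (expf (enum_val j)))) /degD_ideal := Ic.
rewrite mulr_sumr /degD yx_sum hallL_sum (bigD1 j) //= big1 => [|j' nj'].
  rewrite addr0 -/(degD vs _) -scalerAr degDZ mulrC => /eqP.
  by rewrite mulf_eq0 [X in degD vs X]mulrC (negbTE (Bd_dual_neq0 j)) (negbTE nz).
rewrite -/(degD vs _) -scalerAr degDZ mulrC.
have [[stdj dj] [stdj' dj']] := (Bd_std j, Bd_std j').
have g1 : supp_gt1 (expf (enum_val j')).
  by move=> S aS; have [/laminar_onP[_ h] _] := stdj'; have [] := h S; rewrite ?inE.
have := dual_triangular I0 ID IM gen_cross gen_edge T_gt1 stdj g1.
rewrite dj dj' => /(_ erefl)[/degD_ideal|lt|eqf].
- by move=> h0; rewrite [X in degD vs X]mulrC h0 mul0r.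
- have [->|nz'] := eqVneq (c j') 0; first by rewrite mulr0.
  by have := minj j' nz'; rewrite /w leqNgt lt.
- case/eqP: nj'; apply: enum_val_inj; apply/ffunP=> S.
  by apply: val_inj; apply: eqf.
Qed.

Lemma quotient_dim : graded_quotient_dim I d #|Bd|.
Proof.
exists b; split.
- by move=> j; have [_ <-] := Bd_std j; apply: ymon_homog.
- exact: b_free.
- exact: Sp_homog.
Qed.

End Degree.

Lemma hilbert_series d : exists2 k, graded_quotient_dim I d k &
  (nested_poly [set: T])`_d = k%:R.
Proof.
exists #|[set a : exponent | std_bool a && (degf (expf a) == d)]|.
  exact: quotient_dim.
rewrite nested_poly_std coef_sum -sum1_card natr_sum.
rewrite (eq_bigr (fun a => (degf (expf a) == d)%:R)) => [|a _]; last first.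
  by rewrite coefXn eq_sym.
rewrite [RHS](eq_bigl (fun a => std_bool a && (degf (expf a) == d))) => [|a]; last first.
  by rewrite inE.
by rewrite [RHS]big_mkcondr; apply: eq_bigr => a _; case: eqP.
Qed.

End HilbertSeries.

Lemma ideal_of_gen (A : comNzRingType) (gen : A -> Prop) p :
  gen p -> ideal_of gen p.
Proof.
move=> gp; exists 1%N, (fun=> 1), (fun=> p); split=> //.
by rewrite big_ord_recl big_ord0 addr0 mul1r.
Qed.

Theorem theorem1p4 (n : nat) (hn : (2 <= n)%N) :
  is_M0bar_poincare n
    (\sum_(L : {set {set 'I_n.-1}} | partition L [set: 'I_n.-1])
       ((n.-1 + #|L|)`!%:R / (n.-1)`!%:R) *:
       \prod_(B in L) ((#|B|.+1)%:R^-1 *: chibar #|B|.+1)).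
Proof.
have n_gt0 : (0 < n)%N by apply: ltnW.
set P := \sum_(L | _) _.
have PE : P = nested_poly [set: 'I_n].
  rewrite nested_polyE; first by rewrite cardsT card_ord.
  by rewrite -card_gt0 cardsT card_ord.
rewrite PE /is_M0bar_poincare /is_FY_hilbert_series {P PE}.
set G := min_building_set _.
(* Recovers the vertex set of a clique from its edges, so that the variables can be indexed by
   vertex sets. *)
pose vsF (F : {set Kedge n}) : {set 'I_n} := \bigcup_(e in F) val e.
have vsK (S : {set 'I_n}) : (1 < #|S|)%N -> vsF (clique S) = S.
  move=> S1; apply/eqP; rewrite eqEsubset; apply/andP; split.
    by apply/bigcupsP=> e; rewrite inE.
  apply/subsetP=> u Su; have [v Sv nvu] := set_gt1_other u S1.
  have [e ev] := edge_ex nvu; apply/bigcupP; exists e.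
    by rewrite (mem_clique S ev) Sv.
  by rewrite ev !inE eqxx orbT.
pose vs (i : 'I_#|G|) : {set 'I_n} := vsF (enum_val i).
have vsP i : (1 < #|vs i|)%N /\ enum_val i = clique (vs i).
  by have [S S1 eS] := building_clique (enum_valP i); rewrite /vs eS vsK.
have vs_gt1 i : (1 < #|vs i|)%N by have [] := vsP i.
have enumE i : enum_val i = clique (vs i) by have [] := vsP i.
have vs_inj : injective vs.
  by move=> i j eij; apply: enum_val_inj; rewrite !enumE eij.
have vs_surj (S : {set 'I_n}) : (1 < #|S|)%N -> exists i, vs i = S.
  move=> S1; have GS := clique_building S1.
  by exists (enum_rank_in GS (clique S)); rewrite /vs enum_rankK_in // vsK.
have enum_in (S : {set 'I_n}) i : (1 < #|S|)%N ->
    (enum_val i == clique S) = (vs i == S).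
  move=> S1; rewrite enumE; apply/eqP/eqP => [|->//].
  exact: clique_inj.
have T1 : (1 < #|'I_n|)%N by rewrite card_ord.
have edge_gt1 (x y : 'I_n) : x != y -> (1 < #|[set x; y]|)%N.
  by move=> nxy; rewrite cards2 nxy.
have atomE (x y : 'I_n) : x != y -> gy (xvar vs) [set x; y] =
    \sum_(i < #|G| | clique [set x; y] \subset enum_val i) 'X_i.
  move=> nxy; rewrite (gy_xvar vs_inj vs_gt1 vs_surj); apply: eq_bigl => i.
  by rewrite enumE clique_sub // edge_gt1.
have prod2 (N : {set {set Kedge n}}) i j : i != j -> enum_val i \in N ->
    enum_val j \in N -> \prod_(k < #|G| | enum_val k \in N) ('X_k : {mpoly rat[#|G|]}) =
      (\prod_(k < #|G| | [&& enum_val k \in N, k != i & k != j]) 'X_k) *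
      (xvar vs (vs i) * xvar vs (vs j)).
  move=> nij Ni Nj; rewrite !xvarE // (bigD1 i) //= (bigD1 j) /=; last by rewrite Nj eq_sym.
  rewrite mulrA [RHS]mulrC; congr (_ * _).
  by apply: eq_bigl => k; rewrite andbA.
have neq_of_cross (U V : {set 'I_n}) : ~~ noncrossing U V -> U != V.
  by apply: contraNneq => ->; rewrite /noncrossing subxx.
apply: (hilbert_series T1 vs_inj vs_gt1 vs_surj).
(* The product over a non-nested family contains the variables of a crossing pair. *)
- move=> _ [N sN nN | F /flat_atomP[x [y [nxy ->]]]]; last first.
    by right; exists x, y; rewrite atomE.
  left; have [S [S' [ncr S1 S'1 NS NS']]] := not_nested_cross sN nN.
  have [[i iS] [j jS]] := (vs_surj S S1, vs_surj S' S'1).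
  exists S, S', (\prod_(k < #|G| | [&& enum_val k \in N, k != i & k != j]) 'X_k).
  split=> //; rewrite -iS -jS (prod2 N i j) // ?enumE ?iS ?jS //.
  by apply: contraNneq (neq_of_cross _ _ ncr) => ij; rewrite -iS -jS ij.
(* Conversely, a crossing pair is itself a non-nested family, and its product has no other
   factor. *)
- move=> S S' ncr; have S1 := crossing_gt1 ncr.
  have S'1 : (1 < #|S'|)%N by apply: (@crossing_gt1 _ _ S); rewrite noncrossing_sym.
  have [[i iS] [j jS]] := (vs_surj S S1, vs_surj S' S'1).
  have nij : i != j.
    by apply: contraNneq (neq_of_cross _ _ ncr) => ij; rewrite -iS -jS ij.
  have sN : [set clique S; clique S'] \subset G.
    by rewrite subUset !sub1set !clique_building.
  have := FY_nonnested sN (clique_cross_not_nested S1 S'1 ncr).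
  rewrite (prod2 _ i j) // ?enumE ?iS ?jS ?inE ?eqxx ?orbT //.
  rewrite big1 ?mul1r => [|k]; first exact: ideal_of_gen.
  rewrite !inE !enum_in // -iS -jS !(inj_eq vs_inj).
  by case: (k == i); case: (k == j).
- move=> x y nxy; rewrite atomE //; apply: ideal_of_gen; apply: FY_atom.
  by apply/flat_atomP; exists x, y.
Qed.
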